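(* Let $(\mathbf X^*,\mathbf y^* )\in\mathcal S_n\times\mathcal K$ be a saddle-point of $\min_{\mathbf X\in\mathcal S_n}\max_{\mathbf y\in\mathcal K}f(\mathbf X,\mathbf y)$ with $r^*=\mathrm{rank}(\mathbf X^* )\le n-1$, such that $\lambda_{n-r^*}(\nabla_{\mathbf X}f(\mathbf X^*,\mathbf y^* ))-\lambda_n(\nabla_{\mathbf X}f(\mathbf X^*,\mathbf y^* ))\ge\delta$ for some $\delta>0$. Let $\{(\mathbf X_t,\mathbf y_t)\}_{t\ge1}$ and $\{(\mathbf Z_t,\mathbf w_t)\}_{t\ge2}$ be the iterates generated by the low-rank mirror-prox method with approximated matrix exponentiated gradient updates (see context) with SVD rank parameter $r=r^*$ and fixed step-size $$\eta_t=\eta:=\min\left\{\frac1{\beta_X+\beta_{Xy}},\ \frac1{\beta_y+\beta_{yX}},\ \frac1{2\sqrt2\sqrt{\beta_X^2+\beta_{yX}^2}},\ \frac1{2\sqrt{\beta_y^2+\beta_{Xy}^2}}\right\}.$$ Let $G\ge\sup_{(\mathbf X,\mathbf y)\in\mathcal S_n\times\mathcal K}\|\nabla_{\mathbf X}f(\mathbf X,\mathbf y)\|_2$ and $$R_0:=\frac14\left(7\max\{\beta_X,\beta_{Xy}\}+\Big(1+\frac{2\sqrt{2r^*}}{\lambda_{r^*}(\mathbf X^* )}\Big)G\right)^{-1}\delta .$$ Suppose that for all $t\ge0$ $$\varepsilon_t=\min\left\{1,\ \min\left\{\frac{\tilde\varepsilon_0^2}{16\max\{G^2\eta^2,1\}},\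 \left(\frac{\delta}{16\sqrt2\max\{\beta_X,\beta_{Xy}\}(\sqrt5+\sqrt{\eta G})}\right)^4\right\}\frac1{(t+1+c)^3}\right\}$$ for some $0<\tilde\varepsilon_0\le R_0^2$ and some $c\ge\frac{12}{\eta\delta}$. Finally, assume that the initialization matrix $\mathbf X_0$ satisfies $\mathrm{rank}(\mathbf X_0)=r^*$, that $B_{\mathbf X}(\mathbf X^*,\mathbf X_1)\le\frac12R_0^2$, and that $B_{\mathbf y}(\mathbf y^*,\mathbf y_1)\le\frac12R_0^2$. Then for every integer $T\ge1$, $$\max_{\mathbf y\in\mathcal K}f\Big(\frac1T\sum_{t=1}^T\mathbf Z_{t+1},\mathbf y\Big)-\min_{\mathbf X\in\mathcal S_n}f\Big(\mathbf X,\frac1T\sum_{t=1}^T\mathbf w_{t+1}\Big)\le\frac{D^2}{\eta T}+\frac{\eta^{-1}+2(\beta_X+\beta_{yX})}{16\max\{G^2\eta^2,1\}}\frac{R_0^4}{T}+\frac{R_0^2}{\max\{\eta,1\}\,T},$$ where $D^2:=\sup_{(\mathbf X,\mathbf y)\in\mathcal S_n\times\mathcal K}\left(B_{\mathbf X}(\mathbf X,\mathbf X_1)+B_{\mathbf y}(\mathbf y,\mathbf y_1)\right)$.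
   Context: $\mathbb S^n$ is the space of real symmetric $n\times n$ matrices with inner product $\langle\mathbf A,\mathbf B\rangle=\mathrm{Tr}(\mathbf A\mathbf B)$; $\lambda_i(\mathbf X)$ is the $i$-th largest eigenvalue; $\|\cdot\|_2$ on matrices is the spectral norm and $\|\cdot\|_*$ the nuclear norm; $\mathcal S_n=\{\mathbf X\in\mathbb S^n:\mathrm{Tr}(\mathbf X)=1,\mathbf X\succeq0\}$; $\exp,\log$ are the matrix exponential and logarithm. $\mathbb V$ is a finite-dimensional real inner product space with a norm $\|\cdot\|_{\mathcal Y}$ and dual norm $\|\cdot\|_{\mathcal Y^*}$; $\mathcal K\subset\mathbb V$ is nonempty, compact and convex. $f:\mathbb S^n\times\mathbb V\to\mathbb R$ is differentiable, $f(\cdot,\mathbf y)$ is convex for all $\mathbf y\in\mathcal K$, $f(\mathbf X,\cdot)$ is concave on $\mathcal K$ for all $\mathbf X\in\mathcal S_n$, and $\beta_X,\beta_y,\beta_{Xy},\beta_{yX}\ge0$ are such that for all $\mathbf X,\tilde{\mathbf X}\in\mathcal S_n$, $\mathbf y,\tilde{\mathbf y}\in\mathcal K$: $\|\nabla_{\mathbf X}f(\mathbf X,\mathbf y)-\nabla_{\mathbf X}f(\tilde{\mathbf X},\mathbf y)\|_2\le\beta_X\|\mathbf X-\tilde{\mathbf X}\|_*$, $\|\nabla_{\mathbf y}f(\mathbf X,\mathbf y)-\nabla_{\mathbf y}f(\mathbf X,\tilde{\mathbf y})\|_{\mathcal Y^*}\le\beta_y\|\mathbf y-\tilde{\mathbf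 y}\|_{\mathcal Y}$, $\|\nabla_{\mathbf X}f(\mathbf X,\mathbf y)-\nabla_{\mathbf X}f(\mathbf X,\tilde{\mathbf y})\|_2\le\beta_{Xy}\|\mathbf y-\tilde{\mathbf y}\|_{\mathcal Y}$, $\|\nabla_{\mathbf y}f(\mathbf X,\mathbf y)-\nabla_{\mathbf y}f(\tilde{\mathbf X},\mathbf y)\|_{\mathcal Y^*}\le\beta_{yX}\|\mathbf X-\tilde{\mathbf X}\|_*$. Convention: $1/0=+\infty$, and the $\beta$'s are not all zero, so that $\eta$ is a positive real number. A saddle-point is $(\mathbf X^*,\mathbf y^* )\in\mathcal S_n\times\mathcal K$ with $f(\mathbf X^*,\mathbf y)\le f(\mathbf X^*,\mathbf y^* )\le f(\mathbf X,\mathbf y^* )$ for all $\mathbf X\in\mathcal S_n,\mathbf y\in\mathcal K$. Bregman distances: $B_{\mathbf X}(\mathbf X,\tilde{\mathbf X})=\mathrm{Tr}(\mathbf X\log\mathbf X-\mathbf X\log\tilde{\mathbf X})$ for $\mathbf X,\tilde{\mathbf X}\in\mathcal S_n$, $\tilde{\mathbf X}\succ0$ (with $0\log0:=0$). $B_{\mathbf y}(\mathbf y,\tilde{\mathbf y})=\omega_{\mathbf y}(\mathbf y)-\omega_{\mathbf y}(\tilde{\mathbf y})-\langle\mathbf y-\tilde{\mathbf y},\nabla\omega_{\mathbf y}(\tilde{\mathbf y})\rangle$, where $\omega_{\mathbf y}$ is a real-valued function on $\mathcal K$, 1-strongly convex with respect to $\|\cdot\|_{\mathcal Y}$ and continuously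 differentiable (at all points at which its gradient is evaluated below, in particular $\mathbf y_1$ and all minimizers in the dual steps), so that $B_{\mathbf y}(\mathbf y,\tilde{\mathbf y})\ge\frac12\|\mathbf y-\tilde{\mathbf y}\|_{\mathcal Y}^2$. Low-rank mirror-prox with approximated MEG updates. Input: step-sizes $\{\eta_t\}_{t\ge1}$, $\{\varepsilon_t\}_{t\ge0}\subset[0,1]$, rank parameter $r\in\{1,\dots,n-1\}$, $\mathbf X_0\in\mathcal S_n$ with $\mathrm{rank}(\mathbf X_0)=r$, $\mathbf y_1\in\mathcal K$. Set $\mathbf X_1=(1-\varepsilon_0)\mathbf X_0+\frac{\varepsilon_0}n\mathbf I$. For $t=1,2,\dots$: - $\mathbf P_t=\exp(\log(\mathbf X_t)-\eta_t\nabla_{\mathbf X}f(\mathbf X_t,\mathbf y_t))$; let $\mathbf P_t^r=\mathbf V_{\mathbf P}^r\boldsymbol\Lambda_{\mathbf P}^r{\mathbf V_{\mathbf P}^r}^\top$ be its rank-$r$ approximation (top $r$ eigen-components, $\mathbf V^r_{\mathbf P}\in\mathbb R^{n\times r}$ with orthonormal columns); - $\mathbf Z_{t+1}=(1-\varepsilon_t)\frac{\mathbf P_t^r}{\mathrm{Tr}(\mathbf P_t^r)}+\frac{\varepsilon_t}{n-r}(\mathbf I-\mathbf V_{\mathbf P}^r{\mathbf V_{\mathbf P}^r}^\top)$; - $\mathbf w_{t+1}=\arg\min_{\mathbf y\in\mathcal K}\{\langle-\eta_t\nabla_{\mathbf y}f(\mathbf X_t,\mathbf y_t),\mathbf y\rangle+B_{\mathbf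 y}(\mathbf y,\mathbf y_t)\}$; - $\mathbf B_t=\exp(\log(\mathbf X_t)-\eta_t\nabla_{\mathbf X}f(\mathbf Z_{t+1},\mathbf w_{t+1}))$; let $\mathbf B_t^r=\mathbf V_{\mathbf B}^r\boldsymbol\Lambda_{\mathbf B}^r{\mathbf V_{\mathbf B}^r}^\top$ be its rank-$r$ approximation; - $\mathbf X_{t+1}=(1-\varepsilon_t)\frac{\mathbf B_t^r}{\mathrm{Tr}(\mathbf B_t^r)}+\frac{\varepsilon_t}{n-r}(\mathbf I-\mathbf V_{\mathbf B}^r{\mathbf V_{\mathbf B}^r}^\top)$; - $\mathbf y_{t+1}=\arg\min_{\mathbf y\in\mathcal K}\{\langle-\eta_t\nabla_{\mathbf y}f(\mathbf Z_{t+1},\mathbf w_{t+1}),\mathbf y\rangle+B_{\mathbf y}(\mathbf y,\mathbf y_t)\}$. *)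

(* Defs.v *)
From HB Require Import structures.
From mathcomp Require Import all_boot all_order all_algebra.
From mathcomp Require Import all_classical all_reals all_analysis.

Set Implicit Arguments.
Unset Strict Implicit.
Unset Printing Implicit Defensive.

Import Order.TTheory GRing.Theory Num.Theory.
Import numFieldNormedType.Exports.

Local Open Scope classical_set_scope.
Local Open Scope ring_scope.

(* Finite-dimensional normed spaces.  The inner product is a separate form
   [ip : {dot V for idfun}]; it is unrelated to the norm [`|_|] of the type. *)
#[short(type="normedVectType")]
HB.structure Definition NormedVector (R : numFieldType) :=
  {V of Vector R V & NormedModule R V}.

HB.instance Definition _ (R : numFieldType) (m n : nat) :=
  NormedModule.on 'M[R]_(m, n).

Section extrema.
Context {R : realType} {T : Type}.
Implicit Types (A : set T) (g : T -> R).

Definition is_argmin A g x := A x /\ forall x', A x' -> g x <= g x'.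

Definition is_max A g M := (exists2 x, A x & g x = M) /\ forall x, A x -> g x <= M.

Definition is_min A g m := (exists2 x, A x & g x = m) /\ forall x, A x -> m <= g x.

End extrema.

Section matrices.
Context {R : realType} {n : nat}.
Implicit Types A B X : 'M[R]_n.

Definition symmx : set 'M[R]_n := [set X | X^T = X].

Definition psdmx X := symmx X /\ forall v : 'cV[R]_n, 0 <= (v^T *m X *m v) 0 0.

Definition spectrahedron : set 'M[R]_n := [set X | psdmx X /\ \tr X = 1].

(* The eigenvalues in nonincreasing order, repeated according to their
   multiplicity; meaningful when the characteristic polynomial splits over [R],
   in particular for symmetric matrices. *)
Definition eigenvalues A : seq R :=
  xget [::] [set s : seq R | sorted >=%R s /\
                             char_poly A = \prod_(a <- s) ('X - a%:P)].

(* The i-th largest eigenvalue, for 1 <= i <= n. *)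
Definition eigval (i : nat) A : R := (eigenvalues A)`_i.-1.

Definition singular_value (i : nat) A : R := Num.sqrt (eigval i (A^T *m A)).

Definition spectral_norm A : R := singular_value 1 A.

Definition nuclear_norm A : R := \sum_(i < n) singular_value i.+1 A.

(* Functional calculus on symmetric matrices:
   U^T diag(d) U |-> U^T diag(g(d)) U for U orthogonal; the result does not
   depend on the chosen diagonalization. *)
Definition mxfun (g : R -> R) A : 'M[R]_n :=
  xget 0 [set B | exists (U : 'M[R]_n) (d : 'rV[R]_n),
    [/\ U *m U^T = 1%:M,
        A = U^T *m diag_mx d *m U &
        B = U^T *m diag_mx (map_mx g d) *m U]].

Definition expmx := mxfun (@expR R).

(* Since [ln 0 = 0], [X *m logmx X] obeys the convention 0 log 0 = 0 when [X] is
   positive semidefinite and singular. *)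
Definition logmx := mxfun (@ln R).

Definition bregX X X' : R := \tr (X *m logmx X - X *m logmx X').

(* The columns of [V] are orthonormal eigenvectors for the r largest
   eigenvalues; [V] is not unique. *)
Definition top_eigvecs (r : nat) A (V : 'M[R]_(n, r)) :=
  V^T *m V = 1%:M /\
  A *m V = V *m diag_mx (\row_(i < r) eigval i.+1 A).

Definition rank_approx (r : nat) A (V : 'M[R]_(n, r)) : 'M[R]_n :=
  V *m diag_mx (\row_(i < r) eigval i.+1 A) *m V^T.

(* [X'] is a result of the approximated matrix exponentiated gradient step from
   [X] along [G], for some choice of the top eigenvectors. *)
Definition approx_meg_step (r : nat) (eta eps : R) X (G : 'M[R]_n) X' :=
  exists V : 'M[R]_(n, r),
    let P := expmx (logmx X - eta *: G) in
    let Pr := rank_approx P V in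
    top_eigvecs P V /\
    X' = (1 - eps) *: ((\tr Pr)^-1 *: Pr)
         + (eps / (n%:R - r%:R)) *: (1%:M - V *m V^T).

End matrices.

Section spaces.
Context {R : realType} {V : normedVectType R}.
Implicit Types (ip : {dot V for idfun}) (K D : set V) (om : V -> R) (gom : V -> V).

Definition dual_norm ip (g : V) : R := sup [set ip g v | v in [set v : V | `|v| <= 1]].

(* 1-strong convexity on [K] with respect to the norm of [V]. *)
Definition strongly_convex1 K om :=
  forall (s : R) (y y' : V), 0 <= s <= 1 -> K y -> K y' ->
    om (s *: y + (1 - s) *: y')
      <= s * om y + (1 - s) * om y' - s * (1 - s) / 2 * `|y - y'| ^+ 2.

(* Gradient at [y0] of a function whose values matter only on [K]: only
   increments inside [K] are considered. *)
Definition is_gradient_in ip K om (y0 g : V) :=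
  let F := within K (nbhs y0) in
  (fun y : V => om y - om y0 - ip g (y - y0) : R) =o_F (fun y : V => y - y0).

(* [om] is continuously differentiable at the points of [D], with gradient [gom]. *)
Definition C1_in ip K D om gom :=
  (forall y, D y -> is_gradient_in ip K om y (gom y)) /\
  {within D, continuous gom}.

Definition bregY ip om gom (y y' : V) : R :=
  om y - om y' - ip (y - y') (gom y').

Definition prox_step ip K om gom (eta : R) (y0 g y : V) :=
  is_argmin K (fun y' => ip (- eta *: g) y' + bregY ip om gom y' y0) y.

End spaces.

Section saddle.
Context {R : realType} {n : nat} {V : normedVectType R}.
Implicit Types (ip : {dot V for idfun}) (K : set V) (f : 'M[R]_n -> V -> R).
Implicit Types (om : V -> R) (gom : V -> V).

(* Frechet differentiability at (X, y) of f : S^n x V -> R, with gradient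
   g = (g_X, g_y) in S^n x V for the inner product Tr(A B) + <u, v>; [f] is
   defined on all square matrices but only its values at symmetric ones count. *)
Definition is_gradient ip f (X : 'M[R]_n) (y : V) (g : 'M[R]_n * V) :=
  let F := within [set p : 'M[R]_n * V | symmx p.1] (nbhs (X, y)) in
  symmx g.1 /\
  (fun p : 'M[R]_n * V =>
      f p.1 p.2 - f X y - (\tr (g.1 *m (p.1 - X)) + ip g.2 (p.2 - y)) : R)
    =o_F (fun p : 'M[R]_n * V => p - (X, y)).

Definition differentiable_SnV ip f :=
  forall X y, symmx X -> exists g, is_gradient ip f X y g.

Definition grad ip f X y : 'M[R]_n * V := xget (0, 0) (is_gradient ip f X y).
Definition gradX ip f X y : 'M[R]_n := (grad ip f X y).1.
Definition gradY ip f X y : V := (grad ip f X y).2.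

Definition smooth_on ip K f (bX bY bXY bYX : R) :=
  forall (X X' : 'M[R]_n) (y y' : V),
    spectrahedron X -> spectrahedron X' -> K y -> K y' ->
  [/\ spectral_norm (gradX ip f X y - gradX ip f X' y)
        <= bX * nuclear_norm (X - X'),
      dual_norm ip (gradY ip f X y - gradY ip f X y') <= bY * `|y - y'|,
      spectral_norm (gradX ip f X y - gradX ip f X y') <= bXY * `|y - y'| &
      dual_norm ip (gradY ip f X y - gradY ip f X' y)
        <= bYX * nuclear_norm (X - X')].

Definition saddle_point K f (Xs : 'M[R]_n) (ys : V) :=
  [/\ spectrahedron Xs, K ys &
      forall X y, spectrahedron X -> K y ->
        f Xs y <= f Xs ys /\ f Xs ys <= f X ys].

(* [X 0] is the initialization matrix; [y 0] and [Z], [w] at 0 and 1 are unused. *)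
Record low_rank_mirror_prox ip K f om gom (eta eps : nat -> R) (r : nat)
    (X Z : nat -> 'M[R]_n) (y w : nat -> V) : Prop := LowRankMirrorProx {
  mp_X0 : spectrahedron (X 0) /\ \rank (X 0) = r ;
  mp_y1 : K (y 1) ;
  mp_X1 : X 1 = (1 - eps 0) *: X 0 + (eps 0 / n%:R) *: 1%:M ;
  mp_Z : forall t, (1 <= t)%N ->
    approx_meg_step r (eta t) (eps t) (X t) (gradX ip f (X t) (y t)) (Z t.+1) ;
  mp_w : forall t, (1 <= t)%N ->
    prox_step ip K om gom (eta t) (y t) (gradY ip f (X t) (y t)) (w t.+1) ;
  mp_X : forall t, (1 <= t)%N ->
    approx_meg_step r (eta t) (eps t) (X t)
      (gradX ip f (Z t.+1) (w t.+1)) (X t.+1) ;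
  mp_y : forall t, (1 <= t)%N ->
    prox_step ip K om gom (eta t) (y t)
      (gradY ip f (Z t.+1) (w t.+1)) (y t.+1) }.

End saddle.

Section parameters.
Context {R : realType}.
Implicit Types bX bY bXY bYX G eta delta teps c : R.

(* The minima are taken in the extended reals, where [0^-1 = +oo]. *)
Definition step_size bX bY bXY bYX : R := fine
  (mine (((bX + bXY)%:E)^-1)
  (mine (((bY + bYX)%:E)^-1)
  (mine (((2 * Num.sqrt 2 * Num.sqrt (bX ^+ 2 + bYX ^+ 2))%:E)^-1)
        (((2 * Num.sqrt (bY ^+ 2 + bXY ^+ 2))%:E)^-1))))%E.

Definition eps_seq bX bXY G eta delta teps c (t : nat) : R := fine
  (mine 1
    (mine (teps ^+ 2 / (16 * Num.max (G ^+ 2 * eta ^+ 2) 1))%:E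
          ((delta%:E / (16 * Num.sqrt 2 * Num.max bX bXY
                       * (Num.sqrt 5 + Num.sqrt (eta * G)))%:E) ^+ 4)
     * ((t%:R + 1 + c) ^- 3)%:E))%E.

Definition init_radius (rs : nat) (lam bX bXY G delta : R) : R :=
  4^-1 * (7 * Num.max bX bXY + (1 + 2 * Num.sqrt (2 * rs%:R) / lam) * G)^-1
  * delta.

End parameters.

(* Main.v *)
(** An approximate update differs from the exact exponentiated gradient update
    only in that the n - r smallest eigenvalues are replaced by a flat tail of
    total mass eps_t.  If these eigenvalues carry at most the fraction eps_t of
    the trace, the replacement moves the iterate by at most 2 eps_t in nuclear
    norm and costs at most - ln (1 - eps_t) in Bregman distance from any point,
    so the mirror-prox inequality survives up to a multiple of eps_t.

    This condition on the tail reproduces itself.  Near the saddle point the gap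
    of the gradient makes the tail shrink by a factor exp (- eta delta / 4)
    relative to the trace (Courant-Fischer bounds the tail from above, Gibbs'
    variational principle bounds the trace from below), whereas eps_t decreases
    more slowly; and the mirror-prox inequality tested against the saddle point
    keeps the iterates near it, as the eps_t are summable.

    In the final estimate the accumulated error is absorbed by D2.  Indeed D2 is
    at least ln (n / eps_0) plus the dual part, the Bregman distance of a rank
    one matrix supported in the kernel of X_0.  A competitor with mass on the
    range of X* is closer to X_1 than this by a fixed fraction of the smallest
    nonzero eigenvalue of X*, and for the others comparing with X* instead can
    only increase the regret.  Hence the gap is at most D2 / (eta T). *)

(* The obstacle is a circularity: an update is accurate only if the discarded eigenvalues are small,
   they are known to be small only near the saddle point, and nearness is itself a consequence of
   accurate updates. It reappears inside one iteration, since the second update uses the gradient at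
   the midpoint. The first half is therefore tested against the saddle point on its own: the duality
   gap is nonnegative there, and what remains bounds the distance from the midpoint to the saddle
   point.

   The gap acts through complementarity: the range of [Xs], with projector P, is spanned by the
   eigenvectors of the r lowest eigenvalues of the gradient. This is used as two operator
   inequalities, Xs >= lam P and gradient >= mu I + delta (I - P). A tail direction of X_t has
   little mass on [Xs], hence on P, so the gradient exceeds mu there by nearly delta.

   Two budgets fix the constants: R0 is so small that all perturbations cost at most 3/4 of delta,
   and the errors of all the steps sum to at most R0^2 / 100. *)
Require Import Defs.
From HB Require Import structures.
From mathcomp Require Import all_boot all_order all_algebra.
From mathcomp Require Import all_classical all_reals all_analysis.
From mathcomp Require Import ring lra.

Set Implicit Arguments.
Unset Strict Implicit.
Unset Printing Implicit Defensive.

Import Order.TTheory GRing.Theory Num.Theory.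
Import numFieldNormedType.Exports.

Local Open Scope classical_set_scope.
Local Open Scope ring_scope.

(** * Spectral theorem and functional calculus *)

Section spectral.
Context {R : realType}.

Lemma dotE n (u v : 'rV[R]_n) : (u *m v^T) 0 0 = \sum_i u 0 i * v 0 i.
Proof. by rewrite mxE; apply: eq_bigr => i _; rewrite mxE. Qed.

Lemma dot_ge0 n (u : 'rV[R]_n) : 0 <= (u *m u^T) 0 0.
Proof. by rewrite dotE; apply: sumr_ge0 => i _; rewrite -expr2 sqr_ge0. Qed.

Lemma dot_eq0 n (u : 'rV[R]_n) : (u *m u^T) 0 0 = 0 -> u = 0.
Proof.
rewrite dotE => /eqP; rewrite psumr_eq0 => [/allP h|i _]; last first.
  by rewrite -expr2 sqr_ge0.
apply/rowP => i; rewrite mxE; apply/eqP.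
by have := h i (mem_index_enum i); rewrite -expr2 sqrf_eq0.
Qed.

Lemma dotC n (u v : 'rV[R]_n) : (u *m v^T) 0 0 = (v *m u^T) 0 0.
Proof. by rewrite !dotE; apply: eq_bigr => i _; rewrite mulrC. Qed.

Lemma mx00D (A B : 'M[R]_1) : (A + B) 0 0 = A 0 0 + B 0 0.
Proof. by rewrite mxE. Qed.

Lemma mx00N (A : 'M[R]_1) : (- A) 0 0 = - A 0 0.
Proof. by rewrite mxE. Qed.

Lemma mx00Z x (A : 'M[R]_1) : (x *: A) 0 0 = x * A 0 0.
Proof. by rewrite mxE. Qed.

Lemma mx00_1 : (1%:M : 'M[R]_1) 0 0 = 1.
Proof. by rewrite mxE. Qed.

Lemma mx11_eq (A B : 'M[R]_1) : A 0 0 = B 0 0 -> A = B.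
Proof. by move=> h; apply/matrixP => i j; rewrite !ord1. Qed.

Lemma continuous_sum (T : topologicalType) (I : finType) (F : I -> T -> R) :
  (forall i, continuous (F i)) -> continuous (fun x => \sum_i F i x).
Proof.
by move=> cF; apply: continuous_big => [|i _]; [exact: add_continuous | exact: cF].
Qed.

Lemma continuous_quadform n (P : 'M[R]_n) :
  continuous (fun v : 'rV[R]_n => (v *m P *m v^T) 0 0).
Proof.
have -> : (fun v : 'rV[R]_n => (v *m P *m v^T) 0 0) =
    (fun v => \sum_j \sum_i v 0 i * P i j * v 0 j).
  apply/funext => v; rewrite mxE; apply: eq_bigr => j _.
  by rewrite !mxE big_distrl.
apply: continuous_sum => j; apply: continuous_sum => i v.
apply: (@cvgM _ _ (nbhs v)); last exact: coord_continuous.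
apply: (@cvgM _ _ (nbhs v)); first exact: coord_continuous.
  exact: cvg_cst.
Qed.

Lemma continuous_mulmxr_entry n k (M : 'M[R]_(n, k)) j :
  continuous (fun v : 'rV[R]_n => (v *m M) 0 j).
Proof.
have -> : (fun v : 'rV[R]_n => (v *m M) 0 j) =
    (fun v => \sum_i v 0 i * M i j).
  by apply/funext => v; rewrite mxE.
apply: continuous_sum => i v.
apply: (@cvgM _ _ (nbhs v)); first exact: coord_continuous.
  exact: cvg_cst.
Qed.

Lemma normalize_row n (u : 'rV[R]_n) : u != 0 ->
  exists2 a : R, a != 0 & (a *: u) *m (a *: u)^T = 1%:M.
Proof.
move=> u0; set q := (u *m u^T) 0 0.
have q_gt0 : 0 < q.
  rewrite lt_neqAle dot_ge0 andbT eq_sym; apply: contraNneq u0 => q0.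
  by rewrite (dot_eq0 q0).
exists (Num.sqrt q)^-1; first by rewrite invr_eq0 gt_eqF // sqrtr_gt0.
apply: mx11_eq; rewrite linearZ /= -scalemxAl -scalemxAr scalerA !mxE -/q.
have -> : \sum_j u 0 j * u^T j 0 = q by rewrite /q mxE.
by rewrite -expr2 exprVn sqr_sqrtr ?ltW // mulVf ?lt0r_neq0.
Qed.

(** The unit sphere of the kernel is compact, so the Rayleigh quotient has a maximizer [v] there,
    with value [c]. By [invM] the residual [w] of the eigenvector equation stays in the kernel, so
    it is an admissible direction of variation. *)
Lemma eigenvector_in_kernel n k (P : 'M[R]_n) (M : 'M[R]_(n, k)) :
  P^T = P -> (k < n)%N ->
  (forall v : 'rV[R]_n, v *m M = 0 -> v *m P *m M = 0) ->
  exists (v : 'rV[R]_n) (c : R),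
    [/\ v *m v^T = 1%:M, v *m M = 0, v *m P = c *: v &
        forall x : 'rV[R]_n, x *m M = 0 ->
          (x *m P *m x^T) 0 0 <= c * (x *m x^T) 0 0].
Proof.
move=> symP ltkn invM.
pose S := [set v : 'rV[R]_n | v *m M = 0 /\ v *m v^T = 1%:M].
have S0 : S !=set0.
  have : kermx M != 0.
    rewrite -mxrank_eq0 mxrank_ker subn_eq0 -ltnNge.
    exact: leq_ltn_trans (rank_leq_col M) ltkn.
  case/rowV0Pn => u /sub_kermxP uM0 u0.
  have [a a0 a1] := normalize_row u0.
  by exists (a *: u); split => //; rewrite -scalemxAl uM0 scaler0.
have cS : compact S.
  apply: bounded_closed_compact.
    exists 1; split; first exact: num_real.
    move=> m m1 v [_ v1]; rewrite /Num.norm /= mx_normrE.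
    apply/bigmax_leP; split => [|[i j] _ /=]; first by rewrite ltW // (lt_trans ltr01).
    rewrite (le_trans _ (ltW m1)) // ord1 -(@ler_pXn2r _ 2) ?nnegrE //.
    rewrite expr1n real_normK ?num_real //.
    have <- : \sum_i v 0 i * v 0 i = 1 by rewrite -dotE v1 mxE.
    rewrite (bigD1 j) //= -expr2 lerDl.
    by apply: sumr_ge0 => l _; rewrite -expr2 sqr_ge0.
  have -> : S = \bigcap_(j : 'I_k) [set v : 'rV[R]_n | (v *m M) 0 j = 0] `&`
                [set v : 'rV[R]_n | (v *m 1%:M *m v^T) 0 0 = 1].
    apply/seteqP; split=> v /=.
      by case=> vM v1; split=> [j _ /=|]; rewrite ?vM ?mulmx1 ?v1 mxE.
    case=> h1 h2; split; last by apply: mx11_eq; rewrite mulmx1 in h2; rewrite h2 mxE.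
    by apply/rowP => j; rewrite [LHS]h1 // mxE.
  apply: closedI.
    apply: closed_bigI => j _.
    apply: (@preimage_closed _ _ (fun v : 'rV[R]_n => (v *m M) 0 j) [set 0]).
      by move=> v _; apply: continuous_mulmxr_entry.
    exact: closed_eq.
  apply: (@preimage_closed _ _ (fun v : 'rV[R]_n => (v *m 1%:M *m v^T) 0 0) [set 1]).
    by move=> v _; apply: continuous_quadform.
  exact: closed_eq.
have := @compact_EVT_max _ R (fun v : 'rV[R]_n => (v *m P *m v^T) 0 0) S S0 cS.
case=> [|v /set_mem [vM v1] vmax].
  by apply: continuous_subspaceT; exact: continuous_quadform.
pose c := (v *m P *m v^T) 0 0.
have maxK (x : 'rV[R]_n) : x *m M = 0 ->
    (x *m P *m x^T) 0 0 <= c * (x *m x^T) 0 0.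
  move=> xM; have [->|x0] := eqVneq x 0.
    by rewrite !mul0mx !mxE mulr0.
  have [a a0 a1] := normalize_row x0.
  have := vmax (a *: x).
  rewrite inE /S /= -scalemxAl xM scaler0 a1 => /(_ (conj erefl erefl)).
  have := congr1 (fun A : 'M[R]_1 => A 0 0) a1.
  rewrite linearZ /= -!(scalemxAl, scalemxAr) !scalerA.
  rewrite !mx00Z mx00_1 -/c => e1 e2.
  have a2 : 0 < a * a by rewrite -expr2 exprn_even_gt0.
  by rewrite -(ler_pM2l a2) mulrCA e1 mulr1.
exists v, c; split => //.
pose w := c *: v - v *m P.
have wM : w *m M = 0 by rewrite mulmxBl -scalemxAl vM scaler0 sub0r invM ?oppr0.
have e : v *m P *m w^T = w *m P *m v^T.
  apply: mx11_eq; have -> : v *m P *m w^T = (w *m P *m v^T)^T.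
    by rewrite !trmx_mul trmxK symP mulmxA.
  by rewrite mxE.
have wE : w = c *: v - v *m P by [].
suff : w = 0 by rewrite wE => /eqP; rewrite subr_eq0 => /eqP.
clearbody w.
pose b := (w *m w^T) 0 0.
pose d := c * b - (w *m P *m w^T) 0 0.
apply: dot_eq0; rewrite -/b.
(* The form c|x|^2 - x P x^T is nonnegative on the kernel. Along [s *: v + w] its s^2 terms cancel
   because [v] attains [c]; it is affine in s with slope 2|w|^2, which forces [w] to vanish. *)
have key s : 0 <= 2 * s * b + d.
  have vwM : (s *: v + w) *m M = 0 by rewrite mulmxDl wM -scalemxAl vM scaler0 addr0.
  have := maxK _ vwM; rewrite -subr_ge0; congr (0 <= _).
  rewrite linearD linearZ /= !(mulmxDl, mulmxDr, =^~scalemxAl, =^~scalemxAr).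
  rewrite e v1.
  have vw : (v *m w^T) 0 0 = (w *m v^T) 0 0 by rewrite dotC.
  have bE : b = c * (w *m v^T) 0 0 - (w *m P *m v^T) 0 0.
    rewrite /b {2}wE linearB linearZ /= mulmxBr -scalemxAr trmx_mul symP mulmxA.
    by rewrite mx00D mx00N mx00Z.
  have cE : (v *m P *m v^T) 0 0 = c by [].
  rewrite !(mx00D, mx00Z) mx00_1 vw cE /d -/b.
  rewrite bE; ring.
apply/eqP; apply: contraT => b0.
have b_gt0 : 0 < b by rewrite lt_neqAle eq_sym b0 dot_ge0.
have := key (- (d + 1) / (2 * b)).
have -> : 2 * (- (d + 1) / (2 * b)) * b + d = - 1 by field; rewrite gt_eqF.
by rewrite oppr_ge0 ler10.
Qed.


Lemma mulVmx_orth n (U : 'M[R]_n) : U *m U^T = 1%:M -> U^T *m U = 1%:M.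
Proof. exact: mulmx1C. Qed.

Lemma row_diag_mulmx k n (l : 'rV[R]_k) (V : 'M[R]_(k, n)) i :
  row i (diag_mx l *m V) = l 0 i *: row i V.
Proof. by apply/rowP => j; rewrite mul_diag_mx !mxE. Qed.

Lemma orth_rows n k (U : 'M[R]_(k, n)) i j : U *m U^T = 1%:M ->
  (row i U *m (row j U)^T) 0 0 = (i == j)%:R.
Proof.
move=> /matrixP /(_ i j); rewrite !mxE => <-.
by apply: eq_bigr => l _; rewrite !mxE.
Qed.

Lemma orth_diag_row n (U P : 'M[R]_n) (d : 'rV[R]_n) j :
  U *m U^T = 1%:M -> P = U^T *m diag_mx d *m U ->
  row j U *m P = d 0 j *: row j U.
Proof.
move=> UU ->; rewrite -row_mul !mulmxA UU mul1mx; exact: row_diag_mulmx.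
Qed.

(* The eigenvectors are added greedily, by maximizing the Rayleigh quotient on
   the orthogonal of the previous ones, so the new eigenvalues come sorted. *)
Lemma spectral_extension n (P : 'M[R]_n) k (V : 'M[R]_(k, n)) (l : 'rV[R]_k) :
  P^T = P -> (k <= n)%N -> V *m V^T = 1%:M -> V *m P = diag_mx l *m V ->
  exists (U : 'M[R]_n) (d : 'rV[R]_n),
    [/\ U *m U^T = 1%:M, P = U^T *m diag_mx d *m U,
        forall (i : 'I_k) (j : 'I_n), i = j :> nat ->
          row j U = row i V /\ d 0 j = l 0 i &
        forall i j : 'I_n, (k <= i)%N -> (i <= j)%N -> d 0 j <= d 0 i].
Proof.
move=> symP; move em: (n - k)%N => m.
elim: m k V l em => [|m IH] k V l em kn VV VP.
  have e : k = n by apply/eqP; rewrite eqn_leq kn -subn_eq0 em eqxx.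
  subst k; exists V, l; split=> //.
  - by rewrite -mulmxA -VP mulmxA mulVmx_orth // mul1mx.
  - by move=> i j /val_inj ->.
  - by move=> i j; rewrite leqNgt ltn_ord.
have ltkn : (k < n)%N by rewrite -subn_gt0 em.
have invV (v : 'rV[R]_n) : v *m V^T = 0 -> v *m P *m V^T = 0.
  move=> vV; rewrite -mulmxA -{1}symP -trmx_mul VP trmx_mul mulmxA vV.
  by rewrite mul0mx.
have [v [c [v1 vV vP vmax]]] := eigenvector_in_kernel symP ltkn invV.
have Vv : V *m v^T = 0 by rewrite -[LHS]trmxK trmx_mul trmxK vV trmx0.
have c11 : diag_mx (c%:M : 'M[R]_1) = c%:M.
  by apply/matrixP => i j; rewrite !ord1 !mxE.
have [||||U [d [UU PE UV dle]]] := IH (k + 1)%N (col_mx V v) (row_mx l c%:M).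
- by rewrite addn1 subnS em.
- by rewrite addn1.
- rewrite tr_col_mx mul_col_row VV v1 vV Vv; exact/esym/scalar_mx_block.
- rewrite mul_col_mx VP vP diag_mx_row mul_block_col !mul0mx addr0 add0r.
  by rewrite c11 mul_scalar_mx.
exists U, d; split=> //.
  move=> i j ij; have [-> ->] := UV (lshift 1 i) j ij.
  by rewrite rowKu row_mxEl.
move=> i j; rewrite leq_eqVlt => /orP[/eqP ki ij|ki]; last first.
  by apply: dle; rewrite addn1.
have [_ di] := UV (rshift k ord0) i (etrans (addn0 k) ki).
rewrite di row_mxEr mxE eqxx mulr1n.
have [ij'|] := leqP j i.
  have -> : j = i by apply: val_inj; apply/eqP; rewrite eqn_leq ij' ij.
  by rewrite di row_mxEr mxE eqxx mulr1n.
move=> ltij.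
(* Row [j] is orthogonal to [V], so it competes in the maximization that defined [c]. *)
have ujV : row j U *m V^T = 0.
  apply/rowP => p; rewrite !mxE.
  have pn : (p < n)%N by exact: ltn_trans (ltn_ord p) ltkn.
  have [up _] := UV (lshift 1 p) (Ordinal pn) erefl.
  have := orth_rows j (Ordinal pn) UU; rewrite up rowKu.
  have -> : (j == Ordinal pn) = false.
    apply/negbTE/eqP => jp; move: ltij; rewrite jp /= -ki.
    by rewrite ltnNge ltnW.
  by rewrite mxE => e; rewrite -[RHS]/(false%:R) -e; apply: eq_bigr => q _; rewrite !mxE.
have := vmax _ ujV; rewrite (orth_diag_row _ UU PE) -scalemxAl mx00Z.
by rewrite (orth_rows _ _ UU) eqxx !mulr1.
Qed.

End spectral.

(** * Sorted eigenvalues and completion of top eigenvectors *)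

Section eigenvalues.
Context {R : realType}.

Lemma char_poly_orth n (U : 'M[R]_n) (d : 'rV[R]_n) : U *m U^T = 1%:M ->
  char_poly (U^T *m diag_mx d *m U) =
  \prod_(a <- [seq d 0 i | i <- enum 'I_n]) ('X - a%:P).
Proof.
move=> UU; rewrite big_map big_enum /=.
transitivity (char_poly (diag_mx d)); last first.
  rewrite char_poly_trig ?diag_mx_is_trig //.
  by apply: eq_bigr => i _; rewrite mxE eqxx.
rewrite /char_poly /char_poly_mx.
have -> : 'X%:M - map_mx polyC (U^T *m diag_mx d *m U) =
    map_mx polyC U^T *m ('X%:M - map_mx polyC (diag_mx d)) *m map_mx polyC U.
  rewrite mulmxBr mulmxBl !map_mxM; congr (_ - _).
  rewrite mul_mx_scalar -scalemxAl -map_mxM mulVmx_orth // map_scalar_mx.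
  by rewrite scale_scalar_mx mulr1.
rewrite !det_mulmx mulrC mulrA -det_mulmx -map_mxM UU map_scalar_mx det1.
by rewrite mul1r.
Qed.

Definition noninc n (d : 'rV[R]_n) := forall i j : 'I_n, (i <= j)%N -> d 0 j <= d 0 i.

Lemma sorted_rowseq n (d : 'rV[R]_n) : noninc d ->
  sorted >=%R [seq d 0 i | i <- enum 'I_n].
Proof.
move=> h; rewrite sorted_map.
have : sorted leq (map val (enum 'I_n)) by rewrite val_enum_ord iota_sorted.
by rewrite sorted_map; apply: sub_sorted => i j /=; exact: h.
Qed.

Lemma nth_rowseq n (d : 'rV[R]_n) (i : 'I_n) :
  [seq d 0 i | i <- enum 'I_n]`_i = d 0 i.
Proof. by rewrite (nth_map i) ?size_enum_ord // nth_ord_enum. Qed.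

Lemma ge_trans_anti : transitive (>=%R : rel R) /\ antisymmetric (>=%R : rel R).
Proof.
split=> [x y z /= xy yz|x y /= /andP[xy yx]]; first exact: le_trans yz xy.
by apply/eqP; rewrite eq_le xy yx.
Qed.

(** The linear factors determine the roots up to order and sorting fixes the order, so [xget] has
    only one sequence to choose. *)
Lemma eigenvalues_diag n (U : 'M[R]_n) (d : 'rV[R]_n) :
  U *m U^T = 1%:M -> noninc d ->
  eigenvalues (U^T *m diag_mx d *m U) = [seq d 0 i | i <- enum 'I_n].
Proof.
move=> UU dd; rewrite /eigenvalues; apply: xget_unique.
  by split; [exact: sorted_rowseq | exact: char_poly_orth].
move=> s [ss]; rewrite char_poly_orth // => /prod_XsubC_eq e.
have [tr an] := ge_trans_anti.
by apply: (sorted_eq tr an) => //; [exact: sorted_rowseq | rewrite perm_sym].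
Qed.

Lemma eigval_diag n (U : 'M[R]_n) (d : 'rV[R]_n) (i : 'I_n) :
  U *m U^T = 1%:M -> noninc d ->
  eigval i.+1 (U^T *m diag_mx d *m U) = d 0 i.
Proof. by move=> UU dd; rewrite /eigval eigenvalues_diag // nth_rowseq. Qed.

Lemma spectral_sorted n (P : 'M[R]_n) : P^T = P ->
  exists (U : 'M[R]_n) (d : 'rV[R]_n),
    [/\ U *m U^T = 1%:M, P = U^T *m diag_mx d *m U & noninc d].
Proof.
move=> symP.
have e0 (A B : 'M[R]_(0, 0)) : A = B by apply/matrixP => -[].
have [|U [d [UU PE _ dd]]] :=
  spectral_extension (V := (0 : 'M[R]_(0, n))) (l := 0) symP (leq0n n) (e0 _ _).
  by apply/matrixP => -[].
by exists U, d; split=> // i j; exact: dd.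
Qed.

(** Completing the given [V] to an eigenbasis sorts only the added eigenvalues. The first r are the
    top ones by assumption; cancelling this common prefix against the true sorted list leaves two
    sorted permutations of each other, so the whole list is sorted. *)
Lemma spectral_top n r (P : 'M[R]_n) (V : 'M[R]_(n, r)) : P^T = P ->
  top_eigvecs P V ->
  exists (U : 'M[R]_n) (d : 'rV[R]_n),
    [/\ U *m U^T = 1%:M, P = U^T *m diag_mx d *m U, noninc d &
        forall (i : 'I_r) (j : 'I_n), i = j :> nat -> row j U = (col i V)^T].
Proof.
move=> symP [VV PV].
have rn : (r <= n)%N.
  by have := mxrankM_maxr V^T V; rewrite VV mxrank1 => /leq_trans; apply; exact: rank_leq_row.
set l := \row_(i < r) eigval i.+1 P in PV.
have VVT : V^T *m V^T^T = 1%:M by rewrite trmxK.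
have VP : V^T *m P = diag_mx l *m V^T.
  by rewrite -{1}symP -trmx_mul PV trmx_mul tr_diag_mx.
have [U [d [UU PE UV dd]]] := spectral_extension symP rn VVT VP.
have [U' [d' [UU' PE' dd']]] := spectral_sorted symP.
pose L := [seq d 0 i | i <- enum 'I_n].
pose L' := [seq d' 0 i | i <- enum 'I_n].
have EL : eigenvalues P = L' by rewrite PE' eigenvalues_diag.
have sL : size L = n by rewrite size_map size_enum_ord.
have sL' : size L' = n by rewrite size_map size_enum_ord.
have LL' : perm_eq L L'.
  apply: prod_XsubC_eq.
  by rewrite -(char_poly_orth d UU) -(char_poly_orth d' UU') -PE -PE'.
have tL : take r L = take r L'.
  apply: (@eq_from_nth _ 0); rewrite !size_takel ?sL ?sL' // => i ir.
  rewrite !nth_take //.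
  have iN : (i < n)%N by exact: leq_trans ir rn.
  rewrite -[i]/(val (Ordinal iN)) nth_rowseq.
  have [_ ->] := UV (Ordinal ir) (Ordinal iN) erefl.
  by rewrite mxE /eigval EL.
have dL : drop r L = drop r L'.
  have [tr an] := ge_trans_anti.
  apply: (sorted_eq tr an).
  - apply/(sortedP 0) => i; rewrite size_drop sL => ir; rewrite !nth_drop.
    have i1 : (r + i.+1 < n)%N by rewrite -ltn_subRL.
    have i0 : (r + i < n)%N by apply: ltn_trans i1; rewrite addnS.
    rewrite -[(r + i.+1)%N]/(val (Ordinal i1)) -[(r + i)%N]/(val (Ordinal i0)).
    by rewrite !nth_rowseq; apply: dd; rewrite /= ?leq_addr ?leq_add2l.
  - exact: drop_sorted (sorted_rowseq dd').
  - by rewrite -(perm_cat2l (take r L)) cat_take_drop tL cat_take_drop.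
have eL : L = L' by rewrite -(cat_take_drop r L) tL dL cat_take_drop.
exists U, d; split=> //.
  by move=> i j ij; rewrite -!nth_rowseq -/L eL !nth_rowseq; exact: dd'.
by move=> i j ij; have [-> _] := UV i j ij; rewrite -tr_col.
Qed.

End eigenvalues.

Section functional_calculus.
Context {R : realType} {n : nat}.
Implicit Types (U W A B X : 'M[R]_n) (d e : 'rV[R]_n).

(** The eigenvectors are the rows of [U], as in [mxfun]. *)
Definition specmx U d : 'M[R]_n := U^T *m diag_mx d *m U.

Lemma specmxE U d i j : specmx U d i j = \sum_k d 0 k * U k i * U k j.
Proof.
rewrite mxE; apply: eq_bigr => k _; rewrite mul_mx_diag !mxE; congr (_ * _).
by rewrite mulrC.
Qed.

Lemma specmx_sym U d : (specmx U d)^T = specmx U d.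
Proof. by rewrite !trmx_mul trmxK tr_diag_mx mulmxA. Qed.

Lemma sym_specmx A : A^T = A -> exists U d, [/\ U *m U^T = 1%:M, A = specmx U d & noninc d].
Proof. exact: spectral_sorted. Qed.

Lemma specmxD U d e : specmx U (d + e) = specmx U d + specmx U e.
Proof. by rewrite /specmx linearD /= mulmxDr mulmxDl. Qed.

Lemma specmxZ U c d : specmx U (c *: d) = c *: specmx U d.
Proof. by rewrite /specmx linearZ /= -scalemxAr -scalemxAl. Qed.

Lemma specmxB U d e : specmx U (d - e) = specmx U d - specmx U e.
Proof. by rewrite /specmx linearB /= mulmxBr mulmxBl. Qed.

Lemma specmx_const U c : U *m U^T = 1%:M -> specmx U (const_mx c) = c%:M.
Proof.
move=> UU; rewrite /specmx diag_const_mx mul_mx_scalar -scalemxAl mulVmx_orth //.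
by rewrite scale_scalar_mx mulr1.
Qed.

Lemma specmxM U d e : U *m U^T = 1%:M ->
  specmx U d *m specmx U e = specmx U (\row_i (d 0 i * e 0 i)).
Proof.
move=> UU; rewrite /specmx !mulmxA -(mulmxA _ U) UU mulmx1 -(mulmxA U^T) mulmx_diag.
by [].
Qed.

Definition quad (v : 'rV[R]_n) A := (v *m A *m v^T) 0 0.

Lemma quad_row U A i : quad (row i U) A = (U *m A *m U^T) i i.
Proof.
rewrite /quad -row_mul !mxE; apply: eq_bigr => j _; rewrite !mxE.
by [].
Qed.

Lemma tr_specmxM U d A : \tr (specmx U d *m A) = \sum_i d 0 i * quad (row i U) A.
Proof.
rewrite /specmx -!mulmxA mxtrace_mulC /mxtrace -!mulmxA.
by apply: eq_bigr => i _; rewrite mul_diag_mx quad_row -mulmxA mxE.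
Qed.

Lemma quad_specmx (v : 'rV[R]_n) U d :
  quad v (specmx U d) = \sum_i d 0 i * (v *m U^T) 0 i ^+ 2.
Proof.
rewrite /quad /specmx !mulmxA -mulmxA.
have -> : U *m v^T = (v *m U^T)^T by rewrite trmx_mul trmxK.
set w := v *m U^T; rewrite mxE; apply: eq_bigr => i _.
by rewrite mul_mx_diag !mxE; ring.
Qed.

(** The squared overlaps of two eigenbases form a doubly stochastic matrix ([orth_sqrow],
    [orth_sqcol]); through it trace inequalities reduce to scalar ones. *)
Lemma tr_specmx2 U W d e : \tr (specmx U d *m specmx W e) =
  \sum_i \sum_j d 0 i * e 0 j * (U *m W^T) i j ^+ 2.
Proof.
rewrite tr_specmxM; apply: eq_bigr => i _; rewrite quad_specmx big_distrr /=.
by apply: eq_bigr => j _; rewrite -row_mul mxE mulrA.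
Qed.

Lemma orth_mul U W : U *m U^T = 1%:M -> W *m W^T = 1%:M ->
  (U *m W^T) *m (U *m W^T)^T = 1%:M.
Proof.
by move=> UU WW; rewrite trmx_mul trmxK !mulmxA -(mulmxA U) mulVmx_orth // mulmx1.
Qed.

Lemma orth_sqrow (S : 'M[R]_n) i : S *m S^T = 1%:M -> \sum_j S i j ^+ 2 = 1.
Proof.
move=> /matrixP /(_ i i); rewrite !mxE eqxx mulr1n => e.
by rewrite -[RHS]e; apply: eq_bigr => j _; rewrite mxE expr2.
Qed.

Lemma orth_sqcol (S : 'M[R]_n) j : S *m S^T = 1%:M -> \sum_i S i j ^+ 2 = 1.
Proof.
move=> /mulVmx_orth SS; rewrite -(@orth_sqrow S^T j) ?trmxK //.
by apply: eq_bigr => i _; rewrite mxE.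
Qed.

Lemma tr_specmx U d : U *m U^T = 1%:M -> \tr (specmx U d) = \sum_i d 0 i.
Proof.
move=> UU; rewrite /specmx -mulmxA mxtrace_mulC -mulmxA UU mulmx1.
by rewrite mxtrace_diag.
Qed.

(** The change of basis [S] intertwines the two diagonal matrices, so [S i j] is nonzero only where
    the eigenvalues agree, and there [g] takes the same value: the choice of diagonalization is
    immaterial. *)
Lemma mxfun_specmx (g : R -> R) U d : U *m U^T = 1%:M ->
  mxfun g (specmx U d) = specmx U (map_mx g d).
Proof.
move=> UU; rewrite /mxfun; apply: xget_unique; first by exists U, d; split.
move=> _ [W [e [WW eA ->]]]; rewrite -/(specmx W (map_mx g e)).
have [S SE] : exists S, S = W *m U^T by eexists.
have eS : diag_mx e *m S = S *m diag_mx d.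
  rewrite SE.
  have := congr1 (fun A => W *m A *m U^T) eA.
  rewrite /specmx !mulmxA WW mul1mx -(mulmxA _ U) UU mulmx1 => ->.
  by rewrite -mulmxA.
have gS : diag_mx (map_mx g e) *m S = S *m diag_mx (map_mx g d).
  apply/matrixP => i j; move/matrixP: eS => /(_ i j).
  rewrite !mul_diag_mx !mul_mx_diag !mxE.
  have [->|S0] := eqVneq (S i j) 0; first by rewrite !mulr0 !mul0r.
  by rewrite [S i j * _]mulrC => /(mulIf S0) ->; rewrite mulrC.
have WSU : W = S *m U by rewrite SE -mulmxA mulVmx_orth // mulmx1.
rewrite /specmx {2}WSU !mulmxA -(mulmxA W^T) gS SE !mulmxA mulVmx_orth //.
by rewrite mul1mx.
Qed.

Lemma mxfun_sym (g : R -> R) A : A^T = A -> (mxfun g A)^T = mxfun g A.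
Proof.
by case/sym_specmx => U [d [UU -> _]]; rewrite mxfun_specmx // specmx_sym.
Qed.

Lemma row_specmx U d i : U *m U^T = 1%:M -> row i U *m specmx U d = d 0 i *: row i U.
Proof. by move=> UU; apply: orth_diag_row. Qed.

Lemma psd_quad A : psdmx A -> forall v : 'rV[R]_n, 0 <= quad v A.
Proof. by case=> _ h v; have := h v^T; rewrite trmxK. Qed.

Lemma quad_psd A : A^T = A -> (forall v : 'rV[R]_n, 0 <= quad v A) -> psdmx A.
Proof. by move=> sA h; split => // v; have := h v^T; rewrite /quad trmxK. Qed.

Lemma specmx_psd U d : (forall i, 0 <= d 0 i) -> psdmx (specmx U d).
Proof.
move=> d0; apply: quad_psd; first exact: specmx_sym.
by move=> v; rewrite quad_specmx; apply: sumr_ge0 => i _; rewrite mulr_ge0 ?sqr_ge0.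
Qed.

Lemma quad_row_specmx U d i : U *m U^T = 1%:M -> quad (row i U) (specmx U d) = d 0 i.
Proof.
move=> UU; rewrite /quad row_specmx // -scalemxAl mx00Z orth_rows //.
by rewrite eqxx mulr1.
Qed.

Lemma psd_specmx A : psdmx A -> exists U d,
  [/\ U *m U^T = 1%:M, A = specmx U d, noninc d & forall i, 0 <= d 0 i].
Proof.
move=> psdA; have [U [d [UU AE dd]]] := sym_specmx (proj1 psdA).
exists U, d; split=> // i; rewrite -(quad_row_specmx d i UU) -AE.
exact: psd_quad.
Qed.

Lemma tr_psd_ge0 A B : psdmx A -> psdmx B -> 0 <= \tr (A *m B).
Proof.
move=> /psd_specmx [U [d [UU -> _ d0]]] psdB; rewrite tr_specmxM.
by apply: sumr_ge0 => i _; rewrite mulr_ge0 // psd_quad.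
Qed.

End functional_calculus.

(** * Norms and Pinsker's inequality *)

Section scalar.
Context {R : realType}.
Implicit Types a b x : R.

(** The sign condition puts [c] on the same side of 1 as [x], so that x < 1 and x > 1 are treated
    together below. *)
Lemma mvt_from1 (f df : R -> R) x : 0 < x ->
  (forall z : R, 0 < z -> is_derive z 1 f (df z)) ->
  exists c, [/\ 0 < c, 0 <= (c - 1) * (x - 1) & f x - f 1 = df c * (x - 1)].
Proof.
move=> x0 fdf.
have cont (a b : R) : 0 < a -> {within `[a, b], continuous f}.
  move=> a0; apply: derivable_within_continuous => z; rewrite in_itv /= => /andP[az _].
  by have [] := fdf z (lt_le_trans a0 az).
have drv (a b : R) : 0 < a -> forall z : R, z \in `]a, b[%R -> is_derive z 1 f (df z).
  by move=> a0 z; rewrite in_itv /= => /andP[az _]; apply: fdf; exact: lt_trans az.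
have [x1|x1] := leP 1 x.
  have [c + e] := MVT_segment x1 (drv 1 x ltr01) (cont 1 x ltr01).
  rewrite in_itv /= => /andP[c1 cx]; exists c; split => //.
    exact: lt_le_trans ltr01 c1.
  by rewrite mulr_ge0 ?subr_ge0.
have [c + e] := MVT_segment (ltW x1) (drv x 1 x0) (cont x 1 x0).
rewrite in_itv /= => /andP[xc c1]; exists c; split => //.
- exact: lt_le_trans xc.
- by rewrite mulr_le0 ?subr_le0 // ltW.
- by rewrite -[f x - _]opprB e -mulrN opprB.
Qed.

Lemma ln_ge1V x : 0 < x -> 1 - x^-1 <= ln x.
Proof.
move=> x0; have V0 : 0 < x^-1 by rewrite invr_gt0.
have := @le_ln1Dx R (x^-1 - 1); rewrite addrCA subrr addr0 lnV ?posrE // => h.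
by rewrite -lerN2 opprB; apply: h; rewrite ltrBrDl subrr.
Qed.

(** The factor [k], a value of the derivative ln c + 1 / c - 1, records that the left side has the
    sign of x - 1. *)
Lemma ln_chord x : 0 < x ->
  exists2 k : R, 0 <= k & (x + 1) * ln x - 2 * (x - 1) = k * (x - 1).
Proof.
move=> x0; pose f z : R := (z + 1) * ln z - 2 * (z - 1).
pose df z : R := ln z + z^-1 - 1.
have [z z0|c [c0 _]] := @mvt_from1 f df x x0.
  have dl := is_derive1_ln z0.
  apply: is_derive_eq; rewrite /df /= /GRing.scale /=.
  by field; rewrite gt_eqF.
have f1 : f 1 = 0 by rewrite /f ln1; ring.
rewrite f1 subr0 => e; exists (df c); last exact: e.
by rewrite /df; have := ln_ge1V c0; lra.
Qed.

(** The difference of the two sides vanishes at 1, and its derivative is four times the function of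
    [ln_chord], which has the sign of z - 1. *)
Lemma entropy_quadratic x : 0 < x ->
  3 * (x - 1) ^+ 2 <= 2 * (x + 2) * (x * ln x - x + 1).
Proof.
move=> x0; pose f z : R := 2 * (z + 2) * (z * ln z - z + 1) - 3 * (z - 1) ^+ 2.
pose df z : R := 4 * ((z + 1) * ln z - 2 * (z - 1)).
have [z z0|c [c0 cx]] := @mvt_from1 f df x x0.
  have dl := is_derive1_ln z0.
  apply: is_derive_eq; rewrite /df /= /GRing.scale /=.
  by field; rewrite gt_eqF.
have f1 : f 1 = 0 by rewrite /f ln1; ring.
rewrite f1 subr0 -subr_ge0 -/(f x) => ->; rewrite /df.
have [k k0 ->] := ln_chord c0.
by rewrite -!mulrA mulr_ge0 // mulr_ge0.
Qed.

(* [ln 0 = 0] covers the case [a = 0]. *)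
Lemma entropy_quadratic2 a b : 0 <= a -> 0 < b ->
  3 * (a - b) ^+ 2 <= 2 * (a + 2 * b) * (a * ln a - a * ln b - a + b).
Proof.
rewrite le_eqVlt => /orP[/eqP <-|a0] b0; first by rewrite !mul0r; nra.
have x0 : 0 < a / b by rewrite divr_gt0.
have := entropy_quadratic x0; rewrite ln_div ?posrE //.
have -> : a = a / b * b by rewrite divfK // gt_eqF.
set x := a / b; rewrite mulfK ?gt_eqF // => h.
rewrite -subr_ge0; move: h; set l := ln _ - ln b => h.
have -> : 2 * (x * b + 2 * b) * (x * b * ln (x * b) - x * b * ln b - x * b + b)
   - 3 * (x * b - b) ^+ 2 =
   b ^+ 2 * (2 * (x + 2) * (x * l - x + 1) - 3 * (x - 1) ^+ 2).
  by rewrite /l; ring.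
by rewrite mulr_ge0 ?sqr_ge0 // subr_ge0.
Qed.

End scalar.

Section norms.
Context {R : realType} {n : nat}.
Implicit Types (U W A B X : 'M[R]_n) (d e : 'rV[R]_n).

Lemma eigenvalues_perm U d : U *m U^T = 1%:M ->
  perm_eq (eigenvalues (specmx U d)) [seq d 0 i | i <- enum 'I_n] /\
  sorted >=%R (eigenvalues (specmx U d)).
Proof.
move=> UU; have [W [e [WW E ee]]] := sym_specmx (specmx_sym U d).
rewrite E eigenvalues_diag //; split; last exact: sorted_rowseq.
by apply: prod_XsubC_eq; rewrite -(char_poly_orth d UU) -(char_poly_orth e WW) -/(specmx U d) E.
Qed.

Lemma sqr_specmx U d : U *m U^T = 1%:M ->
  (specmx U d)^T *m specmx U d = specmx U (\row_i (d 0 i ^+ 2)).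
Proof.
by move=> UU; rewrite specmx_sym specmxM //; congr specmx; apply/rowP => i; rewrite !mxE.
Qed.

Lemma nuclear_norm_specmx U d : U *m U^T = 1%:M ->
  nuclear_norm (specmx U d) = \sum_i `|d 0 i|.
Proof.
move=> UU; rewrite /nuclear_norm /singular_value /eigval /= sqr_specmx //.
set d2 := \row_i _; have [pE _] := eigenvalues_perm d2 UU.
have sE : size (eigenvalues (specmx U d2)) = n.
  by rewrite (perm_size pE) size_map size_enum_ord.
transitivity (\sum_(a <- eigenvalues (specmx U d2)) Num.sqrt a).
  by rewrite (big_nth 0) sE big_mkord.
rewrite (perm_big _ pE) big_map big_enum; apply: eq_bigr => i _.
by rewrite mxE sqrtr_sqr.
Qed.

Lemma spectral_norm_specmx U d i : U *m U^T = 1%:M ->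
  `|d 0 i| <= spectral_norm (specmx U d).
Proof.
move=> UU; rewrite /spectral_norm /singular_value /eigval /= sqr_specmx //.
set d2 := \row_i _; have [pE sE] := eigenvalues_perm d2 UU.
rewrite -sqrtr_sqr ler_wsqrtr //.
have : d 0 i ^+ 2 \in eigenvalues (specmx U d2).
  by rewrite (perm_mem pE); apply/mapP; exists i; rewrite ?mem_enum // mxE.
case: (eigenvalues _) sE => [//|a s] /= sE; rewrite inE => /orP[/eqP -> //|].
have [tr _] := @ge_trans_anti R.
by move: sE; rewrite (path_sortedE tr) => /andP[/allP h _] /h.
Qed.

Lemma nuclear_norm_ge0 A : 0 <= nuclear_norm A.
Proof. by apply: sumr_ge0 => i _; exact: sqrtr_ge0. Qed.

Lemma tr_specmx_nuclear U d B (c : R) : U *m U^T = 1%:M -> B^T = B ->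
  (forall i, `|d 0 i| <= c) -> `|\tr (specmx U d *m B)| <= c * nuclear_norm B.
Proof.
move=> UU /sym_specmx [W [e [WW -> _]]] dc; rewrite tr_specmx2 nuclear_norm_specmx //.
have SS := orth_mul UU WW; set S := U *m W^T in SS *.
apply: le_trans (ler_norm_sum _ _ _) _.
apply: (@le_trans _ _ (\sum_i \sum_j c * `|e 0 j| * S i j ^+ 2)).
  apply: ler_sum => i _; apply: le_trans (ler_norm_sum _ _ _) _.
  apply: ler_sum => j _; rewrite normrM (ger0_norm (sqr_ge0 _)) normrM.
  by rewrite ler_wpM2r ?sqr_ge0 // ler_wpM2r.
rewrite exchange_big big_distrr /=; apply: ler_sum => j _.
by rewrite -big_distrr /= orth_sqcol // mulr1.
Qed.

Lemma tr_le_spectral_nuclear A B : A^T = A -> B^T = B ->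
  `|\tr (A *m B)| <= spectral_norm A * nuclear_norm B.
Proof.
move=> /sym_specmx [U [d [UU -> _]]] sB; apply: tr_specmx_nuclear => // i.
exact: spectral_norm_specmx.
Qed.

(** The matrix sign of [B] attains the bound of [tr_specmx_nuclear]; this duality yields the
    triangle inequality. *)
Lemma nuclear_norm_sign B : B^T = B -> exists U d,
  [/\ U *m U^T = 1%:M, forall i, `|d 0 i| <= 1 & nuclear_norm B = \tr (specmx U d *m B)].
Proof.
move=> /sym_specmx [U [e [UU -> _]]]; exists U, (\row_i Num.sg (e 0 i)); split=> //.
  by move=> i; rewrite mxE normr_sg; case: eqP.
rewrite nuclear_norm_specmx // specmxM // tr_specmx //.
by apply: eq_bigr => i _; rewrite !mxE normrEsg.
Qed.

Lemma nuclear_normD A B : A^T = A -> B^T = B ->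
  nuclear_norm (A + B) <= nuclear_norm A + nuclear_norm B.
Proof.
move=> sA sB; have sAB : (A + B)^T = A + B by rewrite linearD /= sA sB.
have [U [d [UU d1 ->]]] := nuclear_norm_sign sAB.
rewrite mulmxDr mxtraceD lerD // -[leRHS]mul1r; apply: le_trans (ler_norm _) _;
  exact: tr_specmx_nuclear.
Qed.

Lemma nuclear_normN A : A^T = A -> nuclear_norm (- A) = nuclear_norm A.
Proof.
move=> /sym_specmx [U [d [UU -> _]]]; have -> : - specmx U d = specmx U (- d).
  by rewrite -[in RHS]scaleN1r specmxZ scaleN1r.
rewrite !nuclear_norm_specmx //; apply: eq_bigr => i _.
by rewrite mxE normrN.
Qed.

Lemma nuclear_norm_distC A B : A^T = A -> B^T = B ->
  nuclear_norm (A - B) = nuclear_norm (B - A).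
Proof.
by move=> sA sB; rewrite -nuclear_normN ?opprB // linearB /= sA sB.
Qed.

Lemma nuclear_norm_triangle A B X : A^T = A -> B^T = B -> X^T = X ->
  nuclear_norm (A - B) <= nuclear_norm (A - X) + nuclear_norm (X - B).
Proof.
move=> sA sB sX; have -> : A - B = (A - X) + (X - B) by rewrite addrA subrK.
by apply: nuclear_normD; rewrite linearB /= ?sA ?sB ?sX.
Qed.

Lemma nuclear_norm_spectrahedron X : spectrahedron X -> nuclear_norm X = 1.
Proof.
case=> /psd_specmx [U [d [UU -> _ d0]]]; rewrite tr_specmx // nuclear_norm_specmx // => <-.
by apply: eq_bigr => i _; rewrite ger0_norm.
Qed.

Lemma spectrahedron_sym X : spectrahedron X -> X^T = X.
Proof. by case=> -[]. Qed.

Lemma spectrahedron_specmx U d : U *m U^T = 1%:M -> (forall i, 0 <= d 0 i) ->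
  \sum_i d 0 i = 1 -> spectrahedron (specmx U d).
Proof. by move=> UU d0 d1; split; [exact: specmx_psd | rewrite tr_specmx]. Qed.

Lemma bregX_specmx U W d e : U *m U^T = 1%:M -> W *m W^T = 1%:M ->
  bregX (specmx U d) (specmx W e) =
  \sum_i \sum_j (U *m W^T) i j ^+ 2 * (d 0 i * ln (d 0 i) - d 0 i * ln (e 0 j)).
Proof.
move=> UU WW; rewrite /bregX /logmx !mxfun_specmx // raddfB /=.
rewrite specmxM // tr_specmx // tr_specmx2 -sumrB; apply: eq_bigr => i _.
rewrite !mxE -[X in X - _]mulr1 -(orth_sqrow i (orth_mul UU WW)) big_distrr /= -sumrB.
apply: eq_bigr => j _; have -> : map_mx (@ln R) e 0 j = ln (e 0 j) by rewrite mxE.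
by ring.
Qed.

Lemma sum_CauchySchwarz (I : finType) (u v : I -> R) :
  (\sum_i u i * v i) ^+ 2 <= (\sum_i u i ^+ 2) * (\sum_i v i ^+ 2).
Proof.
rewrite -subr_ge0; pose a := \sum_i u i ^+ 2; pose b := \sum_i v i ^+ 2.
pose c := \sum_i u i * v i; rewrite -/a -/b -/c.
have key s t : 0 <= s ^+ 2 * a - 2 * s * t * c + t ^+ 2 * b.
  have -> : s ^+ 2 * a - 2 * s * t * c + t ^+ 2 * b = \sum_i (s * u i - t * v i) ^+ 2.
    rewrite /a /b /c !big_distrr /= -sumrB -big_split /=.
    by apply: eq_bigr => i _; ring.
  by apply: sumr_ge0 => i _; exact: sqr_ge0.
have a0 : 0 <= a by apply: sumr_ge0 => i _; exact: sqr_ge0.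
have [a00|a00] := eqVneq a 0.
  rewrite a00 mul0r sub0r oppr_ge0; apply: contraT; rewrite -ltNge => c2.
  (* With a = 0 the form is affine in s, and this choice makes it - c^4 (b + 2). *)
  have := key (c * (b + 1)) (c ^+ 2); rewrite a00.
  have b0 : 0 <= b by apply: sumr_ge0 => i _; exact: sqr_ge0.
  have -> : (c * (b + 1)) ^+ 2 * 0 - 2 * (c * (b + 1)) * c ^+ 2 * c + (c ^+ 2) ^+ 2 * b
    = - ((c ^+ 2) ^+ 2 * (b + 2)) by ring.
  rewrite oppr_ge0 leNgt mulr_gt0 //; first by rewrite exprn_gt0.
  by rewrite ltr_wpDl.
have agt0 : 0 < a by rewrite lt_neqAle eq_sym a00.
have := key c a.
have -> : c ^+ 2 * a - 2 * c * a * c + a ^+ 2 * b = a * (a * b - c ^+ 2) by ring.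
by rewrite pmulr_rge0.
Qed.

(** Orthogonal factors preserve norms and the diagonal one shrinks them, so the product is a
    contraction. In [pinsker] it is applied to the sign matrix seen between two eigenbases. *)
Lemma contraction_sqrow (S1 S2 : 'M[R]_n) d i : S1 *m S1^T = 1%:M -> S2 *m S2^T = 1%:M ->
  (forall k, `|d 0 k| <= 1) ->
  \sum_j (S1 *m diag_mx d *m S2) i j ^+ 2 <= 1.
Proof.
move=> S11 S22 d1; set K := _ *m S2.
have -> : \sum_j K i j ^+ 2 = (K *m K^T) i i.
  by rewrite mxE; apply: eq_bigr => j _; rewrite [K^T _ _]mxE expr2.
have -> : K *m K^T = S1 *m diag_mx (\row_k (d 0 k ^+ 2)) *m S1^T.
  rewrite /K !trmx_mul tr_diag_mx !mulmxA -(mulmxA _ S2) S22 mulmx1.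
  by rewrite -(mulmxA S1) mulmx_diag.
rewrite mxE -(orth_sqrow i S11); apply: ler_sum => k _.
rewrite mul_mx_diag !mxE mulrAC -expr2 ler_piMr ?sqr_ge0 //.
by rewrite -real_normK ?num_real // expr_le1.
Qed.

(* Both the relative entropy and the nuclear norm of the difference are double
   sums over the two eigenbases, with the same weights [<u_i, w_j>^2]; scalar
   Pinsker and Cauchy-Schwarz then give the sharp constant. *)
Lemma pinsker X Y : spectrahedron X -> spectrahedron Y ->
  (exists W e, [/\ W *m W^T = 1%:M, Y = specmx W e & forall i, 0 < e 0 i]) ->
  nuclear_norm (X - Y) ^+ 2 <= 2 * bregX X Y.
Proof.
move=> SX SY [W [e [WW YE e0]]].
have [U [d [UU XE _ d0]]] := psd_specmx (proj1 SX).
have sXY : (X - Y)^T = X - Y by rewrite linearB /= !spectrahedron_sym.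
have [Q [s [QQ s1 ->]]] := nuclear_norm_sign sXY.
have trX : \sum_i d 0 i = 1 by rewrite -(proj2 SX) XE tr_specmx.
have trY : \sum_i e 0 i = 1 by rewrite -(proj2 SY) YE tr_specmx.
have SS := orth_mul UU WW.
pose S := U *m W^T; pose K := W *m specmx Q s *m U^T.
(* The weight is the factor a + 2 b of [entropy_quadratic2]. Rows and columns of [K] have norm at
   most 1 and both traces are 1, so the squares of [v] sum to at most 1 + 2 = 3, the constant on the
   left of that inequality. *)
pose wt (p : 'I_n * 'I_n) := d 0 p.1 + 2 * e 0 p.2.
have wt0 p : 0 < wt p by rewrite ltr_wpDl // mulr_gt0.
pose u p := S p.1 p.2 * (d 0 p.1 - e 0 p.2) / Num.sqrt (wt p).
pose v p := K p.2 p.1 * Num.sqrt (wt p).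
have trE : \tr (specmx Q s *m (X - Y)) = \sum_p u p * v p.
  have e1 : \tr (specmx Q s *m X) = \sum_i \sum_j S i j * d 0 i * K j i.
    transitivity (\tr (diag_mx d *m (S *m K))).
      rewrite /S /K XE /specmx !mulmxA -(mulmxA _ W^T) mulVmx_orth // mulmx1.
      rewrite mxtrace_mulC !mulmxA mxtrace_mulC !mulmxA.
      by rewrite mxtrace_mulC !mulmxA mxtrace_mulC !mulmxA.
    rewrite /mxtrace; apply: eq_bigr => i _; rewrite mul_diag_mx !mxE big_distrr /=.
    by apply: eq_bigr => j _; ring.
  have e2 : \tr (specmx Q s *m Y) = \sum_i \sum_j S i j * e 0 j * K j i.
    transitivity (\tr (diag_mx e *m (K *m S))).
      rewrite /S /K YE /specmx !mulmxA -(mulmxA _ U^T) mulVmx_orth // mulmx1.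
      rewrite mxtrace_mulC !mulmxA mxtrace_mulC !mulmxA.
      by rewrite mxtrace_mulC !mulmxA mxtrace_mulC !mulmxA.
    rewrite exchange_big /mxtrace; apply: eq_bigr => j _.
    rewrite mul_diag_mx !mxE big_distrr /=.
    by apply: eq_bigr => i _; ring.
  rewrite mulmxBr raddfB /= e1 e2 !pair_bigA /= -sumrB.
  apply: eq_bigr => p _; rewrite /u /v.
  have w0 : Num.sqrt (wt p) != 0 by rewrite gt_eqF // sqrtr_gt0.
  by field.
have u2 : 3 * \sum_p u p ^+ 2 <= 2 * bregX X Y.
  have -> : bregX X Y = \sum_p S p.1 p.2 ^+ 2 *
      (d 0 p.1 * ln (d 0 p.1) - d 0 p.1 * ln (e 0 p.2) - d 0 p.1 + e 0 p.2).
    rewrite XE YE bregX_specmx // -(pair_bigA _ (fun i j => S i j ^+ 2 *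
      (d 0 i * ln (d 0 i) - d 0 i * ln (e 0 j) - d 0 i + e 0 j))) /=.
    (* The linear terms of [entropy_quadratic2] sum to zero: the weights are doubly stochastic and
       both traces are 1. *)
    have : \sum_i \sum_j S i j ^+ 2 * (e 0 j - d 0 i) = 0.
      under eq_bigr do under eq_bigr do rewrite mulrBr.
      under eq_bigr do rewrite sumrB.
      rewrite sumrB exchange_big /= -[RHS](subrr 1); congr (_ - _).
        rewrite -trY; apply: eq_bigr => j _.
        by rewrite -big_distrl /= orth_sqcol // mul1r.
      rewrite -trX; apply: eq_bigr => i _.
      by rewrite -big_distrl /= orth_sqrow // mul1r.
    move=> z; rewrite -[LHS]addr0 -[X in _ + X = _]z -big_split /=; apply: eq_bigr => i _.
    by rewrite -big_split /=; apply: eq_bigr => j _; rewrite -/S; ring.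
  rewrite !big_distrr /=; apply: ler_sum => p _.
  rewrite /u exprMn exprVn sqr_sqrtr ?(ltW (wt0 p)) // exprMn.
  rewrite [leLHS]mulrA ler_pdivrMr // -subr_ge0.
  have := entropy_quadratic2 (d0 p.1) (e0 p.2); rewrite -/(wt p) -subr_ge0.
  move/(mulr_ge0 (sqr_ge0 (S p.1 p.2))); congr (_ <= _).
  by ring.
have v2 : \sum_p v p ^+ 2 <= 3.
  have KE : K = (W *m Q^T) *m diag_mx s *m (Q *m U^T).
    by rewrite /K /specmx !mulmxA.
  have KT : K^T = (U *m Q^T) *m diag_mx s *m (Q *m W^T).
    by rewrite /K trmx_mul (trmx_mul W) specmx_sym trmxK /specmx !mulmxA.
  have rowK j : \sum_i K j i ^+ 2 <= 1.
    by rewrite KE; apply: contraction_sqrow => //; exact: orth_mul.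
  have colK i : \sum_j K j i ^+ 2 <= 1.
    have <- : \sum_j K^T i j ^+ 2 = \sum_j K j i ^+ 2.
      by apply: eq_bigr => j _; rewrite mxE.
    by rewrite KT; apply: contraction_sqrow => //; exact: orth_mul.
  have -> : \sum_p v p ^+ 2 = \sum_i d 0 i * (\sum_j K j i ^+ 2) +
      2 * \sum_j e 0 j * (\sum_i K j i ^+ 2).
    transitivity (\sum_i \sum_j (d 0 i * K j i ^+ 2 + 2 * (e 0 j * K j i ^+ 2))).
      rewrite pair_bigA /=; apply: eq_bigr => p _.
      by rewrite /v exprMn sqr_sqrtr ?(ltW (wt0 p)) // /wt; ring.
    under eq_bigr do rewrite big_split /= -!big_distrr /=.
    rewrite big_split /=; congr (_ + _); rewrite -big_distrr exchange_big /=.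
    by congr (_ * _); apply: eq_bigr => j _; rewrite big_distrr.
  have -> : 3 = \sum_i d 0 i + 2 * \sum_j e 0 j :> R by rewrite trX trY; ring.
  rewrite lerD //.
    by apply: ler_sum => i _; rewrite ler_piMr.
  rewrite ler_wpM2l //; apply: ler_sum => i _; rewrite ler_piMr //.
  exact: ltW.
rewrite trE; apply: le_trans (sum_CauchySchwarz _ _) _.
apply: le_trans u2; rewrite [leRHS]mulrC ler_wpM2l //.
by apply: sumr_ge0 => p _; exact: sqr_ge0.
Qed.

End norms.

(** * The approximate exponentiated gradient step *)

Section meg.
Context {R : realType} {n : nat}.
Implicit Types (U W A B X Y G : 'M[R]_n) (d e a : 'rV[R]_n).

Definition posdef Y := exists W e,
  [/\ W *m W^T = 1%:M, Y = specmx W e & forall i, 0 < e 0 i].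

(* [Y] and [ln Y] are small on the orthogonal complement of an r-dimensional
   space; this is what a step passes on to the next one about its spectrum. *)
Definition tail_bound (r : nat) (s : R) Y := exists V : 'M[R]_(n, r),
  forall v : 'rV[R]_n, v *m V = 0 ->
    quad v (logmx Y) <= ln s * (v *m v^T) 0 0 /\ quad v Y <= s * (v *m v^T) 0 0.

Lemma posdef_sym Y : posdef Y -> Y^T = Y.
Proof. by case=> W [e [_ -> _]]; exact: specmx_sym. Qed.

Lemma logmx_sym Y : Y^T = Y -> (logmx Y)^T = logmx Y.
Proof. exact: mxfun_sym. Qed.

Lemma bregX_ge0 X Y : spectrahedron X -> spectrahedron Y -> posdef Y -> 0 <= bregX X Y.
Proof.
move=> SX SY pY; have := pinsker SX SY pY.
by have := sqr_ge0 (nuclear_norm (X - Y)); lra.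
Qed.

(** In logarithms the exact step is linear, and the normalizing constant [k] cancels because [u] and
    [Xe] have the same trace. *)
Lemma bregX_three_point u X Xe G (eta k : R) :
  spectrahedron u -> spectrahedron Xe ->
  logmx Xe = logmx X - eta *: G - k%:M ->
  eta * \tr (G *m (Xe - u)) = bregX u X - bregX u Xe - bregX Xe X.
Proof.
move=> [_ tu] [_ te] LE.
have h Y : \tr Y = 1 -> \tr (Y *m logmx Xe) =
    \tr (Y *m logmx X) - eta * \tr (G *m Y) - k.
  move=> tY; rewrite LE !mulmxBr !raddfB /= -scalemxAr mxtraceZ mul_mx_scalar.
  by rewrite mxtraceZ tY mulr1 [\tr (Y *m G)]mxtrace_mulC.
by rewrite /bregX mulmxBr !raddfB /= !h //; ring.
Qed.

Lemma quad1 (v : 'rV[R]_n) : quad v 1%:M = (v *m v^T) 0 0.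
Proof. by rewrite /quad mulmx1. Qed.

Lemma dot_orth (v : 'rV[R]_n) U : U *m U^T = 1%:M ->
  (v *m v^T) 0 0 = \sum_i (v *m U^T) 0 i ^+ 2.
Proof.
move=> UU; rewrite -quad1 -(specmx_const 1 UU) quad_specmx.
by apply: eq_bigr => i _; rewrite mxE mul1r.
Qed.

Lemma quad_specmx_gt0 (v : 'rV[R]_n) U d : U *m U^T = 1%:M ->
  (forall i, 0 < d 0 i) -> v != 0 -> 0 < quad v (specmx U d).
Proof.
move=> UU d0 v0; rewrite lt_neqAle eq_sym quad_specmx; apply/andP; split; last first.
  by apply: sumr_ge0 => i _; rewrite mulr_ge0 ?sqr_ge0 // ltW.
rewrite psumr_eq0 => [|i _]; last by rewrite mulr_ge0 ?sqr_ge0 // ltW.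
apply: contra v0 => /allP h; apply/eqP/dot_eq0; rewrite (dot_orth v UU).
apply: big1 => i _; have := h i (mem_index_enum i).
by rewrite mulf_eq0 gt_eqF //= => /eqP.
Qed.

Lemma row_orth_neq0 U i : U *m U^T = 1%:M -> row i U != 0.
Proof.
move=> UU; apply/eqP => z; have := orth_rows i i UU; rewrite z mul0mx mxE eqxx.
by move/eqP; rewrite eq_sym oner_eq0.
Qed.

Lemma posdef_quad Y : posdef Y -> forall v : 'rV[R]_n, v != 0 -> 0 < quad v Y.
Proof. by case=> W [e [WW -> e0]] v; exact: quad_specmx_gt0. Qed.

Lemma posdef_specmx Y U d i : posdef Y -> U *m U^T = 1%:M -> Y = specmx U d -> 0 < d 0 i.
Proof.
move=> pY UU YE; rewrite -(quad_row_specmx d i UU) -YE.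
exact/posdef_quad/row_orth_neq0.
Qed.

Lemma expmx_posdef A : A^T = A -> posdef (expmx A) /\ logmx (expmx A) = A.
Proof.
case/sym_specmx => U [a [UU -> _]]; rewrite /expmx /logmx !mxfun_specmx //; split.
  by exists U, (map_mx (@expR R) a); split => // i; rewrite mxE expR_gt0.
by congr specmx; apply/rowP => i; rewrite !mxE expRK.
Qed.

(** [F] is arbitrary so that one formula covers both the rank-r part and the projector
    [V *m V^T]. *)
Lemma rank_approx_specmx r U (V : 'M[R]_(n, r)) (F : nat -> R) : (r <= n)%N ->
  (forall (i : 'I_r) (j : 'I_n), i = j :> nat -> row j U = (col i V)^T) ->
  V *m diag_mx (\row_(i < r) F i) *m V^T =
  specmx U (\row_i if (i < r)%N then F i else 0).
Proof.
move=> rn UV; apply/matrixP => p q; rewrite specmxE mxE.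
transitivity (\sum_(i < n | (i < r)%N) F i * U i p * U i q); last first.
  rewrite big_mkcond; apply: eq_bigr => i _; rewrite mxE.
  by case: ifP; rewrite ?mul0r.
rewrite (big_ord_narrow rn); apply: eq_bigr => i _.
have Ui s : U (widen_ord rn i) s = V s i.
  by have := UV i (widen_ord rn i) erefl => /rowP /(_ s); rewrite !mxE.
by rewrite mul_mx_diag !Ui !mxE; ring.
Qed.

(* Courant-Fischer: the first i+1 eigenvectors span a space which meets the
   orthogonal of any r vectors when r <= i. *)
Lemma eigenvalue_le_tail r U a (V : 'M[R]_(n, r)) (i : 'I_n) :
  U *m U^T = 1%:M -> noninc a -> (r <= i)%N ->
  exists v : 'rV[R]_n, [/\ v *m V = 0, (v *m v^T) 0 0 = 1 & a 0 i <= quad v (specmx U a)].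
Proof.
move=> UU na ri.
pose f := widen_ord (ltn_ord i).
have : kermx (rowsub f U *m V) != 0.
  rewrite -mxrank_eq0 mxrank_ker subn_eq0 -ltnNge.
  exact: leq_ltn_trans (rank_leq_col (rowsub f U *m V)) _.
case/rowV0Pn => c /sub_kermxP cV c0.
pose v0 := c *m rowsub f U.
have vU : v0 *m U^T = c *m rowsub f 1%:M.
  by rewrite /v0 -mulmxA mul_rowsub_mx UU.
have v00 : v0 != 0.
  apply: contraNneq c0 => z; apply/eqP/rowP => j; move: vU; rewrite z mul0mx.
  move=> /rowP /(_ (f j)); rewrite !mxE => /esym; rewrite (bigD1 j) //= big1 ?addr0.
    by rewrite !mxE eqxx mulr1.
  move=> k kj; rewrite !mxE [_ == _](_ : _ = false) ?mulr0 //.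
  by apply/negbTE; apply: contraNneq kj => /(congr1 val) /= e; apply/eqP/val_inj.
have [b b0 b1] := normalize_row v00.
have vUk (k : 'I_n) : (i < k)%N -> (v0 *m U^T) 0 k = 0.
  move=> ik; rewrite vU mxE; apply: big1 => j _; rewrite !mxE.
  rewrite [_ == _](_ : _ = false) ?mulr0 //; apply/negbTE/eqP => /(congr1 val) /= e.
  by move: ik; rewrite -e ltnNge -ltnS ltn_ord.
exists (b *: v0); split.
- by rewrite -scalemxAl /v0 -mulmxA cV scaler0.
- by rewrite b1 mxE.
have -> : a 0 i = a 0 i * ((b *: v0) *m (b *: v0)^T) 0 0 by rewrite b1 mx00_1 mulr1.
rewrite (dot_orth _ UU) quad_specmx big_distrr /=; apply: ler_sum => k _.
rewrite -scalemxAl mxE; have [ki|ik] := leqP k i.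
  by rewrite ler_wpM2r ?sqr_ge0 //; exact: na.
by rewrite vUk // mulr0 expr0n /= !mulr0.
Qed.

(** The right side minus the left is the Bregman distance from [X] to the normalized exponential of
    [specmx U a]. *)
Lemma gibbs U a X : U *m U^T = 1%:M -> spectrahedron X -> (0 < n)%N ->
  \tr (X *m specmx U a) - \tr (X *m logmx X) <= ln (\sum_i expR (a 0 i)).
Proof.
move=> UU SX n0; set S := \sum_i _.
have S0 : 0 < S.
  rewrite /S; case: n a n0 {S SX UU} => // m a _.
  by rewrite big_ord_recl ltr_wpDr ?expR_gt0 // sumr_ge0 // => j _; rewrite expR_ge0.
pose Xe := specmx U (\row_i (expR (a 0 i) / S)).
have pe : posdef Xe.
  by exists U, (\row_i (expR (a 0 i) / S)); split => // i; rewrite mxE divr_gt0 ?expR_gt0.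
have Se : spectrahedron Xe.
  apply: spectrahedron_specmx => // [i|]; first by rewrite mxE divr_ge0 ?expR_ge0 // ltW.
  by under eq_bigr do rewrite mxE; rewrite -big_distrl /= mulfV ?gt_eqF.
have := bregX_ge0 SX Se pe; rewrite /bregX raddfB /=.
have -> : logmx Xe = specmx U a - (ln S)%:M.
  rewrite /logmx mxfun_specmx // -(specmx_const _ UU) -specmxB; congr specmx.
  by apply/rowP => i; rewrite !mxE ln_div ?posrE ?expR_gt0 // expRK.
rewrite mulmxBr raddfB /= mul_mx_scalar mxtraceZ (proj2 SX) mulr1.
by lra.
Qed.

End meg.

Section meg_step.
Context {R : realType} {n : nat}.
Implicit Types (U W A B X Y G : 'M[R]_n) (d e a : 'rV[R]_n).

Lemma sum_split_ord r (F : 'I_n -> R) :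
  \sum_i F i = \sum_(i < n | (i < r)%N) F i + \sum_(i < n | ~~ (i < r)%N) F i.
Proof. by rewrite (bigID (fun i : 'I_n => (i < r)%N)). Qed.

Lemma sum_tail_const r (c : R) : (r <= n)%N ->
  \sum_(i < n | ~~ (i < r)%N) c = (n%:R - r%:R) * c.
Proof.
move=> rn; apply: (addrI (\sum_(i < n | (i < r)%N) c)).
rewrite -sum_split_ord (big_ord_narrow rn) !sumr_const !card_ord.
by rewrite -[c *+ n]mulr_natl -[c *+ r]mulr_natl; ring.
Qed.

(** The exact update [Xe] and the approximate one share the eigenbasis [U], so they are compared
    eigenvalue by eigenvalue. The diagonalization precedes the tail condition because the caller
    verifies it for these very [a]. The condition bounds each small eigenvalue and not only their
    sum, since the Bregman cost compares logarithms. *)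
Lemma meg_step r (eta eps : R) X G X' :
  (0 < r)%N -> (r < n)%N -> 0 < eps < 1 -> X^T = X -> G^T = G ->
  approx_meg_step r eta eps X G X' ->
  exists U a, [/\ U *m U^T = 1%:M, logmx X - eta *: G = specmx U a, noninc a &
   (forall i : 'I_n, (r <= i)%N ->
      (n%:R - r%:R) * expR (a 0 i) <= eps * \sum_j expR (a 0 j)) ->
   exists Xe k,
     [/\ spectrahedron Xe, posdef Xe, logmx Xe = logmx X - eta *: G - k%:M,
         nuclear_norm (X' - Xe) <= 2 * eps &
     [/\ spectrahedron X', posdef X',
         forall u, spectrahedron u -> bregX u X' <= bregX u Xe - ln (1 - eps) &
         tail_bound r (eps / (n%:R - r%:R)) X']]].
Proof.
move=> r0 rn /andP[e0 e1] sX sG [V [topV X'E]].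
have rn' := ltnW rn.
set A := logmx X - eta *: G in topV X'E *; set P := expmx A in topV X'E.
have sA : A^T = A by rewrite /A linearB /= linearZ /= logmx_sym // sG.
have [pP lP] := expmx_posdef sA.
have [U [d [UU PE nd UV]]] := spectral_top (posdef_sym pP) topV.
rewrite -/(specmx U d) -/P in PE.
have d0 i : 0 < d 0 i := posdef_specmx i pP UU PE.
pose a : 'rV[R]_n := map_mx (@ln R) d.
have AE : A = specmx U a.
  by rewrite -lP -/P PE /logmx mxfun_specmx.
have ea i : expR (a 0 i) = d 0 i by rewrite mxE lnK ?posrE.
exists U, a; split=> //.
  by move=> i j ij; rewrite !mxE ler_ln ?posrE //; exact: nd.
set S := \sum_j _ => tail.
have SE : S = \sum_j d 0 j by apply: eq_bigr => j _; rewrite ea.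
pose q : R := n%:R - r%:R.
have q0 : 0 < q by rewrite subr_gt0 ltr_nat.
have {}tail (i : 'I_n) : (r <= i)%N -> q * d 0 i <= eps * S by move=> /tail; rewrite ea.
pose Sr := \sum_(i < n | (i < r)%N) d 0 i.
have Sr0 : 0 < Sr.
  rewrite /Sr (big_ord_narrow rn'); case: (r) r0 rn' => // m _ h.
  by rewrite big_ord_recl ltr_wpDr // sumr_ge0 // => j _; rewrite ltW.
pose St := \sum_(i < n | ~~ (i < r)%N) d 0 i.
have St0 : 0 <= St by apply: sumr_ge0 => i _; rewrite ltW.
have Ssplit : S = Sr + St by rewrite SE (sum_split_ord r).
have S0 : 0 < S by rewrite Ssplit ltr_wpDr.
have Stle : St <= eps * S.
  have := @sum_tail_const r (eps * S / q) rn'.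
  rewrite -/q [q * _]mulrC divfK ?gt_eqF // => <-.
  by apply: ler_sum => i; rewrite -leqNgt => /tail; rewrite ler_pdivlMr // mulrC.
pose F (i : nat) : R := eigval i.+1 P.
have FE (i : 'I_n) : F i = d 0 i by rewrite /F PE (eigval_diag i UU nd).
have PrE : rank_approx P V = specmx U (\row_i if (i < r)%N then d 0 i else 0).
  rewrite /rank_approx (rank_approx_specmx (U := U) F rn' UV); congr specmx.
  by apply/rowP => i; rewrite !mxE FE.
have VVE : V *m V^T = specmx U (\row_i if (i < r)%N then 1 else 0).
  rewrite -(rank_approx_specmx (U := U) (fun=> 1) rn' UV).
  have -> : diag_mx (\row_(i < r) (1 : R)) = 1%:M.
    by apply/matrixP => i j; rewrite !mxE.
  by rewrite mulmx1.
have trPr : \tr (rank_approx P V) = Sr.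
  rewrite PrE tr_specmx // /Sr [RHS]big_mkcond; apply: eq_bigr => i _.
  by rewrite mxE; case: ifP.
pose z : 'rV[R]_n := \row_i if (i < r)%N then (1 - eps) * d 0 i / Sr else eps / q.
have X'z : X' = specmx U z.
  rewrite X'E trPr PrE VVE -(specmx_const 1 UU) -specmxB -!specmxZ -specmxD.
  congr specmx; apply/rowP => i; rewrite !mxE -/q; case: ifP => _.
    by rewrite subrr mulr0 addr0; ring.
  by rewrite subr0 !mulr0 add0r mulr1.
have z0 i : 0 < z 0 i.
  by rewrite mxE; case: ifP => _; rewrite ?divr_gt0 // mulr_gt0 // subr_gt0.
have z1 : \sum_i z 0 i = 1.
  rewrite (sum_split_ord r) (eq_bigr (fun i => (1 - eps) / Sr * d 0 i)); last first.
    by move=> i ir; rewrite mxE ir; ring.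
  rewrite -big_distrr /= -/Sr divfK ?gt_eqF //.
  rewrite (eq_bigr (fun=> eps / q)); last by move=> i /negbTE ir; rewrite mxE ir.
  by rewrite sum_tail_const // -/q mulrC divfK ?gt_eqF // subrK.
pose Xe := specmx U (\row_i (d 0 i / S)).
have SXe : spectrahedron Xe.
  apply: spectrahedron_specmx => // [i|].
    by rewrite mxE divr_ge0 // ltW.
  under eq_bigr do rewrite mxE.
  by rewrite -big_distrl /= -SE mulfV ?gt_eqF.
have pXe : posdef Xe.
  by exists U, (\row_i (d 0 i / S)); split => // i; rewrite mxE divr_gt0.
have lXe : logmx Xe = A - (ln S)%:M.
  rewrite AE /logmx mxfun_specmx // -(specmx_const _ UU) -specmxB; congr specmx.
  by apply/rowP => i; rewrite !mxE ln_div ?posrE.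
have SX' : spectrahedron X' by rewrite X'z; apply: spectrahedron_specmx => // i; rewrite ltW.
exists Xe, (ln S); split=> //.
  rewrite X'z -specmxB nuclear_norm_specmx // (sum_split_ord r) mulr2n mulrDl !mul1r.
  (* Head and tail contribute at most eps each: 1 - eps <= Sr / S <= 1 for the head, and n - r terms
     of size at most eps / q for the tail. *)
  have SrS : (1 - eps) * S <= Sr.
    have -> : Sr = S - St by rewrite Ssplit; ring.
    by rewrite mulrBl mul1r lerB.
  have SrS' : Sr <= S by rewrite Ssplit lerDl.
  apply: lerD.
    rewrite (eq_bigr (fun i => `|(1 - eps) / Sr - S^-1| * d 0 i)); last first.
      move=> i ir; rewrite !mxE ir -[X in _ = _ * X](ger0_norm (ltW (d0 i))) -normrM.
      by congr `|_|; ring.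
    rewrite -big_distrr /= -/Sr -[X in _ * X <= _](ger0_norm (ltW Sr0)) -normrM.
    have -> : ((1 - eps) / Sr - S^-1) * Sr = (1 - eps) - Sr / S.
      by field; rewrite !gt_eqF.
    have h1 : Sr / S <= 1 by rewrite ler_pdivrMr // mul1r.
    have h2 : 1 - eps <= Sr / S by rewrite ler_pdivlMr.
    by rewrite ler_norml; apply/andP; split; lra.
  rewrite -[leRHS](divfK (lt0r_neq0 q0)) mulrC -sum_tail_const //.
  apply: ler_sum => i ir; rewrite !mxE (negbTE ir).
  have h1 : 0 < d 0 i / S by rewrite divr_gt0.
  have h2 : d 0 i / S <= eps / q.
    rewrite ler_pdivrMr // mulrAC ler_pdivlMr // mulrC; apply: tail.
    by rewrite leqNgt.
  by rewrite ler_norml; apply/andP; split; lra.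
split=> //.
- by exists U, z.
(* [logmx X'] dominates [logmx Xe] plus ln (1 - eps) as an operator: in the head because Sr <= S, in
   the tail because the flat value eps / q is at least the eigenvalue it replaces. *)
- move=> u Su.
  suff : 0 <= \tr (u *m logmx X') - (\tr (u *m logmx Xe) + ln (1 - eps)).
    by rewrite /bregX !raddfB /=; lra.
  have {1}<- : \tr (u *m (ln (1 - eps))%:M) = ln (1 - eps).
    by rewrite mul_mx_scalar mxtraceZ (proj2 Su) mulr1.
  rewrite -raddfD /= -mulmxDr -raddfB /= -mulmxBr.
  apply: tr_psd_ge0; first exact: (proj1 Su).
  rewrite lXe AE X'z /logmx mxfun_specmx // -!(specmx_const _ UU).
  rewrite -specmxB -specmxD -specmxB; apply: specmx_psd => i.
  rewrite !mxE; case: ifP => ir.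
    rewrite ln_div ?posrE ?mulr_gt0 // ?subr_gt0 // lnM ?posrE ?subr_gt0 //.
    have : ln Sr <= ln S by rewrite ler_ln ?posrE // Ssplit lerDl.
    lra.
  have h : ln (d 0 i / S) <= ln (eps / q).
    rewrite ler_ln ?posrE ?divr_gt0 //.
    rewrite ler_pdivrMr // mulrAC ler_pdivlMr // mulrC; apply: tail.
    by rewrite leqNgt ir.
  have l1 : ln (1 - eps) <= 0 by apply: ln_le0; lra.
  by move: h; rewrite ln_div ?posrE //; lra.
- exists V => v vV.
  have vU (i : 'I_n) : (i < r)%N -> (v *m U^T) 0 i = 0.
    move=> ir; have -> : (v *m U^T) 0 i = (v *m V) 0 (Ordinal ir).
      have /rowP e := UV (Ordinal ir) i erefl.
      by rewrite !mxE; apply: eq_bigr => j _; have := e j; rewrite !mxE => ->.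
    by rewrite vV mxE.
  rewrite X'z /logmx mxfun_specmx // !quad_specmx (dot_orth v UU) !big_distrr /=.
  have lz i : map_mx (@ln R) z 0 i = ln (z 0 i) by rewrite mxE.
  have zE i : z 0 i = if (i < r)%N then (1 - eps) * d 0 i / Sr else eps / q by rewrite mxE.
  by split; apply: ler_sum => i _; rewrite ?lz zE; case: ifP => // ir;
    rewrite vU // expr0n /= !mulr0.
Qed.

End meg_step.

(** * Complementarity at the saddle point under the eigenvalue gap *)

Section eigengap.
Context {R : realType}.

Lemma rank_specmx_noninc n (U : 'M[R]_n) (d : 'rV[R]_n) (i : 'I_n) :
  U *m U^T = 1%:M -> noninc d -> (forall i, 0 <= d 0 i) ->
  (0 < d 0 i) = (i < \rank (specmx U d))%N.
Proof.
move=> UU nd d0.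
have uU : U \in unitmx by have [] := mulmx1_unit UU.
have uUT : U^T \in unitmx by have [] := mulmx1_unit UU.
have -> : \rank (specmx U d) = \rank (diag_mx d).
  rewrite /specmx mxrankMfree ?row_free_unit //.
  by rewrite -mxrank_tr trmx_mul trmxK mxrankMfree ?row_free_unit // mxrank_tr.
apply/idP/idP => [di|].
  (* A truncated inverse: it turns the first i + 1 diagonal entries into 1 and the others into 0. *)
  pose e : 'rV[R]_n := \row_j if (j <= i)%N then (d 0 j)^-1 else 0.
  have E : diag_mx e *m diag_mx d = pid_mx i.+1 :> 'M[R]_n.
    rewrite mulmx_diag; apply/matrixP => j k; rewrite !mxE ltnS -val_eqE /=.
    have [ji|ij] := leqP j i; last by rewrite mul0r mul0rn andbF.
    rewrite andbT mulVf // gt_eqF // (lt_le_trans di) //; exact: nd.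
  have := mxrankM_maxr (diag_mx e) (diag_mx d).
  by rewrite E rank_pid_mx.
apply: contraTT; rewrite -leNgt -leqNgt => di.
have E : diag_mx d = diag_mx d *m (pid_mx i : 'M[R]_n).
  apply/matrixP => j k; rewrite mul_diag_mx !mxE -val_eqE /=.
  have [jk|jk] := eqVneq (j : nat) k; last by rewrite mulr0.
  have [_|ik] := ltnP j i; first by rewrite mulr1.
  have -> : d 0 j = 0.
    apply/eqP; rewrite eq_le d0 andbT (le_trans _ di) //; exact: nd.
  by rewrite mul0rn mul0r.
rewrite E; apply: leq_trans (mxrankM_maxr _ _) _.
by rewrite rank_pid_mx // ltnW.
Qed.

Lemma eigval_specmx n (U : 'M[R]_n) (d : 'rV[R]_n) (k : nat) (i : 'I_n) :
  U *m U^T = 1%:M -> noninc d -> k.-1 = i -> eigval k (specmx U d) = d 0 i.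
Proof. by move=> UU nd ki; rewrite /eigval ki eigenvalues_diag // nth_rowseq. Qed.

Lemma mxtrace_sqr_eq0 n (A : 'M[R]_n) : A^T = A -> \tr (A *m A) = 0 -> A = 0.
Proof.
move=> sA; have -> : \tr (A *m A) = \sum_i \sum_j A i j ^+ 2.
  rewrite /mxtrace; apply: eq_bigr => i _; rewrite mxE; apply: eq_bigr => j _.
  by rewrite -{2}sA mxE expr2.
move=> /eqP; rewrite psumr_eq0 => [/allP h|i _]; last first.
  by apply: sumr_ge0 => j _; exact: sqr_ge0.
apply/matrixP => i j; rewrite mxE; have := h i (mem_index_enum i).
rewrite psumr_eq0 => [/allP h'|k _]; last exact: sqr_ge0.
by have := h' j (mem_index_enum j); rewrite /= sqrf_eq0 => /eqP.
Qed.

Lemma rank1_spectrahedron n (v : 'rV[R]_n) : (v *m v^T) 0 0 = 1 ->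
  spectrahedron (v^T *m v).
Proof.
move=> v1; split; last by rewrite mxtrace_mulC /mxtrace big_ord1.
apply: quad_psd; first by rewrite trmx_mul trmxK.
move=> w; rewrite /quad !mulmxA -mulmxA.
have -> : v *m w^T = (w *m v^T)^T by rewrite trmx_mul trmxK.
exact: dot_ge0.
Qed.

Lemma tr_rank1 n (v : 'rV[R]_n) A : \tr (A *m (v^T *m v)) = quad v A.
Proof. by rewrite mulmxA mxtrace_mulC /mxtrace big_ord1 /quad mulmxA. Qed.

(** Optimality makes the trace of [Gs *m Xs] the least eigenvalue of [Gs], and the gap then confines
    [Xs] to the span of the r lowest eigenvectors. As [Xs] has rank r, that span is its range, with
    projector [P]. The result takes the form of operator inequalities, ready to be traced against
    any point of the spectrahedron. *)
Lemma eigengap_structure n (Xs Gs : 'M[R]_n) (r : nat) (delta : R) :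
  spectrahedron Xs -> Gs^T = Gs -> r = \rank Xs -> (r <= n - 1)%N -> 0 < delta ->
  eigval (n - r) Gs - eigval n Gs >= delta ->
  (forall X, spectrahedron X -> \tr (Gs *m Xs) <= \tr (Gs *m X)) ->
  [/\ (0 < r)%N, (r < n)%N, 0 < eigval r Xs <= 1, delta <= 2 * spectral_norm Gs &
   exists P : 'M[R]_n, [/\ psdmx P, psdmx (1%:M - P), psdmx (Xs - eigval r Xs *: P) &
     psdmx (Gs - (\tr (Gs *m Xs))%:M - delta *: (1%:M - P))]].
Proof.
move=> SX sG rE rn1 dl0 gap opt.
have n0 : (0 < n)%N.
  rewrite lt0n; apply/eqP => n0; move: (proj2 SX); subst n.
  by rewrite /mxtrace big_ord0 => /eqP; rewrite eq_sym oner_eq0.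
have rn : (r < n)%N by rewrite -(subnK n0) addn1 ltnS.
have [U [d [UU XE nd d0]]] := psd_specmx (proj1 SX).
have dpos i : (0 < d 0 i) = (i < r)%N by rewrite rE XE; exact: rank_specmx_noninc.
have dzero (i : 'I_n) : (i < r)%N = false -> d 0 i = 0.
  by move=> ir; apply/eqP; rewrite eq_le d0 andbT leNgt dpos ir.
have d1 : \sum_i d 0 i = 1 by rewrite -(proj2 SX) XE tr_specmx.
have r0 : (0 < r)%N.
  rewrite lt0n; apply/eqP => r0; move: d1; rewrite big1 => [/eqP|i _].
    by rewrite eq_sym oner_eq0.
  by apply: dzero; rewrite r0.
have r1n : (r.-1 < n)%N by rewrite prednK // ltnW.
set lam := eigval r Xs.
have lamE : lam = d 0 (Ordinal r1n).
  by rewrite /lam XE; apply: eigval_specmx.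
have lam0 : 0 < lam by rewrite lamE dpos /= prednK.
have lam1 : lam <= 1.
  by rewrite lamE -d1 (bigD1 (Ordinal r1n)) //= lerDl sumr_ge0.
have lamle (i : 'I_n) : (i < r)%N -> lam <= d 0 i.
  by move=> ir; rewrite lamE; apply: nd => /=; rewrite -ltnS prednK.
have [W [g [WW GE ng]]] := sym_specmx sG.
have l1n : (n.-1 < n)%N by rewrite prednK.
have k1n : ((n - r).-1 < n)%N by rewrite prednK ?subn_gt0 // leq_subr.
pose il := Ordinal l1n; pose ik := Ordinal k1n.
have muE : eigval n Gs = g 0 il.
  by rewrite GE; apply: eigval_specmx.
have kE : eigval (n - r) Gs = g 0 ik.
  by rewrite GE; apply: eigval_specmx.
rewrite muE kE in gap.
have gmin i : g 0 il <= g 0 i by apply: ng; rewrite /= -ltnS prednK.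
have glt (i : 'I_n) : (i < n - r)%N -> g 0 il + delta <= g 0 i.
  move=> ir; rewrite -lerBrDl (le_trans gap) // lerD2r; apply: ng.
  by rewrite /= -ltnS prednK ?subn_gt0.
have trXG : \tr (Gs *m Xs) = g 0 il + \sum_i (g 0 i - g 0 il) * quad (row i W) Xs.
  have e : \tr ((g 0 il)%:M *m Xs) = g 0 il.
    by rewrite mul_scalar_mx mxtraceZ (proj2 SX) mulr1.
  rewrite -[X in X + _]e.
  rewrite -(specmx_const _ WW) GE !tr_specmxM -big_split /=.
  by apply: eq_bigr => i _; rewrite mxE; ring.
have q0 i : 0 <= quad (row i W) Xs by apply: psd_quad; case: SX.
(* Optimality is tested against the projector on a lowest eigenvector. *)
have tr_le : \tr (Gs *m Xs) <= g 0 il.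
  have v1 : (row il W *m (row il W)^T) 0 0 = 1 by rewrite orth_rows // eqxx.
  by have := opt _ (rank1_spectrahedron v1); rewrite tr_rank1 GE quad_row_specmx.
have s0 : \sum_i (g 0 i - g 0 il) * quad (row i W) Xs = 0.
  apply/eqP; rewrite eq_le -(lerD2l (g 0 il)) -trXG addr0 tr_le /=.
  by apply: sumr_ge0 => i _; rewrite mulr_ge0 // subr_ge0.
have trE : \tr (Gs *m Xs) = g 0 il by rewrite trXG s0 addr0.
have qz (i : 'I_n) : (i < n - r)%N -> quad (row i W) Xs = 0.
  move=> ir; move/eqP: s0; rewrite psumr_eq0 => [/allP h|j _]; last first.
    by rewrite mulr_ge0 // subr_ge0.
  have := h i (mem_index_enum i); rewrite /= mulf_eq0 => /orP[|/eqP //].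
  by have := glt i ir; rewrite subr_eq0 => + /eqP e; rewrite e; lra.
pose P := specmx U (\row_i if (i < r)%N then 1 else 0 : R).
pose Q := specmx W (\row_i if (i < n - r)%N then 0 else 1 : R).
have CP : 1%:M - P = specmx U (\row_i if (i < r)%N then 0 else 1 : R).
  rewrite -(specmx_const 1 UU) -specmxB; congr specmx; apply/rowP => i.
  by rewrite !mxE; case: ifP; rewrite ?subrr ?subr0.
have CQ : 1%:M - Q = specmx W (\row_i if (i < n - r)%N then 1 else 0 : R).
  rewrite -(specmx_const 1 WW) -specmxB; congr specmx; apply/rowP => i.
  by rewrite !mxE; case: ifP; rewrite ?subrr ?subr0.
have pP : psdmx P by apply: specmx_psd => i; rewrite mxE; case: ifP.
have pCP : psdmx (1%:M - P) by rewrite CP; apply: specmx_psd => i; rewrite mxE; case: ifP.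
have pCQ : psdmx (1%:M - Q) by rewrite CQ; apply: specmx_psd => i; rewrite mxE; case: ifP.
have pXP : psdmx (Xs - lam *: P).
  rewrite XE /P -specmxZ -specmxB; apply: specmx_psd => i; rewrite !mxE.
  by case: ifP => ir; rewrite ?mulr1 ?mulr0 ?subr0 // subr_ge0 lamle.
have trP : \tr P = r%:R.
  rewrite /P tr_specmx //; under eq_bigr do rewrite mxE.
  by rewrite -big_mkcond /= (big_ord_narrow (ltnW rn)) sumr_const card_ord.
have trQ : \tr Q = r%:R.
  have -> : Q = 1%:M - (1%:M - Q) by rewrite opprB addrCA subrr addr0.
  rewrite raddfB /= mxtrace1 CQ tr_specmx //; under eq_bigr do rewrite mxE.
  rewrite -big_mkcond /= (big_ord_narrow (leq_subr r n)) sumr_const card_ord.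
  by rewrite natrB ?(ltnW rn) // opprB addrCA subrr addr0.
have trCQX : \tr ((1%:M - Q) *m Xs) = 0.
  rewrite CQ tr_specmxM; apply: big1 => i _; rewrite mxE; case: ifP => ir.
    by rewrite qz // mulr0.
  by rewrite mul0r.
(* [Xs] has no mass on 1 - Q, and lam P <= Xs, so [P] has none either. *)
have trCQP : \tr ((1%:M - Q) *m P) = 0.
  have h1 := tr_psd_ge0 pCQ pP.
  have := tr_psd_ge0 pCQ pXP; rewrite mulmxBr raddfB /= trCQX sub0r -scalemxAr.
  rewrite mxtraceZ oppr_ge0 pmulr_rle0 // => h2.
  by apply/eqP; rewrite eq_le h1 h2.
have trQP : \tr (Q *m P) = r%:R.
  by move: trCQP; rewrite mulmxBl mul1mx raddfB /= trP => /eqP; rewrite subr_eq0 => /eqP.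
have PP : P *m P = P.
  rewrite /P specmxM //; congr specmx; apply/rowP => i; rewrite !mxE.
  by case: ifP; rewrite ?mulr1 ?mulr0.
have QQ : Q *m Q = Q.
  rewrite /Q specmxM //; congr specmx; apply/rowP => i; rewrite !mxE.
  by case: ifP; rewrite ?mulr1 ?mulr0.
(* Two projectors of trace r whose product has trace r: the square of Q - P has trace r - r - r + r
   = 0. *)
have QP : Q = P.
  apply/eqP; rewrite -subr_eq0; apply/eqP/mxtrace_sqr_eq0.
    by rewrite linearB /= !specmx_sym.
  rewrite mulmxBr !mulmxBl QQ PP !raddfB /= [\tr (P *m Q)]mxtrace_mulC trQP trP trQ.
  by rewrite !subrr addr0.
split=> //; first by rewrite lam0 lam1.
  have := spectral_norm_specmx g ik WW; have := spectral_norm_specmx g il WW.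
  rewrite -GE !ler_norml => /andP[h1 h2] /andP[h3 h4]; lra.
exists P; split=> //.
rewrite trE -QP CQ GE -(specmx_const _ WW) -specmxZ -!specmxB.
apply: specmx_psd => i; rewrite !mxE; case: ifP => ir.
  by rewrite mulr1 -subr_ge0; have := glt i ir; lra.
by rewrite mulr0 subr0 subr_ge0.
Qed.

End eigengap.

(** * First order conditions *)

Section normed_vector.
Context {R : realType} {V : normedVectType R}.

(* On coordinates, the norm attains a positive minimum on the unit sphere. *)
Lemma coord_bounded : exists2 C : R, 0 < C &
  forall (v : V) i, `|coord (vbasis {:V}) i v| <= C * `|v|.
Proof.
set b := vbasis {:V}; set d := \dim {:V}.
pose phi (x : 'rV[R]_d) : V := \sum_i x 0 i *: b`_i.
pose psi (v : V) : 'rV[R]_d := \row_i coord b i v.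
have psiK v : phi (psi v) = v.
  rewrite [RHS](coord_vbasis (memvf v)); apply: eq_bigr => i _.
  by rewrite mxE.
have phi0 x : phi x = 0 -> x = 0.
  have fb : free b := basis_free (vbasisP {:V}).
  have hf := elimT (@freeP _ _ _ b) fb.
  by move=> /hf h; apply/rowP => i; rewrite mxE h.
have phiZ c x : phi (c *: x) = c *: phi x.
  by rewrite /phi scaler_sumr; apply: eq_bigr => i _; rewrite mxE scalerA.
have cphi : continuous phi.
  move=> x; rewrite /phi; apply: (@continuous_big V _ +%R 0 xpredT) => //.
    exact: add_continuous.
  move=> i _ {}x; apply: (@cvgZr_tmp _ _ _ (nbhs x)); exact: (@coord_continuous R 1 d 0 i).
pose S := [set x : 'rV[R]_d | `|x| = 1].
have cS : compact S.
  apply: bounded_closed_compact.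
    exists 1; split; first exact: num_real.
    by move=> m m1 v /= ->; rewrite ltW.
  apply: (@preimage_closed _ _ (fun x : 'rV[R]_d => `|x|) [set 1]).
    by move=> x _; exact: norm_continuous.
  exact: closed_eq.
have [S0|S0] := pselect (S !=set0); last first.
  exists 1 => // v i; have [/eqP|x0] := eqVneq (psi v) 0.
    move=> /eqP /rowP /(_ i); rewrite !mxE => ->.
    by rewrite normr0 mul1r normr_ge0.
  exfalso; apply: S0; exists (`|psi v|^-1 *: psi v).
  rewrite /S /= normrZ normrV ?unitfE ?normr_eq0 // normr_id mulVf //.
  by rewrite normr_eq0.
have [|c cS' cmin] := @compact_EVT_min _ R (fun x => `|phi x|) S S0 cS.
  apply: continuous_subspaceT => x; apply: continuous_comp; first exact: cphi.
  exact: norm_continuous.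
have c1 : `|c| = 1 by move: cS'; rewrite inE.
have m0 : 0 < `|phi c|.
  rewrite normr_gt0; apply/eqP => /phi0 c0; move: c1; rewrite c0 normr0.
  by move/eqP; rewrite eq_sym oner_eq0.
exists (`|phi c|^-1); first by rewrite invr_gt0.
move=> v i; have xi : `|coord b i v| <= `|psi v|.
  have -> : coord b i v = psi v 0 i by rewrite mxE.
  rewrite [leRHS]/Num.norm /= mx_normrE.
  by apply: (le_bigmax _ (fun ij : 'I_1 * 'I_d => `|psi v ij.1 ij.2|) (0, i)).
apply: le_trans xi _; rewrite ler_pdivlMl //.
have [->|x0] := eqVneq (psi v) 0; first by rewrite normr0 mulr0.
have n0 : 0 < `|psi v| by rewrite normr_gt0.
have := cmin (`|psi v|^-1 *: psi v).
rewrite inE /S /= normrZ normrV ?unitfE ?normr_eq0 // normr_id mulVf ?gt_eqF //.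
move=> /(_ erefl); rewrite phiZ normrZ normrV ?unitfE ?normr_eq0 // normr_id psiK.
by rewrite ler_pdivlMl // mulrC.
Qed.

Variable ip : {dot V for idfun}.

Lemma ipC u v : ip u v = ip v u.
Proof. by rewrite hermC expr0 mul1r. Qed.

Lemma ipBr u v w : ip u (v - w) = ip u v - ip u w.
Proof. exact: linearBr. Qed.

Lemma ipBl u v w : ip (u - v) w = ip u w - ip v w.
Proof. exact: linearBl. Qed.

Lemma ipZr c u v : ip u (c *: v) = c * ip u v.
Proof. exact: linearZr_LR. Qed.

Lemma ipZl c u v : ip (c *: u) v = c * ip u v.
Proof. exact: linearZl_LR. Qed.

(** The norm is unrelated to [ip], so the bound comes from coordinates rather than from
    Cauchy-Schwarz. *)
Lemma ip_bounded g : exists2 C : R, 0 < C & forall v, `|ip g v| <= C * `|v|.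
Proof.
have [C C0 hC] := coord_bounded.
pose M := \sum_(i < \dim {:V}) `|ip g (vbasis {:V})`_i|.
have M0 : 0 <= M by apply: sumr_ge0.
exists (C * (M + 1)); first by rewrite mulr_gt0 // ltr_wpDl.
move=> v; rewrite {1}(coord_vbasis (memvf v)) linear_sumr.
apply: le_trans (ler_norm_sum _ _ _) _.
apply: (@le_trans _ _ (\sum_(i < \dim {:V}) (C * `|v|) * `|ip g (vbasis {:V})`_i|)).
  by apply: ler_sum => i _; rewrite linearZr_LR /= normrM ler_wpM2r.
rewrite -big_distrr /= -/M [leRHS]mulrAC ler_wpM2l ?mulr_ge0 ?(ltW C0) //.
by rewrite lerDl.
Qed.

(** [sup] is an upper bound only for a bounded set; boundedness is [ip_bounded]. *)
Lemma dual_normP g v : ip g v <= dual_norm ip g * `|v|.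
Proof.
have [C C0 hC] := ip_bounded g.
have hs : has_sup [set ip g v | v in [set v : V | `|v| <= 1]].
  split; first by exists (ip g 0), 0 => //=; rewrite normr0.
  exists C => _ [u /= u1 <-]; apply: le_trans (ler_norm _) _.
  by apply: le_trans (hC u) _; rewrite ler_piMr // ltW.
have [->|v0] := eqVneq v 0; first by rewrite linear0r normr0 mulr0.
have n0 : 0 < `|v| by rewrite normr_gt0.
have : ip g (`|v|^-1 *: v) <= dual_norm ip g.
  apply: sup_upper_bound => //; exists (`|v|^-1 *: v) => //=.
  by rewrite normrZ normrV ?unitfE ?normr_eq0 // normr_id mulVf ?gt_eqF.
by rewrite linearZr_LR /= mulrC ler_pdivrMr.
Qed.

End normed_vector.

(** * Differentials relative to a set and first order inequalities *)

Section relative_differential.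
Context {R : realType} {W : normedModType R}.
Implicit Types (A : set W) (g : W -> R) (L : W -> R) (x z : W) (e s : R).

(* Only increments inside [A] count, which is enough for first order conditions
   along segments of [A]. *)
Definition reldiff A g x L := forall e, 0 < e -> exists2 r : R, 0 < r &
  forall p, A p -> `|p - x| < r -> `|g p - g x - L (p - x)| <= e * `|p - x|.

Lemma littleo_reldiff A g x L :
  (let F := within A (nbhs x) in
   (fun p => g p - g x - L (p - x) : R) =o_F (fun p => p - x)) -> reldiff A g x L.
Proof.
move=> /= /eqoP ho e e0; have := ho e e0.
rewrite /within /= => /nbhs_ballP [r r0 hr]; exists r => // p Ap pr.
by apply: hr => //; rewrite -ball_normE /= distrC.
Qed.

Lemma reldiffN A g x L : reldiff A g x L -> reldiff A (- g) x (fun z => - L z).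
Proof.
move=> d e e0; have [r r0 hr] := d e e0; exists r => // p Ap pr.
by rewrite /= -!opprD normrN; exact: hr.
Qed.

Lemma reldiff_segment A g x L z : reldiff A g x L ->
  (forall s u, L (s *: u) = s * L u) ->
  (forall s, 0 <= s <= 1 -> A (s *: z + (1 - s) *: x)) ->
  forall e, 0 < e -> exists2 s0 : R, 0 < s0 <= 1 & forall s, 0 < s <= s0 ->
    `|g (s *: z + (1 - s) *: x) - g x - s * L (z - x)| <= e * s.
Proof.
move=> d LZ Az e e0; pose N := `|z - x| + 1.
have N0 : 0 < N by rewrite ltr_wpDl.
have [r r0 hr] := d _ (divr_gt0 e0 N0).
exists (Num.min 1 (r / 2 / N)).
  by rewrite lt_min ltr01 !divr_gt0 // ge_min lexx.
move=> s /andP[s0]; rewrite le_min => /andP[s1 sr].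
have Ap : A (s *: z + (1 - s) *: x) by apply: Az; rewrite s1 (ltW s0).
have pE : s *: z + (1 - s) *: x - x = s *: (z - x).
  by rewrite scalerBl scale1r scalerBr addrA addrAC addrK.
have nz : `|s *: (z - x)| = s * `|z - x| by rewrite normrZ gtr0_norm.
have szN : s * `|z - x| <= s * N by rewrite ler_wpM2l ?(ltW s0) // lerDl.
have := hr _ Ap; rewrite pE nz LZ => /(_ _) h; apply: le_trans (h _) _.
  apply: le_lt_trans szN _; rewrite -ltr_pdivlMr // (le_lt_trans sr) //.
  by rewrite ltr_pM2r ?invr_gt0 // ltr_pdivrMr // ltr_pMr // ltr1n.
by rewrite mulrAC ler_pdivrMr // -mulrA ler_wpM2l // ltW.
Qed.

Lemma le_of_small_increments (L M : R) :
  (forall e, 0 < e -> exists2 s, 0 < s & s * L - e * s <= s * M) -> L <= M.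
Proof.
move=> h; apply/ler_addgt0Pr => e e0; have [s s0] := h e e0.
by rewrite [e * s]mulrC -mulrBr ler_pM2l // lerBlDr.
Qed.

Lemma reldiff_convex A g x L z : reldiff A g x L ->
  (forall s u, L (s *: u) = s * L u) ->
  (forall s, 0 <= s <= 1 -> A (s *: z + (1 - s) *: x)) ->
  (forall s, 0 <= s <= 1 -> g (s *: z + (1 - s) *: x) <= s * g z + (1 - s) * g x) ->
  L (z - x) <= g z - g x.
Proof.
move=> d LZ Ac gc; apply: le_of_small_increments => e e0.
have [s0 /andP[s00 s01] hs] := reldiff_segment d LZ Ac e0.
exists s0 => //; have := gc s0; rewrite ltW // s01 => /(_ isT) h2.
have := hs s0; rewrite s00 lexx => /(_ isT); rewrite ler_norml => /andP[h3 _].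
by rewrite mulrBr; lra.
Qed.

Lemma reldiff_strongly_convex A g x L z : reldiff A g x L ->
  (forall s u, L (s *: u) = s * L u) ->
  (forall s, 0 <= s <= 1 -> A (s *: z + (1 - s) *: x)) ->
  (forall s, 0 <= s <= 1 -> g (s *: z + (1 - s) *: x) <=
     s * g z + (1 - s) * g x - s * (1 - s) / 2 * `|z - x| ^+ 2) ->
  2^-1 * `|z - x| ^+ 2 <= g z - g x - L (z - x).
Proof.
move=> d LZ Ac gc; rewrite lerBrDl -lerBrDr.
apply: le_of_small_increments => e e0.
have [s0 /andP[s00 s01] hs] := reldiff_segment d LZ Ac (divr_gt0 e0 (@ltr0Sn R 1)).
set N := `|z - x| ^+ 2 in gc *.
have N0 : 0 <= N by exact: sqr_ge0.
(* The second bound keeps the quadratic remainder s^2 N / 2 below s e / 2; the other half of e went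
   to the differential. *)
pose s := Num.min s0 (e / (N + 1)).
have s_gt0 : 0 < s by rewrite lt_min s00 divr_gt0 // ltr_wpDl.
have s_le : s <= s0 by rewrite ge_min lexx.
have sN : s * N <= e.
  apply: (@le_trans _ _ (s * (N + 1))); first by rewrite ler_wpM2l ?(ltW s_gt0) // lerDl.
  by rewrite -ler_pdivlMr ?ltr_wpDl // ge_min lexx orbT.
exists s => //; have := gc s; rewrite (ltW s_gt0) (le_trans s_le s01) => /(_ isT) h2.
have := hs s; rewrite s_gt0 s_le => /(_ isT); rewrite ler_norml => /andP[h3 _].
have h4 : s * (s * N) <= s * e by rewrite ler_wpM2l // ltW.
have e1 : s * (1 - s) / 2 * N = s * N / 2 - s * (s * N) / 2 by field.
have e2 : s * (g z - g x - 2^-1 * N) = s * g z - s * g x - s * N / 2 by field.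
by rewrite e2; rewrite e1 in h2; lra.
Qed.

Lemma reldiff_min A g x L z : reldiff A g x L ->
  (forall s u, L (s *: u) = s * L u) ->
  (forall s, 0 <= s <= 1 -> A (s *: z + (1 - s) *: x)) ->
  (forall p, A p -> g x <= g p) -> 0 <= L (z - x).
Proof.
move=> d LZ Ac gm; rewrite -oppr_le0.
apply: le_of_small_increments => e e0.
have [s0 /andP[s00 s01] hs] := reldiff_segment d LZ Ac e0.
exists s0 => //; have := hs s0; rewrite s00 lexx => /(_ isT).
rewrite ler_norml => /andP[_ h1].
have := gm _ (Ac s0 _); rewrite (ltW s00) s01 => /(_ isT).
by rewrite mulr0 mulrN; lra.
Qed.

Lemma reldiff_cvg A g x L (C : R) : reldiff A g x L ->
  (forall z, `|L z| <= C * `|z|) -> g @ within A (nbhs x) --> g x.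
Proof.
move=> d hL; apply/cvgrPdist_le => e e0.
have [r r0 hr] := d 1 ltr01.
pose K : R := `|C| + 1.
have K0 : 0 < K by rewrite ltr_wpDl.
rewrite /within /=; apply/nbhs_ballP; exists (Num.min r (e / K)) => /=.
  by rewrite lt_min r0 divr_gt0.
move=> p; rewrite -ball_normE /= distrC lt_min => /andP[pr pe] Ap.
have := hr p Ap pr; rewrite mul1r => h1.
have h2 : `|L (p - x)| <= `|C| * `|p - x|.
  by apply: le_trans (hL _) _; rewrite ler_wpM2r // ler_norm.
rewrite distrC; apply: (@le_trans _ _ (K * `|p - x|)).
  rewrite /K mulrDl mul1r [leRHS]addrC -[g p - g x](subrK (L (p - x))).
  by apply: le_trans (ler_normD _ _) _; rewrite lerD.
by rewrite mulrC -ler_pdivlMr // ltW.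
Qed.

Lemma reldiff_continuous A g (L : W -> W -> R) :
  (forall x, A x -> reldiff A g x (L x)) ->
  (forall x, A x -> exists C : R, forall z, `|L x z| <= C * `|z|) ->
  {within A, continuous g}.
Proof.
move=> d hL; rewrite continuous_subspace_in => x; rewrite inE => Ax.
have [C hC] := hL x Ax; have := reldiff_cvg (d x Ax) hC.
by rewrite (@nbhs_subspace_in _ A x Ax).
Qed.

End relative_differential.

Section convexity.
Context {R : realType} {E : lmodType R}.

Lemma convex_setE (A : set E) (x y : E) (s : R) : convex_set A ->
  0 <= s <= 1 -> A x -> A y -> A (s *: x + (1 - s) *: y).
Proof.
move=> cA /andP[s0 s1] Ax Ay.
pose t : {i01 R} := @Itv01 R s s0 s1.
have := cA x y t; rewrite !inE => /(_ Ax Ay); rewrite /conv /=.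
by [].
Qed.

Lemma convex_functionE (A : set E) (g : E -> R) (x y : E) (s : R) :
  convex_function A g ->
  0 <= s <= 1 -> A x -> A y -> g (s *: x + (1 - s) *: y) <= s * g x + (1 - s) * g y.
Proof.
move=> cg /andP[s0 s1] Ax Ay.
pose t : {i01 R} := @Itv01 R s s0 s1.
have := cg t x y; rewrite !inE => /(_ Ax Ay); rewrite /conv /=.
by [].
Qed.

Lemma jensen_mean (A : set E) (g : E -> R) (x : nat -> E) (T : nat) :
  (forall (s : R) u v, 0 <= s <= 1 -> A u -> A v -> A (s *: u + (1 - s) *: v)) ->
  (forall (s : R) u v, 0 <= s <= 1 -> A u -> A v ->
     g (s *: u + (1 - s) *: v) <= s * g u + (1 - s) * g v) ->
  (1 <= T)%N -> (forall t, (1 <= t <= T)%N -> A (x t)) ->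
  A (T%:R^-1 *: \sum_(1 <= t < T.+1) x t) /\
  T%:R * g (T%:R^-1 *: \sum_(1 <= t < T.+1) x t) <= \sum_(1 <= t < T.+1) g (x t).
Proof.
move=> cA cg; elim: T => [//|T IH] _ Ax.
case: T IH Ax => [_ Ax|T IH Ax].
  by rewrite !big_nat1 invr1 scale1r mul1r; split => //; apply: Ax.
have [|Am gm] := IH isT _; first by move=> t /andP[t1 tT]; apply: Ax; rewrite t1 ltnW.
set m := (T.+1)%:R^-1 *: _ in Am gm.
have T0 : 0 < T.+1%:R :> R by rewrite ltr0n.
have T1 : 0 < T.+2%:R :> R by rewrite ltr0n.
(* After the two case splits there are T + 2 points, and the last one gets weight 1 / (T + 2). *)
pose s : R := T.+2%:R^-1.
have s01 : 0 <= s <= 1.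
  by rewrite /s invr_ge0 ler0n /= invf_le1 // ler1n.
have s1E : 1 - s = T.+1%:R / T.+2%:R.
  have e : T.+2%:R = T.+1%:R + 1 :> R by rewrite natr1.
  by rewrite /s e; field; rewrite nat1r natr1 lt0r_neq0.
have E1 : T.+2%:R^-1 *: \sum_(1 <= t < T.+3) x t = s *: x T.+2 + (1 - s) *: m.
  rewrite big_nat_recr //= scalerDr addrC; congr (_ + _).
  by rewrite /m scalerA s1E mulrAC divff ?lt0r_neq0 // mul1r.
have AT : A (x T.+2) by apply: Ax; rewrite leqnn.
rewrite E1; split; first exact: cA.
rewrite big_nat_recr //=; have h := cg s _ _ s01 AT Am.
have : T.+2%:R * g (s *: x T.+2 + (1 - s) *: m) <= g (x T.+2) + T.+1%:R * g m.
  rewrite -ler_pdivlMl //; apply: le_trans h _; rewrite s1E le_eqVlt; apply/orP; left; apply/eqP.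
  by rewrite /s; field; rewrite lt0r_neq0.
by move=> h'; apply: le_trans h' _; rewrite [leLHS]addrC lerD2r.
Qed.

End convexity.

Section gradients.
Context {R : realType} {n : nat} {V : normedVectType R}.
Variables (ip : {dot V for idfun}) (K : set V) (f : 'M[R]_n -> V -> R).
Implicit Types (X u Z : 'M[R]_n) (y v w : V).

Lemma symmx_conv (s t : R) u X : symmx u -> symmx X -> symmx (s *: u + t *: X).
Proof. by rewrite /symmx /= linearD !linearZ /= => -> ->. Qed.

Lemma spectrahedron_symmx X : spectrahedron X -> symmx X.
Proof. by case=> -[]. Qed.

Lemma spectrahedron_conv (s : R) u X : 0 <= s <= 1 ->
  spectrahedron u -> spectrahedron X -> spectrahedron (s *: u + (1 - s) *: X).
Proof.
move=> /andP[s0 s1] Su SX; split; last first.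
  by rewrite mxtraceD !mxtraceZ (proj2 Su) (proj2 SX) !mulr1 addrC subrK.
apply: quad_psd => [|v]; first by apply: symmx_conv; exact: spectrahedron_symmx.
have -> : quad v (s *: u + (1 - s) *: X) = s * quad v u + (1 - s) * quad v X.
  by rewrite /quad mulmxDr mulmxDl -!scalemxAr -!scalemxAl mx00D !mx00Z.
by rewrite addr_ge0 // mulr_ge0 ?subr_ge0 //; apply: psd_quad; [case: Su | case: SX].
Qed.

Hypothesis df : differentiable_SnV ip f.

Lemma grad_spec X y : symmx X -> is_gradient ip f X y (grad ip f X y).
Proof. by move=> sX; apply: xgetPex; exact: df. Qed.

Lemma gradX_sym X y : symmx X -> (gradX ip f X y)^T = gradX ip f X y.
Proof. by move=> sX; case: (grad_spec y sX). Qed.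

Lemma grad_reldiff X y : symmx X ->
  reldiff [set p : 'M[R]_n * V | symmx p.1] (fun p => f p.1 p.2) (X, y)
    (fun p => \tr (gradX ip f X y *m p.1) + ip (gradY ip f X y) p.2).
Proof. by move=> sX; apply: littleo_reldiff; case: (grad_spec y sX). Qed.

Lemma gradX_reldiff X y : symmx X ->
  reldiff symmx (f^~ y) X (fun H => \tr (gradX ip f X y *m H)).
Proof.
move=> sX e e0; have [r r0 hr] := grad_reldiff y sX e0; exists r => // p sp pr.
have E : `|(p, y) - (X, y)| = `|p - X|.
  have -> : (p, y) - (X, y) = (p - X, y - y) by [].
  by rewrite subrr prod_normE /= normr0 max_l.
have := hr (p, y) sp; rewrite E => /(_ pr) /=.
by rewrite subrr linear0r addr0.
Qed.

Lemma gradY_reldiff X y : symmx X ->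
  reldiff setT (f X) y (ip (gradY ip f X y)).
Proof.
move=> sX e e0; have [r r0 hr] := grad_reldiff y sX e0; exists r => // p _ pr.
have E : `|(X, p) - (X, y)| = `|p - y|.
  have -> : (X, p) - (X, y) = (X - X, p - y) by [].
  by rewrite subrr prod_normE /= normr0 max_r.
have := hr (X, p) sX; rewrite E => /(_ pr) /=.
by rewrite subrr mulmx0 mxtrace0 add0r.
Qed.

Lemma gradX_convex X u y : convex_function symmx (f^~ y) -> symmx X -> symmx u ->
  \tr (gradX ip f X y *m (u - X)) <= f u y - f X y.
Proof.
move=> cf sX su; apply: (reldiff_convex (gradX_reldiff y sX)).
- by move=> s v; rewrite -scalemxAr mxtraceZ.
- by move=> s _; exact: symmx_conv.
- by move=> s s01; exact: (convex_functionE cf).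
Qed.

Lemma gradY_concave X y v : convex_set K -> convex_function K (fun v => - f X v) ->
  symmx X -> K y -> K v ->
  f X v - f X y <= ip (gradY ip f X y) (v - y).
Proof.
move=> cK cf sX Ky Kv; rewrite -lerN2 opprB.
have d : reldiff K (- f X) y (fun z => - ip (gradY ip f X y) z).
  move=> e e0; have [r r0 hr] := reldiffN (gradY_reldiff y sX) e0.
  by exists r => // p _; exact: hr.
have -> : f X y - f X v = (- f X) v - (- f X) y by rewrite /= opprK addrC.
apply: (reldiff_convex d).
- by move=> s u; rewrite linearZr_LR /= mulrN.
- by move=> s s01; exact: convex_setE.
- by move=> s s01; exact: (convex_functionE cf).
Qed.

Lemma gradX_optimal X u y : (forall Z, spectrahedron Z -> f X y <= f Z y) ->
  spectrahedron X -> spectrahedron u ->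
  \tr (gradX ip f X y *m X) <= \tr (gradX ip f X y *m u).
Proof.
move=> opt SX Su; rewrite -subr_ge0 -raddfB /= -mulmxBr.
have d : reldiff spectrahedron (f^~ y) X (fun H => \tr (gradX ip f X y *m H)).
  move=> e e0; have [r r0 hr] := gradX_reldiff y (spectrahedron_symmx SX) e0.
  by exists r => // p Sp; apply: hr; exact: spectrahedron_symmx.
apply: (reldiff_min d) => //.
- by move=> s v; rewrite -scalemxAr mxtraceZ.
- by move=> s s01; exact: spectrahedron_conv.
Qed.

Lemma continuous_fY X : symmx X -> {within K, continuous (f X)}.
Proof.
move=> sX; apply: (reldiff_continuous (L := fun y => ip (gradY ip f X y))) => [y _|y _].
  move=> e e0; have [r r0 hr] := gradY_reldiff y sX e0.
  by exists r => // p _; exact: hr.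
by have [C _ hC] := ip_bounded ip (gradY ip f X y); exists C.
Qed.

Lemma tr_bounded (G : 'M[R]_n) : exists C : R, forall H, `|\tr (G *m H)| <= C * `|H|.
Proof.
exists (\sum_i \sum_j `|G i j|) => H; rewrite /mxtrace.
apply: le_trans (ler_norm_sum _ _ _) _; rewrite big_distrl; apply: ler_sum => i _.
rewrite mxE; apply: le_trans (ler_norm_sum _ _ _) _; rewrite big_distrl.
apply: ler_sum => j _; rewrite normrM ler_wpM2l //.
rewrite [leRHS]/Num.norm /= mx_normrE.
by apply: (le_bigmax _ (fun ij : 'I_n * 'I_n => `|H ij.1 ij.2|) (j, i)).
Qed.

Lemma continuous_fX y : {within spectrahedron, continuous (f^~ y)}.
Proof.
apply: (reldiff_continuous (L := fun X H => \tr (gradX ip f X y *m H))) => [X SX|X _].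
  move=> e e0; have [r r0 hr] := gradX_reldiff y (spectrahedron_symmx SX) e0.
  by exists r => // p Sp; apply: hr; exact: spectrahedron_symmx.
exact: tr_bounded.
Qed.

End gradients.

Section prox.
Context {R : realType} {V : normedVectType R}.
Variables (ip : {dot V for idfun}) (K : set V) (om : V -> R) (gom : V -> V) (D : set V).
Hypotheses (cK : convex_set K) (sc : strongly_convex1 K om) (c1 : C1_in ip K D om gom).
Implicit Types (y v w g : V).

Lemma om_reldiff y : D y -> reldiff K om y (ip (gom y)).
Proof. by move=> Dy; apply: littleo_reldiff; exact: (proj1 c1). Qed.

Lemma bregY_ge y v : D y -> K y -> K v -> 2^-1 * `|v - y| ^+ 2 <= bregY ip om gom v y.
Proof.
move=> Dy Ky Kv; rewrite /bregY ipC; apply: (reldiff_strongly_convex (om_reldiff Dy)).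
- by move=> s u; rewrite linearZr_LR.
- by move=> s s01; exact: convex_setE.
- by move=> s s01; exact: sc.
Qed.

(** First order optimality of [w] in the direction of [v]. It is an inequality, where
    [bregX_three_point] is an equality, because [w] may lie on the boundary of [K]. *)
Lemma prox_three_point eta y0 g w v : prox_step ip K om gom eta y0 g w -> D w -> K v ->
  - eta * ip g (w - v) <=
  bregY ip om gom v y0 - bregY ip om gom v w - bregY ip om gom w y0.
Proof.
move=> [Kw wmin] Dw Kv.
pose h p := ip (- eta *: g) p + bregY ip om gom p y0.
pose L z := - eta * ip g z + (ip (gom w) z - ip z (gom y0)).
have d : reldiff K h w L.
  move=> e e0; have [r r0 hr] := om_reldiff Dw e0; exists r => // p Kp pr.
  have -> : h p - h w - L (p - w) = om p - om w - ip (gom w) (p - w).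
    by rewrite /h /L /bregY !ipZl !ipBr !ipBl; ring.
  exact: hr.
have LZ s u : L (s *: u) = s * L u.
  by rewrite /L !ipZr ipZl; ring.
have := reldiff_min d LZ (fun s s01 => convex_setE cK s01 Kv Kw) wmin.
rewrite /L /bregY !ipBr !ipBl.
have := ipC ip (gom w) v; have := ipC ip (gom w) w => -> ->.
lra.
Qed.

End prox.

Section compactness.
Context {R : realType}.

Lemma spectrahedron_entry_le1 n (X : 'M[R]_n) i j : spectrahedron X -> `|X i j| <= 1.
Proof.
case=> /psd_specmx [U [d [UU -> _ d0]]]; rewrite tr_specmx // => d1.
have U1 k l : `|U k l| <= 1.
  rewrite -(@expr_le1 _ 2) // real_normK ?num_real // -(orth_sqrow k UU).
  by rewrite (bigD1 l) //= lerDl sumr_ge0 // => m _; exact: sqr_ge0.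
rewrite specmxE -d1; apply: le_trans (ler_norm_sum _ _ _) _.
apply: ler_sum => k _; rewrite !normrM (ger0_norm (d0 k)) -mulrA ler_piMr //.
by rewrite mulr_ile1.
Qed.

(** The set is closed and bounded after flattening to row vectors, and the continuous [vec_mx]
    carries compactness back. *)
Lemma compact_spectrahedron n : compact (spectrahedron : set 'M[R]_n).
Proof.
pose S := [set x : 'rV[R]_(n * n) | spectrahedron (vec_mx x : 'M[R]_n)].
have cent i j : continuous (fun x : 'rV[R]_(n * n) => (vec_mx x : 'M[R]_n) i j).
  have -> : (fun x : 'rV[R]_(n * n) => (vec_mx x : 'M[R]_n) i j) =
    (fun x => x 0 (mxvec_index i j)) by apply/funext => x; rewrite mxE.
  exact: coord_continuous.
have cquad (v : 'rV[R]_n) :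
    continuous (fun x : 'rV[R]_(n * n) => quad v (vec_mx x)).
  have -> : (fun x : 'rV[R]_(n * n) => quad v (vec_mx x)) =
      (fun x => \sum_j \sum_i v 0 i * vec_mx x i j * v 0 j).
    by apply/funext => x; rewrite /quad mxE; apply: eq_bigr => j _; rewrite !mxE big_distrl.
  apply: continuous_sum => j; apply: continuous_sum => i x.
  apply: (@cvgM _ _ (nbhs x)); last exact: cvg_cst.
  by apply: (@cvgM _ _ (nbhs x)); [exact: cvg_cst | exact: cent].
have ctr : continuous (fun x : 'rV[R]_(n * n) => \tr (vec_mx x : 'M[R]_n)).
  exact: continuous_sum.
have cS : compact S.
  apply: bounded_closed_compact.
    exists 1; split; first exact: num_real.
    move=> m m1 x Sx; rewrite /Num.norm /= mx_normrE; apply/bigmax_leP.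
    split=> [|[i j] _ /=]; first by rewrite ltW // (lt_trans ltr01).
    case/mxvec_indexP: j => k l; rewrite ord1 (le_trans _ (ltW m1)) //.
    have -> : x 0 (mxvec_index k l) = (vec_mx x : 'M[R]_n) k l by rewrite mxE.
    exact: spectrahedron_entry_le1.
  have -> : S = (\bigcap_(i : 'I_n) \bigcap_(j : 'I_n)
       [set x | (vec_mx x : 'M[R]_n) i j - (vec_mx x : 'M[R]_n) j i = 0]) `&`
      (\bigcap_(v : 'rV[R]_n) [set x | 0 <= quad v (vec_mx x)]) `&`
      [set x | \tr (vec_mx x : 'M[R]_n) = 1].
    apply/seteqP; split=> x /=.
      move=> [[sx px] tx]; split; last exact: tx.
      split=> [i _ j _ /=|v _ /=].
        by have /matrixP /(_ i j) := sx; rewrite mxE => ->; rewrite subrr.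
      by apply: psd_quad; split.
    move=> [[h1 h2] h3]; split; last exact: h3.
    apply: quad_psd => [|v]; last exact: h2.
    apply/matrixP => i j; rewrite mxE; apply/eqP; rewrite -subr_eq0; apply/eqP.
    exact: h1.
  apply: closedI; first apply: closedI.
  - apply: closed_bigI => i _; apply: closed_bigI => j _.
    apply: (@preimage_closed _ _ (fun x : 'rV[R]_(n * n) =>
      (vec_mx x : 'M[R]_n) i j - (vec_mx x : 'M[R]_n) j i) [set 0]).
      by move=> x _; apply: (@cvgB _ _ _ (nbhs x)); exact: cent.
    exact: closed_eq.
  - apply: closed_bigI => v _.
    apply: (@preimage_closed _ _ (fun x : 'rV[R]_(n * n) => quad v (vec_mx x)) [set y | 0 <= y]).
      by move=> x _; exact: cquad.
    exact: closed_ge.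
  - apply: (@preimage_closed _ _ (fun x : 'rV[R]_(n * n) => \tr (vec_mx x : 'M[R]_n)) [set 1]).
      by move=> x _; exact: ctr.
    exact: closed_eq.
have -> : (spectrahedron : set 'M[R]_n) = [set vec_mx x | x in S].
  apply/seteqP; split=> [X SX|_ [x Sx <-]]; last exact: Sx.
  by exists (mxvec X); rewrite /S /= mxvecK.
apply: continuous_compact cS; apply: continuous_subspaceT => x.
move=> B /nbhs_ballP [e e0 hB]; apply/nbhs_ballP; exists e => // y [_ xy].
by apply: hB; split => // i j; rewrite !mxE; exact: xy.
Qed.

End compactness.

(** * Mirror-prox *)

Section parameters.
Context {R : realType}.
Implicit Types a b x : R.

Lemma inve_ge0_spec a : 0 <= a ->
  (0 < (a%:E)^-1)%E /\ (a = 0 \/ (a%:E)^-1%E = (a^-1)%:E).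
Proof.
rewrite le_eqVlt => /orP[/eqP <-|a0].
  by rewrite inve0; split; [exact: lt0y | left].
by rewrite inver gt_eqF //; split; [rewrite lte_fin invr_gt0 | right].
Qed.

Lemma fine_le_inve a (m : \bar R) : 0 <= a -> m \is a fin_num -> (0 < m)%E ->
  (m <= (a%:E)^-1)%E -> fine m * a <= 1.
Proof.
move=> a0 fm m0; case: (inve_ge0_spec a0) => _ [->|->]; first by rewrite mulr0.
rewrite -(fineK fm) lee_fin; move: a0; rewrite le_eqVlt => /orP[/eqP <-|a0].
  by rewrite mulr0.
by rewrite -ler_pdivlMr // mul1r.
Qed.

Lemma step_size_spec bX bY bXY bYX : 0 <= bX -> 0 <= bY -> 0 <= bXY -> 0 <= bYX ->
  ~ [/\ bX = 0, bY = 0, bXY = 0 & bYX = 0 :> R] ->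
  let eta := step_size bX bY bXY bYX in
  [/\ 0 < eta, 8 * eta ^+ 2 * (bX ^+ 2 + bYX ^+ 2) <= 1 &
      4 * eta ^+ 2 * (bY ^+ 2 + bXY ^+ 2) <= 1].
Proof.
move=> X0 Y0 XY0 YX0 nz; rewrite /step_size.
set a1 := bX + bXY; set a2 := bY + bYX.
set s3 := bX ^+ 2 + bYX ^+ 2; set s4 := bY ^+ 2 + bXY ^+ 2.
set a3 := 2 * Num.sqrt 2 * Num.sqrt s3; set a4 := 2 * Num.sqrt s4.
set m := mine _ _ => /=.
have a10 : 0 <= a1 by rewrite addr_ge0.
have a20 : 0 <= a2 by rewrite addr_ge0.
have a30 : 0 <= a3 by rewrite !mulr_ge0 // sqrtr_ge0.
have a40 : 0 <= a4 by rewrite mulr_ge0 // sqrtr_ge0.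
have s30 : 0 <= s3 by rewrite addr_ge0 // sqr_ge0.
have s40 : 0 <= s4 by rewrite addr_ge0 // sqr_ge0.
have [i1 c1] := inve_ge0_spec a10; have [i2 c2] := inve_ge0_spec a20.
have [i3 _] := inve_ge0_spec a30; have [i4 _] := inve_ge0_spec a40.
have m0 : (0 < m)%E by rewrite /m !lt_min i1 i2 i3.
have [m1 m2 m3 m4] : [/\ m <= (a1%:E)^-1, m <= (a2%:E)^-1, m <= (a3%:E)^-1 & m <= (a4%:E)^-1]%E.
  by rewrite /m !ge_min !lexx !orbT.
(* If the first two denominators both vanished, all the Lipschitz constants would be zero, being
   nonnegative. *)
have fm : m \is a fin_num.
  rewrite fin_real // (lt_trans _ m0) ?ltNyr //=.
  case: c1 => [a1z|e1]; last by rewrite (le_lt_trans m1) // e1 ltry.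
  case: c2 => [a2z|e2]; last by rewrite (le_lt_trans m2) // e2 ltry.
  by exfalso; apply: nz; rewrite /a1 /a2 in a1z a2z; split; lra.
have eta0 : 0 < fine m by rewrite fine_gt0 // m0 -ge0_fin_numE // ltW.
split=> //.
  have := fine_le_inve a30 fm m0 m3; rewrite -(@ler_pXn2r _ 2) ?nnegrE //; last first.
    by rewrite mulr_ge0 // ltW.
  rewrite expr1n !exprMn !sqr_sqrtr // => h; apply: le_trans h.
  by rewrite le_eqVlt; apply/orP; left; apply/eqP; ring.
have := fine_le_inve a40 fm m0 m4; rewrite -(@ler_pXn2r _ 2) ?nnegrE //; last first.
  by rewrite mulr_ge0 // ltW.
rewrite expr1n !exprMn !sqr_sqrtr // => h; apply: le_trans h.
by rewrite le_eqVlt; apply/orP; left; apply/eqP; ring.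
Qed.

(** The inner extended-real minimum does not depend on t and collapses to a real [C]: when the
    Lipschitz constants vanish its second term is +oo and [C] is the first. *)
Lemma eps_seq_spec bX bXY G eta delta teps c :
  0 <= bX -> 0 <= bXY -> 0 < delta -> 0 < teps -> 0 <= c ->
  exists2 C : R, 0 < C <= teps ^+ 2 / (16 * Num.max (G ^+ 2 * eta ^+ 2) 1) &
    forall t, eps_seq bX bXY G eta delta teps c t = Num.min 1 (C / (t%:R + 1 + c) ^+ 3).
Proof.
move=> X0 XY0 d0 t0 c0; rewrite /eps_seq.
set c1 := teps ^+ 2 / _; set b := 16 * Num.sqrt 2 * _ * _.
have M1 : 1 <= Num.max (G ^+ 2 * eta ^+ 2) 1 by rewrite le_max lexx orbT.
have c10 : 0 < c1.
  by rewrite divr_gt0 ?exprn_gt0 // mulr_gt0 // (lt_le_trans ltr01).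
have b0 : 0 <= b.
  rewrite !mulr_ge0 ?addr_ge0 ?sqrtr_ge0 //.
  by rewrite le_max X0.
have [C /andP[C0 Cc] CE] : exists2 C : R, 0 < C <= c1 &
    (mine c1%:E ((delta%:E / b%:E) ^+ 4) = C%:E)%E.
  have [_ [bz|bi]] := inve_ge0_spec b0.
    exists c1; first by rewrite c10 lexx.
    rewrite bz inve0 gt0_muley ?lte_fin //.
    have -> : (+oo ^+ 4 = +oo :> \bar R)%E by rewrite /expe /= !mulyy.
    by rewrite minEle leey.
  exists (Num.min c1 ((delta / b) ^+ 4)).
    rewrite lt_min c10 ge_min lexx andbT /=.
    have bp : 0 < b.
      rewrite lt_neqAle b0 andbT; apply/eqP => bz; move: bi; rewrite -bz inve0.
      by [].
    by rewrite exprn_gt0 // divr_gt0.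
  by rewrite bi -EFinM -EFin_expe -EFin_min.
exists C; first by rewrite C0 Cc.
by move=> t; rewrite CE -EFinM -EFin_min /=.
Qed.

Lemma init_radius_spec (r : nat) (lam bX bXY G delta : R) :
  0 <= bX -> 0 <= bXY -> (0 < r)%N -> 0 < lam <= 1 -> 0 < delta -> delta <= 2 * G ->
  let R0 := init_radius r lam bX bXY G delta in
  [/\ 0 < R0, R0 <= lam / 5, R0 <= 2 / 15 &
      28 * Num.max bX bXY * R0 + 4 * (G * R0) + 11 * (G * R0 / lam) <= delta].
Proof.
move=> X0 XY0 r0 /andP[lam0 lam1] d0 dG; rewrite /init_radius; set b := Num.max _ _.
have b0 : 0 <= b by rewrite le_max X0.
have G0 : 0 < G by lra.
(* The rational 14 / 10 is below sqrt 2 <= sqrt (2 r), and 8 times it exceeds the coefficient 11. *)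
set q := Num.sqrt _; have q1 : 14 / 10 <= q.
  rewrite -(@ler_pXn2r _ 2) ?nnegrE ?sqrtr_ge0 // sqr_sqrtr ?mulr_ge0 //.
  have : 1 <= r%:R :> R by rewrite ler1n.
  by rewrite expr2; lra.
set k := 7 * b + _.
have il0 : 1 <= lam^-1 by rewrite invf_ge1.
have ql : 14 / 10 * lam^-1 <= q / lam by rewrite ler_pM2r // invr_gt0.
have k0 : 0 < k.
  rewrite ltr_wpDl ?mulr_ge0 // mulr_gt0 // -mulrA.
  have : 0 < q / lam by rewrite divr_gt0 //; lra.
  lra.
set R0 := 4^-1 * k^-1 * delta.
have Rp : 0 < R0 by rewrite !mulr_gt0 ?invr_gt0.
have Rk : 4 * (k * R0) = delta by rewrite /R0; field; rewrite gt_eqF.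
have GR0 : 0 < G * R0 by rewrite mulr_gt0.
have key : 28 * b * R0 + 4 * (G * R0) + 11 * (G * R0 / lam) <= delta.
  have h : G * R0 * (14 / 10 * lam^-1) <= G * R0 * (q / lam) by rewrite ler_pM2l.
  have GRl : 0 <= G * R0 / lam by rewrite divr_ge0 // ltW.
  have -> : delta = 28 * b * R0 + 4 * (G * R0) + 8 * (G * R0 * (q / lam)).
    by rewrite -Rk /k; ring.
  have e : G * R0 * (14 / 10 * lam^-1) = 14 / 10 * (G * R0 / lam) by ring.
  by rewrite e in h; lra.
have bR0 : 0 <= b * R0 by rewrite mulr_ge0 // ltW.
(* Cancelling G through delta <= 2 G gives 4 R0 + 11 R0 / lam <= 2; hence R0 / lam <= 1 / 5, and R0
   <= 2 / 15 because lam <= 1. *)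
have h2 : G * (4 * R0 + 11 * (R0 / lam)) <= G * 2.
  have -> : G * (4 * R0 + 11 * (R0 / lam)) = 4 * (G * R0) + 11 * (G * R0 / lam) by ring.
  by move: key; rewrite -mulrA; lra.
rewrite ler_pM2l // in h2.
have RlE : R0 / lam * lam = R0 by rewrite divfK // gt_eqF.
have Rl0 : 0 < R0 / lam by rewrite divr_gt0.
have RlR : R0 <= R0 / lam by rewrite ler_pdivlMr // ler_piMr // ltW.
split=> //; last by lra.
rewrite -RlE mulrC ler_pM2l //; lra.
Qed.

(** With a = t + c, (1 + 1 / a)^3 <= exp (3 / a) <= exp (eta delta / 4), since a >= c >= 12 / (eta
    delta); this is the origin of the 12. *)
Lemma eps_ratio (C c eta delta : R) (t : nat) : (1 <= t)%N -> 0 < C -> 0 < eta -> 0 < delta ->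
  12 / (eta * delta) <= c ->
  C / (t.-1%:R + 1 + c) ^+ 3 * expR (- (eta * (delta / 4))) <= C / (t%:R + 1 + c) ^+ 3.
Proof.
move=> t1 C0 e0 d0 hc; rewrite -!mulrA ler_pM2l //.
have ed0 : 0 < eta * delta by rewrite mulr_gt0.
have c0 : 0 < c by apply: lt_le_trans hc; rewrite divr_gt0.
have -> : t.-1%:R + 1 = t%:R :> R by rewrite natr1 prednK.
have T1 : 1 <= t%:R :> R by rewrite ler1n.
set a := t%:R + c; have a0 : 0 < a by rewrite /a; lra.
have -> : t%:R + 1 + c = a + 1 by rewrite /a; ring.
have a10 : 0 < a + 1 by lra.
rewrite mulrC expRN -invfM lef_pV2 ?posrE ?mulr_gt0 ?exprn_gt0 ?expR_gt0 //.
have h : a + 1 <= a * expR (a^-1).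
  have -> : a + 1 = a * (1 + a^-1) by rewrite mulrDr mulr1 mulfV ?gt_eqF.
  by rewrite ler_pM2l // expR_ge1Dx.
apply: (@le_trans _ _ ((a * expR (a^-1)) ^+ 3)).
  by rewrite ler_pXn2r // nnegrE ?mulr_ge0 ?expR_ge0 // ltW.
rewrite exprMn mulrC ler_pM2r ?exprn_gt0 // -expRM_natr ler_expR.
have : 12 <= c * (eta * delta) by rewrite -ler_pdivrMr.
have : c * (eta * delta) <= a * (eta * delta) by rewrite ler_pM2r // /a; lra.
move=> h1 h2; rewrite mulrC ler_pdivrMr //.
have -> : eta * (delta / 4) * a = a * (eta * delta) / 4 by field.
lra.
Qed.

End parameters.

(** * Decay of the tail in one step *)

Section one_step.
Context {R : realType} {n : nat}.
Implicit Types (U W A B X Y G P : 'M[R]_n) (d e a : 'rV[R]_n).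

Lemma tr_spectrahedron_le W B : spectrahedron W -> B^T = B ->
  `|\tr (W *m B)| <= nuclear_norm B.
Proof.
move=> SW sB; have [U [d [UU WE _ d0]]] := psd_specmx (proj1 SW).
have d1 : \sum_i d 0 i = 1 by rewrite -(proj2 SW) WE tr_specmx.
rewrite WE -[leRHS]mul1r; apply: tr_specmx_nuclear => // i.
by rewrite ger0_norm // -d1 (bigD1 i) //= lerDl sumr_ge0.
Qed.

Lemma ger_psd A B X : psdmx (A - B) -> psdmx X -> \tr (B *m X) <= \tr (A *m X).
Proof. by move=> pAB pX; have := tr_psd_ge0 pAB pX; rewrite mulmxBl raddfB /= subr_ge0. Qed.

Lemma gap_lower (Gs Xs P W : 'M[R]_n) (delta : R) : spectrahedron W ->
  psdmx (Gs - (\tr (Gs *m Xs))%:M - delta *: (1%:M - P)) ->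
  \tr (Gs *m Xs) + delta * (1 - \tr (P *m W)) <= \tr (Gs *m W).
Proof.
move=> SW; rewrite -addrA -opprD => /ger_psd /(_ (proj1 SW)).
rewrite mulmxDl mxtraceD mul_scalar_mx mxtraceZ (proj2 SW) mulr1.
by rewrite -scalemxAl mxtraceZ mulmxBl raddfB /= mul1mx (proj2 SW).
Qed.

Lemma proj_upper (Xs P W : 'M[R]_n) (lam : R) : spectrahedron W ->
  psdmx (Xs - lam *: P) -> lam * \tr (P *m W) <= \tr (Xs *m W).
Proof. by move=> SW /ger_psd /(_ (proj1 SW)); rewrite -scalemxAl mxtraceZ. Qed.

(** A unit vector [v] in the tail of [X] bounds a_i by ln s - eta tr (G W), with W its projector,
    and Gibbs' principle bounds ln S below by - eta tr (G X). The difference of the two traces is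
    nearly the gap; the corrections are the mass of W on [P], the change of gradient ([sg], counted
    twice) and the distance from [X] to [Xs]. *)
Lemma tail_condition (Xs Gs P X G U : 'M[R]_n) a (r : nat) (lam delta s sg Gn eta : R) :
  spectrahedron Xs -> Gs^T = Gs -> 0 < lam -> 0 < delta ->
  psdmx (Xs - lam *: P) ->
  psdmx (Gs - (\tr (Gs *m Xs))%:M - delta *: (1%:M - P)) ->
  (forall W, W^T = W -> `|\tr (Gs *m W)| <= Gn * nuclear_norm W) ->
  spectrahedron X -> tail_bound r s X -> G^T = G -> 0 < eta -> 0 < s ->
  (forall W, W^T = W -> `|\tr ((G - Gs) *m W)| <= sg * nuclear_norm W) ->
  U *m U^T = 1%:M -> logmx X - eta *: G = specmx U a -> noninc a ->
  forall i : 'I_n, (r <= i)%N ->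
  expR (a 0 i) <= s * expR (- (eta * (delta * (1 - (s + nuclear_norm (Xs - X)) / lam)
       - 2 * sg - Gn * nuclear_norm (Xs - X)))) * \sum_j expR (a 0 j).
Proof.
move=> SXs sGs lam0 d0 pXP pGP hGn SX [V hV] sG eta0 s0 hsg UU AE na i ri.
set N := nuclear_norm _; set S := \sum_j _.
have n0 : (0 < n)%N by exact: leq_ltn_trans (ltn_ord i).
have [sX sXs] := (spectrahedron_sym SX, spectrahedron_sym SXs).
have sD : (Xs - X)^T = Xs - X by rewrite linearB /= sX sXs.
have S0 : 0 < S.
  rewrite /S (bigD1 i) //= ltr_wpDr ?expR_gt0 // sumr_ge0 // => *; rewrite expR_ge0.
have [v [vV v1 av]] := eigenvalue_le_tail V UU na ri.
have [lv qv] := hV v vV; rewrite v1 !mulr1 in lv qv.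
have SW := rank1_spectrahedron v1; set W := v^T *m v in SW.
have sW := spectrahedron_sym SW.
have trW B : \tr (B *m W) = quad v B by exact: tr_rank1.
have quadE B C (c : R) : quad v (B - c *: C) = quad v B - c * quad v C.
  by rewrite -!trW mulmxBl raddfB /= -scalemxAl mxtraceZ.
have h1 : a 0 i <= ln s - eta * \tr (G *m W).
  by apply: le_trans av _; rewrite -AE quadE trW lerD2r.
(* Testing Gibbs' principle at [X] itself cancels the entropy. *)
have h2 : - (eta * \tr (G *m X)) <= ln S.
  have := gibbs a UU SX n0; rewrite -AE mulmxBr raddfB /= -scalemxAr mxtraceZ.
  by rewrite [\tr (X *m G)]mxtrace_mulC; lra.
have h3 : \tr (G *m W) >= \tr (Gs *m W) - sg.
  have := hsg W sW; rewrite nuclear_norm_spectrahedron // mulr1 mulmxBl raddfB /=.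
  by rewrite ler_norml => /andP[+ _]; lra.
have h4 : \tr (G *m X) <= \tr (Gs *m X) + sg.
  have := hsg X sX; rewrite nuclear_norm_spectrahedron // mulr1 mulmxBl raddfB /=.
  by rewrite ler_norml => /andP[_]; lra.
have h5 : \tr (Gs *m X) <= \tr (Gs *m Xs) + Gn * N.
  have := hGn _ sD; rewrite -/N mulmxBr raddfB /= ler_norml => /andP[+ _]; lra.
have h6 := gap_lower SW pGP.
(* W has mass at most s on [X], hence at most s + N on [Xs], which dominates lam P. *)
have h7 : \tr (P *m W) <= (s + N) / lam.
  rewrite ler_pdivlMr // mulrC; apply: le_trans (proj_upper SW pXP) _.
  have := tr_spectrahedron_le SW sD; rewrite -/N mxtrace_mulC mulmxBl raddfB /=.
  by rewrite trW (trW X) ler_norml => /andP[_]; lra.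
have h8 : delta * (1 - (s + N) / lam) <= delta * (1 - \tr (P *m W)).
  by rewrite ler_pM2l // lerD2l lerN2.
set q := delta * _ - 2 * sg - Gn * N.
have h9 : eta * q <= eta * (\tr (G *m W) - \tr (G *m X)).
  by rewrite ler_pM2l // /q; lra.
have -> : s * expR (- (eta * q)) * S = expR (ln s - eta * q + ln S).
  by rewrite !expRD !lnK ?posrE.
rewrite ler_expR; move: h9; rewrite mulrBr; lra.
Qed.

End one_step.

(** * Scalar inequalities behind one step *)

Section scalar_bounds.
Context {R : realFieldType}.
Variables (eta bX bY bXY bYX : R).
Hypotheses (h1 : 8 * eta ^+ 2 * (bX ^+ 2 + bYX ^+ 2) <= 1)
           (h2 : 4 * eta ^+ 2 * (bY ^+ 2 + bXY ^+ 2) <= 1).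

(** Of the 8 in [h1], one factor 2 pays for (x + y)^2 <= 2 (x^2 + y^2) and another for (e + 2 eps)^2
    <= 2 e^2 + 8 eps^2, leaving 1 / 2 in front of e^2. For h^2 only the first doubling occurs, hence
    the 4 in [h2]. *)
Lemma young_squares (e h eps : R) :
  eta ^+ 2 * (bX * (e + 2 * eps) + bXY * h) ^+ 2 +
  eta ^+ 2 * (bY * h + bYX * (e + 2 * eps)) ^+ 2 <= e ^+ 2 / 2 + h ^+ 2 / 2 + 2 * eps ^+ 2.
Proof.
set f := e + 2 * eps.
have i1 : (bX * f + bXY * h) ^+ 2 <= 2 * (bX ^+ 2 * f ^+ 2 + bXY ^+ 2 * h ^+ 2).
  by have := sqr_ge0 (bX * f - bXY * h); rewrite !expr2; lra.
have i2 : (bY * h + bYX * f) ^+ 2 <= 2 * (bY ^+ 2 * h ^+ 2 + bYX ^+ 2 * f ^+ 2).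
  by have := sqr_ge0 (bY * h - bYX * f); rewrite !expr2; lra.
have e0 := sqr_ge0 eta.
have j1 := ler_wpM2l e0 i1; have j2 := ler_wpM2l e0 i2.
have k1 := ler_wpM2l (sqr_ge0 f) h1; have k2 := ler_wpM2l (sqr_ge0 h) h2.
have f2 : f ^+ 2 <= 2 * e ^+ 2 + 8 * eps ^+ 2.
  by have := sqr_ge0 (e - 2 * eps); rewrite /f !expr2; lra.
lra.
Qed.

Lemma young_cross (p q e h eps : R) :
  eta * ((bX * (e + 2 * eps) + bXY * h) * p) + eta * ((bY * h + bYX * (e + 2 * eps)) * q)
  <= p ^+ 2 / 2 + q ^+ 2 / 2 + e ^+ 2 / 2 + h ^+ 2 / 2 + eps ^+ 2.
Proof.
have := young_squares e h eps.
set A := _ + bXY * h; set B := bY * h + _ => hs.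
have := sqr_ge0 (eta * A - p); have := sqr_ge0 (eta * B - q).
have e0 := sqr_ge0 e; have h0 := sqr_ge0 h.
rewrite !expr2 in hs e0 h0 *; lra.
Qed.

(** The comparison with the saddle point has p^2 / 2 and q^2 / 2 at its disposal; spending quarters
    leaves the quarters that bound the distance in [midpoint_energy]. *)
Lemma young_cross4 (p q e h eps : R) :
  eta * ((bX * (e + 2 * eps) + bXY * h) * p) + eta * ((bY * h + bYX * (e + 2 * eps)) * q)
  <= p ^+ 2 / 4 + q ^+ 2 / 4 + e ^+ 2 / 2 + h ^+ 2 / 2 + 2 * eps ^+ 2.
Proof.
have := young_squares e h eps.
set A := _ + bXY * h; set B := bY * h + _ => hs.
have := sqr_ge0 (eta * A - p / 2); have := sqr_ge0 (eta * B - q / 2).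
rewrite !expr2 in hs *; lra.
Qed.

End scalar_bounds.

Section step_arithmetic.
Context {R : realFieldType}.

(* The two energy balances of a step, with every trace, Bregman distance and
   square abstracted to a real number. *)
Lemma midpoint_energy (eta A C T y1 y2 cx cy Bx By Bxe Bze Byw Bwy a2 b2 e2 h2 eps2 g : R) :
  0 <= eta * (A + C + T - (y1 - y2)) -> eta * A <= g -> eta * C <= cx -> eta * y2 <= cy ->
  eta * T = Bx - Bxe - Bze -> - eta * y1 <= By - Byw - Bwy ->
  cx + cy <= a2 / 4 + b2 / 4 + e2 / 2 + h2 / 2 + 2 * eps2 ->
  a2 <= 2 * Bxe -> 2^-1 * b2 <= Byw -> e2 <= 2 * Bze -> 2^-1 * h2 <= Bwy ->
  a2 / 4 + b2 / 4 <= Bx + By + g + 2 * eps2.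
Proof. lra. Qed.

Lemma step_energy (eta A C T S y1 y2 y3 cx cy Bu Bv BuXe BuX' BXeX BXeZe BZeX Bvy' By'y By'w Bwy
    p2 q2 e2 h2 eps2 eps g l : R) :
  eta * A <= g -> eta * C <= cx -> eta * y3 <= cy ->
  eta * S = Bu - BuXe - BXeX -> eta * T = BXeX - BXeZe - BZeX ->
  - eta * y1 <= Bv - Bvy' - By'y -> - eta * y2 <= By'y - By'w - Bwy ->
  BuX' <= BuXe + l -> l <= 2 * eps ->
  cx + cy <= p2 / 2 + q2 / 2 + e2 / 2 + h2 / 2 + eps2 ->
  p2 <= 2 * BXeZe -> 2^-1 * q2 <= By'w -> e2 <= 2 * BZeX -> 2^-1 * h2 <= Bwy ->
  eps2 <= eps ->
  eta * (A + C + T + S - (y1 + y2 - y3)) <= Bu + Bv - (BuX' + Bvy') + (g + 3 * eps).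
Proof. lra. Qed.

Lemma sqr_le_bound (x B c : R) : 0 <= c -> 0 <= x -> x ^+ 2 <= B -> B <= c ^+ 2 -> x <= c.
Proof. by move=> c0 x0 h1 h2; rewrite -(@ler_pXn2r _ 2) ?nnegrE // (le_trans h1). Qed.

(** The squares are at most 2 (51 / 50) R0^2, and 2.04 <= 1.5^2. In [close_midpoint] likewise 4 (52
    / 50) = 4.16 <= 2.05^2. *)
Lemma close_start (B1 B2 n m R0 : R) : n ^+ 2 <= 2 * B1 -> 2^-1 * m ^+ 2 <= B2 ->
  B1 + B2 <= 51 / 50 * R0 ^+ 2 -> 0 <= R0 -> 0 <= n -> 0 <= m -> 0 <= B1 ->
  n <= 15 / 10 * R0 /\ m <= 15 / 10 * R0.
Proof.
move=> h1 h2 h3 R00 n0 m0 B10.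
have R02 := sqr_ge0 R0; have m2 := sqr_ge0 m; have n2 := sqr_ge0 n.
have e : (15 / 10 * R0) ^+ 2 = 225 / 100 * R0 ^+ 2 by field.
have c0 : 0 <= 15 / 10 * R0 by lra.
by split; apply: (sqr_le_bound c0 _ (lexx _)) => //; rewrite e; lra.
Qed.

Lemma close_midpoint (a b B1 g eps2 R0 : R) :
  a ^+ 2 / 4 + b ^+ 2 / 4 <= B1 + g + 2 * eps2 -> g + 2 * eps2 <= R0 ^+ 2 / 50 ->
  B1 <= 51 / 50 * R0 ^+ 2 -> 0 <= R0 -> 0 <= a -> 0 <= b ->
  a <= 41 / 20 * R0 /\ b <= 41 / 20 * R0.
Proof.
move=> h1 h2 h3 R00 a0 b0.
have R02 := sqr_ge0 R0; have a2 := sqr_ge0 a; have b2 := sqr_ge0 b.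
have e : (41 / 20 * R0) ^+ 2 = 1681 / 400 * R0 ^+ 2 by field.
have c0 : 0 <= 41 / 20 * R0 by lra.
by split; apply: (sqr_le_bound c0 _ (lexx _)) => //; rewrite e; lra.
Qed.

Lemma close_gradients (b1 b2 beta a b R0 : R) : 0 <= b1 -> 0 <= b2 -> b1 <= beta -> b2 <= beta ->
  0 <= a -> 0 <= b -> a <= 21 / 10 * R0 -> b <= 21 / 10 * R0 ->
  b1 * a + b2 * b <= 42 / 10 * (beta * R0).
Proof.
move=> b10 b20 h1 h2 a0 b0 ha hb.
have l1 : b1 * a <= beta * (21 / 10 * R0) by apply: ler_pM.
have l2 : b2 * b <= beta * (21 / 10 * R0) by apply: ler_pM.
lra.
Qed.

Lemma close_approx (a z eps R0 : R) : a <= 41 / 20 * R0 -> z <= 2 * eps -> eps <= R0 / 100 ->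
  0 <= R0 -> a + z <= 21 / 10 * R0.
Proof. lra. Qed.

Lemma radius_fraction (c beta GR GRl R0 delta : R) : 28 * beta * R0 + 4 * GR + 11 * GRl <= delta ->
  0 <= GR -> 0 <= GRl -> c <= 42 / 10 * (beta * R0) -> 0 <= beta * R0 -> c <= delta / 5.
Proof. lra. Qed.

End step_arithmetic.

(** * One mirror-prox step near the saddle point *)

Section mirror_prox.
Context {R : realType} {n : nat} {V : normedVectType R}.
Variables (ip : {dot V for idfun}) (K : set V) (f : 'M[R]_n -> V -> R).
Variables (bX bY bXY bYX : R) (om : V -> R) (gom : V -> V) (D : set V).
Variables (Xs : 'M[R]_n) (ys : V) (r : nat) (delta G eta lam R0 : R) (P : 'M[R]_n).
Implicit Types (X Z W u : 'M[R]_n) (y w v : V).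

Hypotheses (cK : convex_set K) (df : differentiable_SnV ip f)
  (cf : forall v, K v -> convex_function symmx (fun A => f A v))
  (cvf : forall A, spectrahedron A -> convex_function K (fun v => - f A v))
  (X0 : 0 <= bX) (XY0 : 0 <= bXY) (YX0 : 0 <= bYX)
  (sm : smooth_on ip K f bX bY bXY bYX)
  (sc : strongly_convex1 K om) (c1 : C1_in ip K D om gom)
  (sad : saddle_point K f Xs ys)
  (eta0 : 0 < eta) (eta1 : 8 * eta ^+ 2 * (bX ^+ 2 + bYX ^+ 2) <= 1)
  (eta2 : 4 * eta ^+ 2 * (bY ^+ 2 + bXY ^+ 2) <= 1)
  (hG : forall X y, spectrahedron X -> K y -> spectral_norm (gradX ip f X y) <= G).

Local Notation gX := (gradX ip f).
Local Notation gY := (gradY ip f).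
Local Notation nuc := nuclear_norm.
Local Notation bregY := (bregY ip om gom).

Let SXs : spectrahedron Xs. Proof. by case: sad. Qed.
Let Kys : K ys. Proof. by case: sad. Qed.

Lemma gX_sym X y : spectrahedron X -> (gX X y)^T = gX X y.
Proof. by move=> SX; apply: (gradX_sym df); exact: spectrahedron_symmx. Qed.

Lemma subr_sym (A B : 'M[R]_n) : A^T = A -> B^T = B -> (A - B)^T = A - B.
Proof. by move=> sA sB; rewrite linearB /= sA sB. Qed.

Lemma gX_lip X X' y y' W : spectrahedron X -> spectrahedron X' -> K y -> K y' -> W^T = W ->
  `|\tr ((gX X y - gX X' y') *m W)| <= (bX * nuc (X - X') + bXY * `|y - y'|) * nuc W.
Proof.
move=> SX SX' Ky Ky' sW.
have [h1 _ _ _] := sm SX SX' Ky Ky'; have [_ _ h2 _] := sm SX' SX' Ky Ky'.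
rewrite -[gX X y](subrK (gX X' y)) -addrA mulmxDl mxtraceD mulrDl.
apply: le_trans (ler_normD _ _) _; apply: lerD.
  apply: le_trans (tr_le_spectral_nuclear _ sW) _.
    by apply: subr_sym; exact: gX_sym.
  by rewrite ler_wpM2r ?nuclear_norm_ge0.
apply: le_trans (tr_le_spectral_nuclear _ sW) _.
  by apply: subr_sym; exact: gX_sym.
by rewrite ler_wpM2r ?nuclear_norm_ge0.
Qed.

Lemma gY_lip X X' y y' v : spectrahedron X -> spectrahedron X' -> K y -> K y' ->
  ip (gY X y - gY X' y') v <= (bY * `|y - y'| + bYX * nuc (X - X')) * `|v|.
Proof.
move=> SX SX' Ky Ky'.
have [_ h1 _ _] := sm SX SX Ky Ky'; have [_ _ _ h2] := sm SX SX' Ky' Ky'.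
rewrite -[gY X y](subrK (gY X y')) -addrA linearDl /= mulrDl.
by apply: lerD; apply: le_trans (dual_normP ip _ _) _; rewrite ler_wpM2r.
Qed.

Lemma gX_bound X y W : spectrahedron X -> K y -> W^T = W ->
  `|\tr (gX X y *m W)| <= G * nuc W.
Proof.
move=> SX Ky sW; apply: le_trans (tr_le_spectral_nuclear (gX_sym y SX) sW) _.
by rewrite ler_wpM2r ?nuclear_norm_ge0 // hG.
Qed.

Lemma duality_gap_le Z w u v : spectrahedron Z -> K w -> spectrahedron u -> K v ->
  f Z v - f u w <= \tr (gX Z w *m (Z - u)) - ip (gY Z w) (w - v).
Proof.
move=> SZ Kw Su Kv.
have h1 := gradX_convex df (cf Kw) (spectrahedron_symmx SZ) (spectrahedron_symmx Su).
have h2 := gradY_concave df cK (cvf SZ) (spectrahedron_symmx SZ) Kw Kv.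
move: h1 h2; rewrite !ipBr !mulmxBr !raddfB /=; lra.
Qed.

Lemma saddle_gap_ge0 Z w : spectrahedron Z -> K w -> 0 <= f Z ys - f Xs w.
Proof.
move=> SZ Kw; case: sad => _ _ h; have [_ h1] := h Z ys SZ Kys.
by have [h2 _] := h Xs w SXs Kw; lra.
Qed.

Hypotheses (r0 : (0 < r)%N) (rn : (r < n)%N) (lam0 : 0 < lam) (d0 : 0 < delta)
  (dG : delta <= 2 * G) (R00 : 0 < R0)
  (key : 28 * Num.max bX bXY * R0 + 4 * (G * R0) + 11 * (G * R0 / lam) <= delta)
  (pXP : psdmx (Xs - lam *: P))
  (pGP : psdmx (gX Xs ys - (\tr (gX Xs ys *m Xs))%:M - delta *: (1%:M - P))).

Let q : R := n%:R - r%:R.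
Let q0 : 0 < q. Proof. by rewrite subr_gt0 ltr_nat. Qed.
Let beta := Num.max bX bXY.
Let beta0 : 0 <= beta. Proof. by rewrite /beta le_max X0. Qed.
Let G0 : 0 < G. Proof. rewrite -(@pmulr_rgt0 _ 2) //; exact: lt_le_trans d0 dG. Qed.

(** Each of the three losses is charged to one term of [key]: the mass of the tail on [P] to the
    last (through delta <= 2 G), the change of gradient to the first, the displacement of [X] to the
    second. Together they cost at most 3 delta / 4. *)
Lemma spectral_margin N s sg : N <= 15 / 10 * R0 -> s <= R0 / 100 ->
  sg <= 42 / 10 * (beta * R0) ->
  delta / 4 <= delta * (1 - (s + N) / lam) - 2 * sg - G * N.
Proof.
move=> hN hs hsg.
have GR : 0 <= G * R0 by rewrite mulr_ge0 // ltW.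
have GRl : 0 <= G * R0 / lam by rewrite divr_ge0 // ltW.
have bR : 0 <= beta * R0 by rewrite mulr_ge0 // ltW.
have h1 : G * N <= G * (15 / 10 * R0) by rewrite ler_pM2l.
have h2 : delta * ((s + N) / lam) <= 2 * G * (151 / 100 * R0 / lam).
  apply: (@le_trans _ _ (delta * (151 / 100 * R0 / lam))).
    by rewrite ler_pM2l // ler_pM2r ?invr_gt0 //; lra.
  by rewrite ler_wpM2r // divr_ge0 ?mulr_ge0 // ltW.
have e : 2 * G * (151 / 100 * R0 / lam) = 302 / 100 * (G * R0 / lam) by field; rewrite gt_eqF.
have := key; rewrite -/beta -mulrA mulrBr mulr1; lra.
Qed.

(** Both updates of an iteration start from the same [X], so this serves for [Z] and [X'] alike,
    with [Gr] the respective gradient. The tail of [X] has level [eps']; the factor exp (- eta delta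
    / 4) from [tail_condition] and [spectral_margin] brings it down to [eps]. *)
Lemma meg_step_near X Gr X' (eps eps' sg : R) :
  spectrahedron X -> posdef X -> tail_bound r (eps' / q) X -> Gr^T = Gr ->
  (forall W, W^T = W -> `|\tr ((Gr - gX Xs ys) *m W)| <= sg * nuc W) ->
  0 < eps < 1 -> 0 < eps' -> eps' <= R0 / 100 ->
  eps' * expR (- (eta * (delta / 4))) <= eps ->
  nuc (Xs - X) <= 15 / 10 * R0 -> sg <= 42 / 10 * (beta * R0) ->
  approx_meg_step r eta eps X Gr X' ->
  exists Xe k,
     [/\ spectrahedron Xe, posdef Xe, logmx Xe = logmx X - eta *: Gr - k%:M,
         nuclear_norm (X' - Xe) <= 2 * eps &
     [/\ spectrahedron X', posdef X',
         forall u, spectrahedron u -> bregX u X' <= bregX u Xe - ln (1 - eps) &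
         tail_bound r (eps / q) X']].
Proof.
move=> SX pX tX sGr hsg eps01 eps'0 eps'R heps hN hsg' step.
have [U [a [UU AE na]]] := meg_step r0 rn eps01 (posdef_sym pX) sGr step.
apply => i ri.
have q1 : 1 <= q.
  by rewrite /q -natrB ?(ltnW rn) // ler1n subn_gt0.
have s0 : 0 < eps' / q by rewrite divr_gt0.
have sR : eps' / q <= R0 / 100.
  by apply: le_trans eps'R; rewrite ler_pdivrMr // ler_peMr // ltW.
have SS : 0 <= \sum_j expR (a 0 j) by apply: sumr_ge0 => j _; rewrite expR_ge0.
have := tail_condition SXs (gX_sym ys SXs) lam0 d0 pXP pGP
  (fun W sW => gX_bound SXs Kys sW) SX tX sGr eta0 s0 hsg UU AE na ri.
rewrite -(ler_pM2l q0) => h; apply: le_trans h _.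
rewrite !mulrA [q * eps']mulrC mulfK ?gt_eqF // ler_wpM2r //.
apply: le_trans heps; rewrite ler_pM2l // ler_expR lerN2 ler_pM2l //.
exact: spectral_margin.
Qed.

Lemma ln_1B_ge (e : R) : 0 <= e <= 2^-1 -> - ln (1 - e) <= 2 * e.
Proof.
move=> /andP[e0 e1]; have h0 : 0 < 1 - e by lra.
have h1 := ln_ge1V h0.
have h2 : (1 - e)^-1 <= 1 + 2 * e.
  by rewrite -[leLHS]mul1r ler_pdivrMr //; nra.
lra.
Qed.

Lemma mirror_prox_step X Z X' y w y' (eps eps' : R) :
  spectrahedron X -> posdef X -> tail_bound r (eps' / q) X -> K y -> D y ->
  D w -> D y' ->
  0 < eps -> eps <= R0 / 100 -> eps <= 2^-1 -> 0 < eps' -> eps' <= R0 / 100 ->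
  eps' * expR (- (eta * (delta / 4))) <= eps ->
  2 * (eta * G) * eps + 2 * eps ^+ 2 <= R0 ^+ 2 / 50 ->
  bregX Xs X + bregY ys y <= 51 / 50 * R0 ^+ 2 ->
  approx_meg_step r eta eps X (gX X y) Z ->
  prox_step ip K om gom eta y (gY X y) w ->
  approx_meg_step r eta eps X (gX Z w) X' ->
  prox_step ip K om gom eta y (gY Z w) y' ->
  [/\ spectrahedron Z, K w,
      forall W, W^T = W -> `|\tr ((gX Z w - gX Xs ys) *m W)| <= delta / 5 * nuc W,
      [/\ spectrahedron X', posdef X', tail_bound r (eps / q) X' & K y'] &
      forall u v, spectrahedron u -> K v ->
      eta * (\tr (gX Z w *m (Z - u)) - ip (gY Z w) (w - v)) <=
      bregX u X + bregY v y - (bregX u X' + bregY v y') + (2 * (eta * G) + 3) * eps].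
Proof.
move=> SX pX tX Ky Dy Dw Dy' e0 eR e1 e'0 e'R eps_ratio err PHI mZ pw mX py.
have [Kw _] := pw; have [Ky' _] := py.
have lt01 : 0 < eps < 1 by move: e0 e1 => -> /=; lra.
have R02 : 0 <= R0 ^+ 2 by exact: sqr_ge0.
have sX := spectrahedron_sym SX; have sXs := spectrahedron_sym SXs.
have BX0 := bregX_ge0 SXs SX pX.
have BY := bregY_ge cK sc c1 Dy Ky Kys.
have pinX := pinsker SXs SX pX.
have N0 : 0 <= nuc (Xs - X) := nuclear_norm_ge0 _.
have M0 : 0 <= `|ys - y| by [].
have R0' := ltW R00.
have [N2 M2] := close_start pinX BY PHI R0' N0 M0 BX0.
have bXb : bX <= beta by rewrite le_max lexx.
have bXYb : bXY <= beta by rewrite le_max lexx orbT.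
have bR : 0 <= beta * R0 by rewrite mulr_ge0.
have wide x : x <= 15 / 10 * R0 -> x <= 21 / 10 * R0.
  by move/le_trans; apply; rewrite ler_pM2r // ler_pM2r ?invr_gt0 ?ltr0n // ler_nat.
have sg1 : bX * nuc (Xs - X) + bXY * `|ys - y| <= 42 / 10 * (beta * R0).
  exact: (close_gradients X0 XY0 bXb bXYb N0 M0 (wide _ N2) (wide _ M2)).
have hsg1 W : W^T = W -> `|\tr ((gX X y - gX Xs ys) *m W)| <=
    (bX * nuc (Xs - X) + bXY * `|ys - y|) * nuc W.
  by move=> sW; have := gX_lip SX SXs Ky Kys sW; rewrite (nuclear_norm_distC sX sXs) (distrC y).
have [Ze [k1 [SZe pZe lZe ZZe [SZ pZ bZ _]]]] :=
  meg_step_near SX pX tX (gX_sym y SX) hsg1 lt01 e'0 e'R eps_ratio N2 sg1 mZ.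
have sZ := spectrahedron_sym SZ; have sZe := spectrahedron_sym SZe.
set e := nuc (Ze - X); set h := `|w - y|.
have e00 : 0 <= e := nuclear_norm_ge0 _.
have h00 : 0 <= h by rewrite /h.
have ZX' := le_trans (nuclear_norm_triangle sZ sX sZe) (lerD ZZe (lexx _)).
have ZX : nuc (Z - X) <= e + 2 * eps by rewrite [leRHS]addrC; exact: ZX'.
have gGh : `|\tr (gX Z w *m (Z - Ze))| <= G * (2 * eps).
  apply: le_trans (gX_bound SZ Kw (subr_sym sZ sZe)) _.
  by rewrite ler_pM2l.
have LX : bX * nuc (Z - X) + bXY * h <= bX * (e + 2 * eps) + bXY * h.
  by rewrite lerD2r ler_wpM2l.
have LY : bY * h + bYX * nuc (Z - X) <= bY * h + bYX * (e + 2 * eps).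
  by rewrite lerD2l ler_wpM2l.
have crossX A B : A^T = A -> B^T = B -> eta * \tr ((gX Z w - gX X y) *m (A - B)) <=
    eta * ((bX * (e + 2 * eps) + bXY * h) * nuc (A - B)).
  move=> sA sB; rewrite (ler_pM2l eta0); apply: le_trans (ler_norm _) _.
  apply: le_trans (gX_lip SZ SX Kw Ky (subr_sym sA sB)) _.
  by rewrite ler_wpM2r ?nuclear_norm_ge0.
have crossY v : eta * ip (gY Z w - gY X y) v <=
    eta * ((bY * h + bYX * (e + 2 * eps)) * `|v|).
  rewrite (ler_pM2l eta0); apply: le_trans (gY_lip v SZ SX Kw Ky) _.
  by rewrite ler_wpM2r.
have pe := pinsker SZe SX pX; rewrite -/e in pe.
have ph := bregY_ge cK sc c1 Dy Ky Kw; rewrite -/h in ph.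
have tp1 := bregX_three_point SXs SZe lZe.
have pp1 := prox_three_point cK c1 pw Dw Kys.
have dX := pinsker SXs SZe pZe.
have dY := bregY_ge cK sc c1 Dw Kw Kys.
set a := nuc (Xs - Ze) in dX; set b := `|ys - w| in dY.
have a0 : 0 <= a := nuclear_norm_ge0 _.
have b0 : 0 <= b by rewrite /b.
(* The linearized gap against the saddle point is nonnegative, so dropping it leaves the distances
   from [(Ze, w)] to the saddle point, controlled by the Bregman distances at [(X, y)]. *)
have gap0 := le_trans (saddle_gap_ge0 SZ Kw) (duality_gap_le SZ Kw SXs Kys).
have := crossX Ze Xs sZe sXs; rewrite (nuclear_norm_distC sZe sXs) -/a => cX.
have := crossY (ys - w); rewrite -/b => cY.
have yc := young_cross4 eta1 eta2 a b e h eps.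
have eG : eta * \tr (gX Z w *m (Z - Ze)) <= 2 * (eta * G) * eps.
  have -> : 2 * (eta * G) * eps = eta * (G * (2 * eps)) by ring.
  by rewrite (ler_pM2l eta0); exact: le_trans (ler_norm _) gGh.
have mid : a ^+ 2 / 4 + b ^+ 2 / 4 <= bregX Xs X + bregY ys y + 2 * (eta * G) * eps + 2 * eps ^+ 2.
  have egap : 0 <= eta * (\tr (gX Z w *m (Z - Xs)) - ip (gY Z w) (w - ys)).
    by rewrite mulr_ge0 // ltW.
  have E1 : \tr (gX Z w *m (Z - Xs)) = \tr (gX Z w *m (Z - Ze)) +
     \tr ((gX Z w - gX X y) *m (Ze - Xs)) + \tr (gX X y *m (Ze - Xs)).
    by rewrite mulmxBl !mulmxBr !raddfB /=; ring.
  have E2 : ip (gY Z w) (w - ys) = ip (gY X y) (w - ys) - ip (gY Z w - gY X y) (ys - w).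
    by rewrite !ipBl !ipBr; ring.
  rewrite E1 E2 in egap.
  exact: (midpoint_energy egap eG cX cY tp1 pp1 yc dX dY pe ph).
have [aR bR'] := close_midpoint mid err PHI R0' a0 b0.
have ZXs : nuc (Xs - Z) <= 21 / 10 * R0.
  apply: le_trans (nuclear_norm_triangle sXs sZ sZe) _; rewrite -/a.
  rewrite (nuclear_norm_distC sZe sZ); exact: (close_approx aR ZZe eR R0').
have ZXs0 : 0 <= nuc (Xs - Z) := nuclear_norm_ge0 _.
(* Only now is the gradient at [(Z, w)] known to be near the one at the saddle point, so that the
   second update can be opened. *)
have sg2 : bX * nuc (Xs - Z) + bXY * b <= 42 / 10 * (beta * R0).
  have b21 : b <= 21 / 10 * R0.
    apply: le_trans bR' _; rewrite ler_pM2r // ler_pdivrMr ?ltr0n // mulrAC.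
    by rewrite ler_pdivlMr ?ltr0n // -!natrM ler_nat.
  exact: (close_gradients X0 XY0 bXb bXYb ZXs0 b0 ZXs b21).
have hsg2 W : W^T = W -> `|\tr ((gX Z w - gX Xs ys) *m W)| <=
    (bX * nuc (Xs - Z) + bXY * b) * nuc W.
  by move=> sW; have := gX_lip SZ SXs Kw Kys sW; rewrite (nuclear_norm_distC sZ sXs) (distrC w).
have [Xe [k2 [SXe pXe lXe _ [SX' pX' bX' tX']]]] :=
  meg_step_near SX pX tX (gX_sym w SZ) hsg2 lt01 e'0 e'R eps_ratio N2 sg2 mX.
have sXe := spectrahedron_sym SXe.
split; [exact: SZ | exact: Kw | | by split | ].
  move=> W sW; apply: le_trans (hsg2 W sW) _; rewrite (ler_wpM2r (nuclear_norm_ge0 W)) //.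
  apply: le_trans sg2 _; have GR : 0 <= G * R0 := mulr_ge0 (ltW G0) R0'.
  have GRl : 0 <= G * R0 / lam := divr_ge0 GR (ltW lam0).
  exact: (radius_fraction key GR GRl (lexx _) bR).
move=> u v Su Kv.
have tq1 := bregX_three_point Su SXe lXe.
have tq2 := bregX_three_point SXe SZe lZe.
have pq1 := prox_three_point cK c1 py Dy' Kv.
have pq2 := prox_three_point cK c1 pw Dw Ky'.
have := bX' u Su => lnb.
have lne : - ln (1 - eps) <= 2 * eps by apply: ln_1B_ge; rewrite e1 (ltW e0).
have pp := pinsker SXe SZe pZe; rewrite (nuclear_norm_distC sXe sZe) in pp.
have pq := bregY_ge cK sc c1 Dw Kw Ky'.
have cX' := crossX Ze Xe sZe sXe.
have cY' := crossY (y' - w).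
set p := nuc (Ze - Xe) in pp cX'; set qq := `|y' - w| in pq cY'.
have yc' := young_cross eta1 eta2 p qq e h eps.
(* Passing through [Ze] and [Xe] separates the approximation error, the change of gradient between
   the half-steps, and two exact updates to which [bregX_three_point] applies. *)
have F1 : \tr (gX Z w *m (Z - u)) = \tr (gX Z w *m (Z - Ze)) +
   \tr ((gX Z w - gX X y) *m (Ze - Xe)) + \tr (gX X y *m (Ze - Xe)) +
   \tr (gX Z w *m (Xe - u)).
  by rewrite mulmxBl !mulmxBr !raddfB /=; ring.
have F2 : ip (gY Z w) (w - v) = ip (gY Z w) (y' - v) + ip (gY X y) (w - y')
    - ip (gY Z w - gY X y) (y' - w).
  by rewrite !ipBl !ipBr; ring.
have ee : eps ^+ 2 <= eps by rewrite expr2 ler_piMr ?(ltW e0) //; case/andP: lt01 => _ /ltW.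
rewrite F1 F2 mulrDl.
exact: (step_energy eG cX' cY' tq1 tq2 pq1 pq2 lnb lne yc' pp pq pe ph ee).
Qed.

End mirror_prox.

(** * The regularized starting point *)

Section initialization.
Context {R : realType} {n : nat}.
Implicit Types (X u : 'M[R]_n).

Lemma idempotent_entropy u : spectrahedron u -> u *m u = u -> \tr (u *m logmx u) = 0.
Proof.
case=> /psd_specmx [U [d [UU -> _ d0]]] _; rewrite specmxM // => uu.
rewrite /logmx mxfun_specmx // specmxM // tr_specmx //; apply: big1 => i _.
have := congr1 (quad (row i U)) uu; rewrite !quad_row_specmx // !mxE => E.
have [->|di] := eqVneq (d 0 i) 0; first by rewrite mul0r.
suff -> : d 0 i = 1 by rewrite ln1 mulr0.
by apply: (mulfI di); rewrite E mulr1.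
Qed.

Lemma entropy_le0 u : spectrahedron u -> \tr (u *m logmx u) <= 0.
Proof.
move=> [/psd_specmx [U [d [UU -> _ d0]]]]; rewrite tr_specmx // => d1.
rewrite /logmx mxfun_specmx // specmxM // tr_specmx //.
apply: sumr_le0 => i _; rewrite !mxE mulr_ge0_le0 // ln_le0 //.
by rewrite -d1 (bigD1 i) //= lerDl sumr_ge0.
Qed.

(** The least eigenvalue of [X1] is eps / n, taken on the kernel of [X0]; a rank one point there has
    zero entropy and lies at distance - ln (eps / n). The last clause measures how far other points
    stay below that value, because ln has slope at least 1 on (0, 1]. *)
Lemma regularized_start (r : nat) X0 (eps : R) :
  spectrahedron X0 -> \rank X0 = r -> (0 < r)%N -> (r < n)%N -> 0 < eps < 1 ->
  let X1 := (1 - eps) *: X0 + (eps / n%:R) *: 1%:M in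
  [/\ spectrahedron X1, posdef X1, tail_bound r (eps / (n%:R - r%:R)) X1,
      exists2 u0, spectrahedron u0 & bregX u0 X1 = - ln (eps / n%:R) &
      forall u, spectrahedron u ->
        bregX u X1 <= - ln (eps / n%:R) - (\tr (u *m X1) - eps / n%:R)].
Proof.
move=> SX0 rX r0 rn /andP[e0 e1] X1.
have [U [d [UU XE nd d0]]] := psd_specmx (proj1 SX0).
have dpos (i : 'I_n) : (0 < d 0 i) = (i < r)%N by rewrite -rX XE; exact: rank_specmx_noninc.
have d1 : \sum_i d 0 i = 1 by rewrite -(proj2 SX0) XE tr_specmx.
have dle1 i : d 0 i <= 1 by rewrite -d1 (bigD1 i) //= lerDl sumr_ge0.
have n0 : 0 < n%:R :> R by rewrite ltr0n (leq_ltn_trans _ rn).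
have n1 : 1 <= n%:R :> R by rewrite ler1n (leq_ltn_trans _ rn).
set k := eps / n%:R; have k0 : 0 < k by rewrite divr_gt0.
have ke : k <= eps by rewrite /k ler_pdivrMr // ler_peMr // ltW.
pose z : 'rV[R]_n := \row_i ((1 - eps) * d 0 i + k).
have zE i : z 0 i = (1 - eps) * d 0 i + k by rewrite mxE.
have X1E : X1 = specmx U z.
  rewrite /X1 XE -/k -(specmx_const 1 UU) -!specmxZ -specmxD; congr specmx.
  by apply/rowP => i; rewrite !mxE mulr1.
clearbody X1.
have e1' : 0 <= 1 - eps by lra.
have zk i : k <= z 0 i by rewrite zE lerDr mulr_ge0.
have z0 i : 0 < z 0 i by apply: lt_le_trans (zk i).
have z1 i : z 0 i <= 1.
  have : (1 - eps) * d 0 i <= (1 - eps) * 1 by rewrite ler_wpM2l.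
  by rewrite zE; lra.
have ztail (i : 'I_n) : (r <= i)%N -> z 0 i = k.
  move=> ri; rewrite zE; have -> : d 0 i = 0.
    by apply/eqP; rewrite eq_le d0 andbT leNgt dpos -leqNgt.
  by rewrite mulr0 add0r.
have SX1 : spectrahedron X1.
  rewrite X1E; apply: spectrahedron_specmx => // [i|]; first exact: ltW.
  under eq_bigr do rewrite zE.
  rewrite big_split /= -big_distrr /= d1 mulr1 sumr_const card_ord -mulr_natr.
  by rewrite /k divfK ?gt_eqF // subrK.
have lz i : map_mx (@ln R) z 0 i = ln (z 0 i) by rewrite mxE.
split=> //.
- by exists U, z.
(* The columns span the range of [X0]. The flat value eps / n is below the eps / (n - r) of the
   later iterates, so one form of [tail_bound] serves from the start. *)
- pose V : 'M[R]_(n, r) := \matrix_(i, j) U (widen_ord (ltnW rn) j) i.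
  have q0 : 0 < n%:R - r%:R :> R by rewrite subr_gt0 ltr_nat.
  have kq : k <= eps / (n%:R - r%:R).
    rewrite /k ler_pM2l // lef_pV2 ?posrE //.
    by rewrite lerBlDr lerDl ler0n.
  exists V => v vV.
  have vU (i : 'I_n) : (i < r)%N -> (v *m U^T) 0 i = 0.
    move=> ir; have -> : (v *m U^T) 0 i = (v *m V) 0 (Ordinal ir).
      rewrite !mxE; apply: eq_bigr => j _; rewrite !mxE; congr (_ * U _ j).
      exact: val_inj.
    by rewrite vV mxE.
  rewrite X1E /logmx mxfun_specmx // !quad_specmx (dot_orth v UU) !big_distrr /=.
  split; apply: ler_sum => i _; rewrite ?lz; (have [ir|ri] := ltnP i r;
    first by rewrite vU // expr0n /= !mulr0); rewrite ztail // ler_wpM2r ?sqr_ge0 //.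
  by rewrite ler_ln ?posrE // divr_gt0.
- pose i0 := Ordinal rn; pose x := row i0 U.
  have x1 : (x *m x^T) 0 0 = 1 by rewrite orth_rows // eqxx.
  exists (x^T *m x); first exact: rank1_spectrahedron.
  have uu : (x^T *m x) *m (x^T *m x) = x^T *m x.
    have -> : (x^T *m x) *m (x^T *m x) = x^T *m (x *m x^T) *m x by rewrite !mulmxA.
    by rewrite [x *m x^T](@mx11_eq _ _ 1%:M) ?mulmx1 // x1 mx00_1.
  rewrite /bregX raddfB /= (idempotent_entropy (rank1_spectrahedron x1) uu) sub0r.
  rewrite mxtrace_mulC tr_rank1 X1E /logmx mxfun_specmx // quad_row_specmx //.
  by rewrite lz ztail.
- move=> u Su; rewrite /bregX raddfB /=.
  have h0 := entropy_le0 Su.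
  suff : ln k + (\tr (u *m X1) - k) <= \tr (u *m logmx X1) by lra.
  have E : ln k + (\tr (u *m X1) - k) = \tr (u *m ((ln k - k)%:M + X1)).
    rewrite mulmxDr mxtraceD mul_mx_scalar mxtraceZ (proj2 Su) mulr1; ring.
  rewrite E -subr_ge0 -raddfB /= -mulmxBr; apply: tr_psd_ge0; first by case: Su.
  rewrite X1E /logmx mxfun_specmx // -(specmx_const _ UU) -specmxD -specmxB.
  apply: specmx_psd => i; rewrite !mxE -zE subr_ge0.
  have h1 := ln_ge1V (divr_gt0 (z0 i) k0).
  rewrite ln_div ?posrE // invf_div in h1.
  (* Equivalent to (z - k) (1 - z) >= 0. *)
  have h2 : k / z 0 i <= 1 - z 0 i + k.
    rewrite ler_pdivrMr //; have := zk i; have := z1 i; have := z0 i; nra.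
  lra.
Qed.

End initialization.

Lemma telescope_le (R : realFieldType) (a B : nat -> R) (kappa : R) (T : nat) :
  0 <= kappa -> (1 <= T)%N ->
  (forall t, (1 <= t)%N -> a t <= B t - B t.+1 + kappa * (t%:R^-1 - t.+1%:R^-1)) ->
  \sum_(1 <= t < T.+1) a t <= B 1%N - B T.+1 + kappa.
Proof.
move=> k0 T1 h.
suff : \sum_(1 <= t < T.+1) a t <= B 1%N - B T.+1 + kappa * (1 - T.+1%:R^-1).
  move/le_trans; apply; rewrite lerD2l ler_piMr // gerBl invr_ge0 ler0n //.
elim: T T1 => [//|[_ _|T IH _]].
  by rewrite big_nat1; have := h 1%N isT; rewrite invr1.
rewrite big_nat_recr //=; have := IH isT; have := h T.+2 isT.
move: (T.+2%:R^-1) (T.+3%:R^-1) => p p'; lra.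
Qed.

Section eps_bounds.
Context {R : realFieldType}.

(** The maximum M is at least 1 and at least g, so C M <= R0^4 / 16 <= R0^2 / 900 bounds both e and
    g e. The cubic decay dominates t (t + 1), whose inverse is 1 / t - 1 / (t + 1); this makes the
    errors telescope. *)
Lemma eps_numeric (C R0 g c lam : R) (t : nat) :
  0 < R0 -> R0 <= 2 / 15 -> R0 <= lam / 5 -> 0 < g -> 0 < c ->
  0 < C -> C <= R0 ^+ 4 / (16 * Num.max (g ^+ 2) 1) ->
  let e := C / (t%:R + 1 + c) ^+ 3 in
  [/\ 0 < e, e <= R0 / 100, e <= lam / 100, 2 * g * e + 2 * e ^+ 2 <= R0 ^+ 2 / 50 &
      (1 <= t)%N -> (2 * g + 3) * e <= R0 ^+ 2 / 100 * (t%:R^-1 - t.+1%:R^-1)].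
Proof.
move=> R00 R0s R0l g0 c0 C0 hC e.
have tn : 0 <= t%:R :> R := ler0n _ _.
set a := t%:R + 1 + c; have a1 : 1 <= a by rewrite /a; lra.
have a0 : 0 < a by lra.
set M := Num.max _ _ in hC.
have M1 : 1 <= M by rewrite le_max lexx orbT.
have Mg : g <= M.
  rewrite le_max; have [g1|g1] := leP g 1; first by rewrite orbT.
  by rewrite expr2 ler_peMl // ltW.
have M0 : 0 < M by lra.
have R2 : R0 ^+ 2 <= 4 / 225.
  have : R0 ^+ 2 <= (2 / 15) ^+ 2 by rewrite ler_pXn2r ?nnegrE //; lra.
  by rewrite !expr2; lra.
have R4 : R0 ^+ 4 = R0 ^+ 2 * R0 ^+ 2 by ring.
have R20 : 0 < R0 ^+ 2 by rewrite exprn_gt0.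
have R4le : R0 ^+ 4 <= R0 ^+ 2 * (4 / 225) by rewrite R4 ler_pM2l.
have CM : C * M <= R0 ^+ 4 / 16.
  move: hC; rewrite invfM mulrA ler_pdivlMr //.
have e0 : 0 < e by rewrite divr_gt0 // exprn_gt0.
have a31 : 1 <= a ^+ 3 by rewrite exprn_ege1.
have eC : e <= C by rewrite ler_pdivrMr ?exprn_gt0 // ler_peMr // ltW.
have CCM : C <= C * M by rewrite ler_peMr // ltW.
have CgM : C * g <= C * M by rewrite ler_pM2l.
have eg : g * e <= C * M by apply: le_trans CgM; rewrite mulrC ler_pM2r.
have C1 : C <= 1 by lra.
have ee : e ^+ 2 <= e by rewrite expr2 ler_piMr // ?ltW //; lra.
have R2R : R0 ^+ 2 <= R0 * (2 / 15) by rewrite expr2 ler_pM2l.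
split=> //; try lra.
move=> t1; have T0 : 0 < t%:R :> R by rewrite ltr0n.
have T1 : 0 < t.+1%:R :> R by rewrite ltr0n.
have -> : t%:R^-1 - t.+1%:R^-1 = (t%:R * t.+1%:R)^-1 :> R.
  by rewrite -natr1; field; rewrite natr1 !gt_eqF.
have at1 : t.+1%:R <= a by rewrite -natr1 /a; lra.
have att : t%:R <= a by rewrite /a; lra.
have atp : t%:R * t.+1%:R <= a ^+ 3.
  apply: (@le_trans _ _ (a * a)); first by apply: ler_pM => //; exact: ler0n.
  by rewrite 2!exprSr expr1 ler_peMr // mulr_ge0 // ltW.
have h : (2 * g + 3) * C <= R0 ^+ 2 / 100 by lra.
rewrite /e mulrA; apply: ler_pM => //.
- by rewrite mulr_ge0 ?ltW //; lra.
- by rewrite invr_ge0 exprn_ge0 // ltW.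
- by rewrite lef_pV2 ?posrE ?exprn_gt0 ?mulr_gt0.
Qed.

End eps_bounds.

(** With at least half of the mass off [P], the saddle gradient gains delta / 2, while exchanging
    that gradient for the current one loses at most 2 delta / 5. *)
Lemma first_order_gain (R : realFieldType) (delta N x a b p : R) : 0 <= delta ->
  - (delta / 5 * N) <= x - (a - b) -> b + delta * (1 - p) <= a ->
  delta / 5 * N <= delta / 5 * 2 -> delta * p <= delta * 2^-1 -> 0 <= x.
Proof. rewrite mulrBr mulr1; lra. Qed.

(** The slack a - k is at least lam / 2 - R0 - lam / 100 >= 29 lam / 100, more than R0^2 / 100. *)
Lemma slack_absorbs_error (R : realFieldType) (lam R0 e k N B a b p l : R) :
  B <= l - (a - k) -> lam * p <= b -> lam * 2^-1 <= lam * p -> b - a <= N -> N <= R0 ->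
  R0 <= lam / 5 -> R0 ^+ 2 <= R0 * 1 -> k <= e -> e <= lam / 100 -> 0 < R0 ->
  B + R0 ^+ 2 / 100 <= l.
Proof. lra. Qed.

Theorem theorem2 (R : realType) (n : nat) (V : normedVectType R)
    (ip : {dot V for idfun}) (K : set V) (f : 'M[R]_n -> V -> R)
    (bX bY bXY bYX : R) (om : V -> R) (gom : V -> V) (D : set V)
    (Xs : 'M[R]_n) (ys : V) (rs : nat) (delta G teps c : R)
    (eps : nat -> R) (X Z : nat -> 'M[R]_n) (y w : nat -> V) :
  let eta := step_size bX bY bXY bYX in
  let R0 := init_radius rs (eigval rs Xs) bX bXY G delta in
  K !=set0 -> compact K -> convex_set K ->
  differentiable_SnV ip f ->
  (forall v, K v -> convex_function symmx (fun A => f A v)) ->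
  (forall A, spectrahedron A -> convex_function K (fun v => - f A v)) ->
  0 <= bX -> 0 <= bY -> 0 <= bXY -> 0 <= bYX ->
  ~ [/\ bX = 0, bY = 0, bXY = 0 & bYX = 0] ->
  smooth_on ip K f bX bY bXY bYX ->
  D `<=` K -> strongly_convex1 K om -> C1_in ip K D om gom ->
  saddle_point K f Xs ys ->
  rs = \rank Xs -> (rs <= n - 1)%N ->
  0 < delta ->
  eigval (n - rs) (gradX ip f Xs ys) - eigval n (gradX ip f Xs ys) >= delta ->
  low_rank_mirror_prox ip K f om gom (fun=> eta) eps rs X Z y w ->
  (forall t, (1 <= t)%N -> D (y t) /\ D (w t.+1)) ->
  (ereal_sup [set (spectral_norm (gradX ip f p.1 p.2))%:E
             | p in spectrahedron `*` K] <= G%:E)%E ->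
  0 < teps -> teps <= R0 ^+ 2 -> c >= 12 / (eta * delta) ->
  (forall t, eps t = eps_seq bX bXY G eta delta teps c t) ->
  bregX Xs (X 1%N) <= R0 ^+ 2 / 2 ->
  bregY ip om gom ys (y 1%N) <= R0 ^+ 2 / 2 ->
  forall T : nat, (1 <= T)%N ->
  let D2 := ereal_sup [set (bregX p.1 (X 1%N) + bregY ip om gom p.2 (y 1%N))%:E
                      | p in spectrahedron `*` K] in
  exists M m : R,
  [/\ is_max K (f (T%:R^-1 *: \sum_(1 <= t < T.+1) Z t.+1)) M,
      is_min spectrahedron (f^~ (T%:R^-1 *: \sum_(1 <= t < T.+1) w t.+1)) m &
      ((M - m)%:E <= D2 * ((eta * T%:R)^-1)%:E
        + ((eta^-1 + 2 * (bX + bYX)) / (16 * Num.max (G ^+ 2 * eta ^+ 2) 1)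
             * (R0 ^+ 4 / T%:R)
           + R0 ^+ 2 / (Num.max eta 1 * T%:R))%:E)%E].
Proof.
move=> eta R0 K0 Kc cK df cf cvf X0 Y0 XY0 YX0 nz sm DK sc c1 sad rE rn1 d0 gap mp hD
  supG t0 tR hc epsE BX1 BY1 T T1 D2.
have [eta0 eta1 eta2] := step_size_spec X0 Y0 XY0 YX0 nz.
rewrite -/eta in eta0 eta1 eta2.
have [SXs Kys sadP] := sad.
have hG A v : spectrahedron A -> K v -> spectral_norm (gradX ip f A v) <= G.
  move=> SA Kv; rewrite -lee_fin; apply: le_trans supG.
  by apply: ereal_sup_ubound; exists (A, v).
have opt A : spectrahedron A ->
    \tr (gradX ip f Xs ys *m Xs) <= \tr (gradX ip f Xs ys *m A).
  by apply: (gradX_optimal df) => // B SB; have [] := sadP B ys SB Kys.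
have sGs := gradX_sym df ys (spectrahedron_symmx SXs).
have [r0 rn lam01 dG' [P [pP pCP pXP pGP]]] := eigengap_structure SXs sGs rE rn1 d0 gap opt.
set lam := eigval rs Xs in R0 tR BX1 BY1 lam01 pXP *.
have [lam0 lam1] := andP lam01.
have dG : delta <= 2 * G.
  by apply: le_trans dG' _; rewrite ler_pM2l // hG.
have G0 : 0 < G by rewrite -(@pmulr_rgt0 _ 2) //; exact: lt_le_trans d0 dG.
have [R00 R0lam R0s key] := init_radius_spec X0 XY0 r0 lam01 d0 dG.
rewrite -/R0 in R00 R0lam R0s key.
have c0 : 0 < c by apply: lt_le_trans hc; rewrite divr_gt0 ?mulr_gt0.
have [C /andP[C0 hC] epsE'] := eps_seq_spec G eta X0 XY0 d0 t0 (ltW c0).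
have g0 : 0 < eta * G by rewrite mulr_gt0.
have CR : C <= R0 ^+ 4 / (16 * Num.max ((eta * G) ^+ 2) 1).
  have E : (eta * G) ^+ 2 = G ^+ 2 * eta ^+ 2 by ring.
  apply: le_trans hC _; rewrite E ler_wpM2r //.
    by rewrite invr_ge0 mulr_ge0 // le_max ler01 orbT.
  by rewrite (exprM R0 2 2) ler_pXn2r // nnegrE ?exprn_ge0 // ltW.
have num t := eps_numeric t R00 R0s R0lam g0 c0 C0 CR.
(* The outer minimum with 1 is inactive: the other term is at most R0 / 100. *)
have epsC t : eps t = C / (t%:R + 1 + c) ^+ 3.
  rewrite epsE epsE' min_r //; have [_ h _ _ _] := num t.
  by apply: le_trans h _; rewrite ler_pdivrMr ?ltr0n // mul1r; lra.
have {}num t : [/\ 0 < eps t, eps t <= R0 / 100, eps t <= lam / 100,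
    2 * (eta * G) * eps t + 2 * eps t ^+ 2 <= R0 ^+ 2 / 50 &
    (1 <= t)%N -> (2 * (eta * G) + 3) * eps t <= R0 ^+ 2 / 100 * (t%:R^-1 - t.+1%:R^-1)].
  by rewrite epsC; exact: num.
have half : R0 / 100 <= 2^-1 by lra.
have [[SX0 rX0] Ky1 X1E stepZ stepw stepX stepy] := mp.
have [e00 eR0 elam0 _ _] := num 0%N.
have e01 : 0 < eps 0%N < 1 by rewrite e00 /=; lra.
have := regularized_start SX0 rX0 r0 rn e01; rewrite -X1E.
move=> [SX1 pX1 tX1 [u0 Su0 bu0] bXle].
set q := n%:R - rs%:R in tX1.
pose Phi t := bregX Xs (X t) + bregY ip om gom ys (y t).
(* [eps t.-1] is the tail level left by the previous update; at t = 1 it is that of the regularized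
   start. The two initial halves make R0^2, and the errors may add a further hundredth, released as
   1 - 1 / t. *)
pose inv t := [/\ spectrahedron (X t), posdef (X t), tail_bound rs (eps t.-1 / q) (X t),
  K (y t) & Phi t <= R0 ^+ 2 + R0 ^+ 2 / 100 * (1 - t%:R^-1)].
have R02 : 0 < R0 ^+ 2 by rewrite exprn_gt0.
have step t : (1 <= t)%N -> inv t -> [/\ spectrahedron (Z t.+1), K (w t.+1),
      forall W, W^T = W -> `|\tr ((gradX ip f (Z t.+1) (w t.+1) - gradX ip f Xs ys) *m W)|
         <= delta / 5 * nuclear_norm W,
      [/\ spectrahedron (X t.+1), posdef (X t.+1),
          tail_bound rs (eps t / q) (X t.+1) & K (y t.+1)] &
      forall u v, spectrahedron u -> K v ->
      eta * (\tr (gradX ip f (Z t.+1) (w t.+1) *m (Z t.+1 - u))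
               - ip (gradY ip f (Z t.+1) (w t.+1)) (w t.+1 - v)) <=
      bregX u (X t) + bregY ip om gom v (y t)
      - (bregX u (X t.+1) + bregY ip om gom v (y t.+1)) + (2 * (eta * G) + 3) * eps t].
  move=> t1 [SX pX tX Ky Ph].
  have [Dy Dw] := hD t t1; have [Dy' _] := hD t.+1 isT.
  have [et etR _ err _] := num t; have [et' et'R _ _ _] := num t.-1.
  apply: (mirror_prox_step cK df cf cvf X0 XY0 YX0 sm sc c1 sad eta0 eta1 eta2 hG r0 rn
    lam0 d0 dG R00 key pXP pGP SX pX tX Ky Dy Dw Dy' et etR (le_trans etR half) et' et'R _ err _
    (stepZ t t1) (stepw t t1) (stepX t t1) (stepy t t1)).
    by rewrite !epsC; exact: eps_ratio.
  (* The invariant stays below 101 / 100 of R0^2, within the 51 / 50 required. *)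
  have : 0 <= t%:R^-1 :> R by rewrite invr_ge0 ler0n.
  rewrite -/(Phi t); move: Ph R02; set p := t%:R^-1; nra.
have invP t : (1 <= t)%N -> inv t.
  elim: t => [//|t IH] _; have [t0'|t1] := posnP t.
    rewrite t0'; split=> //.
    by rewrite invr1 subrr mulr0 addr0 /Phi; lra.
  have [SZ Kw _ [SX pX tX Ky] ineq] := step t t1 (IH t1).
  have [_ _ _ _ Ph] := IH t1.
  split=> //; have := ineq Xs ys SXs Kys; rewrite -/(Phi t) -/(Phi t.+1) => h.
  have gap0 := le_trans (saddle_gap_ge0 sad SZ Kw) (duality_gap_le cK df cf cvf SZ Kw SXs Kys).
  have h1 := mulr_ge0 (ltW eta0) gap0.
  have [_ _ _ _ /(_ t1) h2] := num t.
  move: Ph h h1 h2; set p := t%:R^-1; set p' := t.+1%:R^-1; lra.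
set k := eps 0%N / n%:R in bu0 bXle; set l := - ln k in bu0 bXle.
pose gapt u v t := \tr (gradX ip f (Z t.+1) (w t.+1) *m (Z t.+1 - u))
               - ip (gradY ip f (Z t.+1) (w t.+1)) (w t.+1 - v).
have bY0 v t : K v -> (1 <= t)%N -> 0 <= bregY ip om gom v (y t).
  move=> Kv t1; have [_ _ _ Ky _] := invP t t1; have [Dy _] := hD t t1.
  apply: le_trans (bregY_ge cK sc c1 Dy Ky Kv).
  by rewrite mulr_ge0 ?sqr_ge0 // invr_ge0.
have regret u v : spectrahedron u -> K v ->
    \sum_(1 <= t < T.+1) eta * gapt u v t <=
    bregX u (X 1%N) + bregY ip om gom v (y 1%N) + R0 ^+ 2 / 100.
  move=> Su Kv; pose B t := bregX u (X t) + bregY ip om gom v (y t).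
  have k0 : 0 <= R0 ^+ 2 / 100 by apply: divr_ge0; [exact: ltW | exact: ler0n].
  have tel t : (1 <= t)%N -> eta * gapt u v t <=
      B t - B t.+1 + R0 ^+ 2 / 100 * (t%:R^-1 - t.+1%:R^-1).
    move=> t1; have [_ _ _ _ /(_ u v Su Kv) h] := step t t1 (invP t t1).
    have [_ _ _ _ /(_ t1) h2] := num t.
    by apply: le_trans h _; rewrite lerD2l.
  apply: le_trans (telescope_le k0 T1 tel) _.
  have [SX pX _ _ _] := invP T.+1 isT.
  by rewrite lerD2r gerBl addr_ge0 ?bY0 // bregX_ge0.
have SZ t : (1 <= t)%N -> spectrahedron (Z t.+1).
  by move=> t1; have [] := step t t1 (invP t t1).
have Kw t : (1 <= t)%N -> K (w t.+1).
  by move=> t1; have [] := step t t1 (invP t t1).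
set Zb := T%:R^-1 *: \sum_(1 <= t < T.+1) Z t.+1.
set wb := T%:R^-1 *: \sum_(1 <= t < T.+1) w t.+1.
have jZ v : K v -> spectrahedron Zb /\ T%:R * f Zb v <= \sum_(1 <= t < T.+1) f (Z t.+1) v.
  move=> Kv; apply: (@jensen_mean _ _ spectrahedron (f^~ v) (fun t => Z t.+1)) => //.
  - by move=> s a b s01; exact: spectrahedron_conv.
  - move=> s a b s01 Sa Sb; apply: (convex_functionE (cf v Kv)) => //;
      exact: spectrahedron_symmx.
  - by move=> t /andP[t1 _]; exact: SZ.
have jw u : spectrahedron u -> K wb /\ T%:R * - f u wb <= \sum_(1 <= t < T.+1) - f u (w t.+1).
  move=> Su; apply: (@jensen_mean _ _ K (fun v => - f u v) (fun t => w t.+1)) => //.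
  - by move=> s a b s01; exact: convex_setE.
  - by move=> s a b s01 Ka Kb; exact: (convex_functionE (cvf u Su)).
  - by move=> t /andP[t1 _]; exact: Kw.
have [SZb _] := jZ ys Kys.
have [Kwb _] := jw Xs SXs.
have T0 : 0 < T%:R :> R by rewrite ltr0n.
have gap_regret u v : spectrahedron u -> K v ->
    eta * T%:R * (f Zb v - f u wb) <= \sum_(1 <= t < T.+1) eta * gapt u v t.
  move=> Su Kv; rewrite -big_distrr /= -mulrA ler_pM2l // mulrBr.
  have [_ h1] := jZ v Kv; have [_ h2] := jw u Su; rewrite mulrN in h2.
  apply: le_trans (lerD h1 h2) _; rewrite -big_split /=.
  rewrite !big_nat; apply: ler_sum => t /andP[t1 _].
  exact: (duality_gap_le cK df cf cvf (SZ t t1) (Kw t t1) Su Kv).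
have n0 : (0 < n)%N by exact: leq_ltn_trans rn.
have nR0 : 0 < n%:R :> R by rewrite ltr0n.
have k0 : 0 < k by rewrite divr_gt0.
have ke : k <= eps 0%N by rewrite ler_pdivrMr // (ler_peMr (ltW e00)) // ler1n.
(* For the competitor [Xs], the initial distance and the accumulated error fit below l, since l >= 1
   - k with k and R0 small. *)
have l9 : R0 ^+ 2 / 2 + R0 ^+ 2 / 100 <= l.
  have h1 := ln_ge1V (divr_gt0 ltr01 k0).
  rewrite div1r invrK lnV ?posrE // -/l in h1.
  have h2 : R0 ^+ 2 <= R0 * 1 by rewrite expr2 ler_pM2l //; lra.
  apply: le_trans h1; lra.
have bound u v : spectrahedron u -> K v ->
    eta * T%:R * (f Zb v - f u wb) <= l + bregY ip om gom v (y 1%N).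
  move=> Su Kv; apply: le_trans (gap_regret u v Su Kv) _.
  have su := spectrahedron_sym Su; have sXs := spectrahedron_sym SXs.
  have [pu|pu] := leP (\tr (P *m u)) 2^-1.
    (* far from the range of [Xs], comparing with [Xs] instead only loses *)
    apply: (@le_trans _ _ (\sum_(1 <= t < T.+1) eta * gapt Xs v t)).
      rewrite !big_nat; apply: ler_sum => t /andP[t1 _]; rewrite ler_pM2l //.
      rewrite /gapt lerD2r -subr_ge0 -raddfB /= -mulmxBr.
      have -> : Z t.+1 - Xs - (Z t.+1 - u) = u - Xs.
        by rewrite opprB addrC addrA subrK.
      have [_ _ near _ _] := step t t1 (invP t t1).
      have := near _ (subr_sym su sXs).
      have nuc2 : nuclear_norm (u - Xs) <= 2.
        have snXs : (- Xs)^T = - Xs by rewrite linearN /= sXs.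
        apply: le_trans (nuclear_normD su snXs) _.
        by rewrite nuclear_normN // !nuclear_norm_spectrahedron.
      have E : \tr (gradX ip f Xs ys *m (u - Xs)) =
          \tr (gradX ip f Xs ys *m u) - \tr (gradX ip f Xs ys *m Xs).
        by rewrite mulmxBr raddfB.
      rewrite mulmxBl raddfB /= E.
      rewrite ler_norml => /andP[h _].
      have h2 := gap_lower Su pGP.
      have h3 : delta / 5 * nuclear_norm (u - Xs) <= delta / 5 * 2.
        by rewrite ler_pM2l // divr_gt0.
      have h4 : delta * \tr (P *m u) <= delta * 2^-1 by rewrite ler_pM2l.
      exact: (first_order_gain (ltW d0) h h2 h3 h4).
    apply: le_trans (regret Xs v SXs Kv) _.
    rewrite addrAC lerD2r; apply: le_trans l9; rewrite lerD2r.
    exact: BX1.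
  (* Here [u] has more than half of its mass on the range of [Xs], so tr (u X_1) is at least lam / 2
     - R0, and the last clause of [regularized_start] makes room for the error. *)
  apply: le_trans (regret u v Su Kv) _; rewrite addrAC lerD2r.
  have h1 := bXle u Su.
  have sX1 := spectrahedron_sym SX1.
  have N2 := pinsker SXs SX1 pX1.
  have N1 : nuclear_norm (Xs - X 1%N) <= R0.
    apply: (sqr_le_bound (ltW R00) (nuclear_norm_ge0 _) N2).
    by rewrite mulrC -ler_pdivlMr.
  have h2 := proj_upper Su pXP.
  have h3 := tr_spectrahedron_le Su (subr_sym sXs sX1).
  have h4 : lam * 2^-1 <= lam * \tr (P *m u) by rewrite ler_pM2l // ltW.
  rewrite mulmxBr raddfB /= [\tr (u *m Xs)]mxtrace_mulC ler_norml in h3.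
  case/andP: h3 => _ h3.
  have h5 : R0 ^+ 2 <= R0 * 1 by rewrite expr2 ler_pM2l //; lra.
  exact: (slack_absorbs_error h1 h2 h4 h3 N1 R0lam h5 ke elam0 R00).
have [v0 Kv0 vmax] := compact_EVT_max K0 Kc (continuous_fY df (spectrahedron_symmx SZb)).
have S0 : (spectrahedron : set 'M[R]_n) !=set0 by exists Xs.
have [u1 Su1 umin] :=
  compact_EVT_min S0 (@compact_spectrahedron R n) (@continuous_fX _ _ _ _ _ df wb).
rewrite inE in Kv0; rewrite inE in Su1.
exists (f Zb v0), (f u1 wb); split.
- split; first by exists v0.
  by move=> v Kv; apply: vmax; rewrite inE.
- split; first by exists u1.
  by move=> u Su; apply: umin; rewrite inE.
have eT0 : 0 < eta * T%:R by rewrite mulr_gt0.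
apply: lee_paddr.
  rewrite lee_fin; apply: addr_ge0; last first.
    by apply: divr_ge0; [exact: ltW | apply: mulr_ge0; [rewrite le_max ler01 orbT | exact: ltW]].
  apply: mulr_ge0; last by apply: divr_ge0; [rewrite exprn_ge0 // ltW | exact: ltW].
  apply: divr_ge0; last by apply: mulr_ge0; [exact: ler0n | rewrite le_max ler01 orbT].
  by rewrite addr_ge0 ?invr_ge0 ?(ltW eta0) // mulr_ge0 // addr_ge0.
apply: (@le_trans _ _ ((l + bregY ip om gom v0 (y 1%N))%:E * ((eta * T%:R)^-1)%:E)%E).
  by rewrite -EFinM lee_fin ler_pdivlMr // mulrC; exact: bound.
apply: lee_wpmul2r; first by rewrite lee_fin invr_ge0 ltW.
(* [u0] reaches l whatever the dual variable, so it can be paired with the maximizer [v0]. *)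
by apply: ereal_sup_ubound; exists (u0, v0) => //=; rewrite bu0.
Qed.
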